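(* Let $\mathbb{K}$ be a field of characteristic zero. Let $m,k$ be integers with $0\le k\le 12$ and $k\le m$. Then there exists a number $r(m,k)$ with $$ r(m,k) \leq \max \left\{ 6(m+1),\ \frac{4(m+1)(2m+1)}{(k+1)(k+2)} \right\}$$ such that for all nonnegative integers $d,p_0,\dots,p_m$ with $p_k>r(m,k)$ the space $\Gamma_{d,p_0,\dots,p_m}$ has the expected dimension as a vector space over $\mathbb{K}$, i.e. $$\dim \Gamma_{d,p_{0},\dots,p_{m}} = \max \left\{ 0,\ \frac{(d+1)(d+2)}{2} - \sum_{j=0}^{m} p_{j}\frac{(j+1)(j+2)}{2} \right\}.$$
   Context: $\Gamma_{d,p_0,\dots,p_m}$ denotes the space of all plane curves of degree $d$ passing through $p_0$ generic points and having $p_j$ generic singularities of order $j$ for $j=1,\dots,m$. Concretely: choose $p_0+\dots+p_m$ points of $\mathbb{K}^2$, with $p_j$ of them assigned order $j$ ($j=0,\dots,m$). The space is the $\mathbb{K}$-vector space of all polynomials $f\in\mathbb{K}[x_1,x_2]$ of total degree at most $d$ (including $f=0$) such that for every $j$ and every point $q$ of order $j$ all partial derivatives $\frac{\partial^{|\alpha|}f}{\partial x^\alpha}(q)$ with $|\alpha|\le j$ vanish (order $0$ means only $f(q)=0$). ''Generic'' means that the assertion about the dimension holds for all point tuples in some Zariski open, dense subset of $(\mathbb{K}^2)^{p_0+\dots+p_m}$. *)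

(* Defs.v *)
From mathcomp Require Import all_boot all_order all_algebra.
From mathcomp Require Import mpoly.

Set Implicit Arguments.
Unset Strict Implicit.
Unset Printing Implicit Defensive.

Import GRing.Theory Num.Theory.
Local Open Scope ring_scope.

(* A stand-in for [\dim], which the library defines only for subspaces of a
   finite-dimensional space; here the ambient space is {mpoly K[2]}. *)
Definition has_dim (K : fieldType) (V : lmodType K) (S : V -> Prop) (n : nat) :
    Prop :=
  exists b : 'I_n -> V,
    (forall c : 'I_n -> K, \sum_(i < n) c i *: b i = 0 -> forall i, c i = 0) /\
    (forall v : V, S v <-> exists c : 'I_n -> K, v = \sum_(i < n) c i *: b i).

Section Zariski.

Variables (K : fieldType) (I : finType).

(* The affine space K^I is {ffun I -> K}; the variable 'X_i of
   {mpoly K[#|I|]} stands for the coordinate of index [enum_val i]. *)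
Definition coord_eval (f : {mpoly K[#|I|]}) (x : {ffun I -> K}) : K :=
  f.@[fun i : 'I_#|I| => x (enum_val i)].

Definition zariski_open (U : {ffun I -> K} -> Prop) : Prop :=
  exists F : {mpoly K[#|I|]} -> Prop,
    forall x, U x <-> exists2 f, F f & coord_eval f x != 0.

Definition zariski_dense (U : {ffun I -> K} -> Prop) : Prop :=
  forall V, zariski_open V -> (exists x, V x) -> exists2 x, V x & U x.

Definition generically (P : {ffun I -> K} -> Prop) : Prop :=
  exists U, [/\ zariski_open U, zariski_dense U & forall x, U x -> P x].

End Zariski.

Section Curves.

Variables (K : fieldType) (m d : nat) (p : 'I_m.+1 -> nat).

(* A pair (j, i) with i < p j labels the i-th point of order j. *)
Definition point_label : finType := {j : 'I_m.+1 & 'I_(p j)}.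

(* (K^2)^(p_0 + ... + p_m) is {ffun coord_label -> K}. *)
Definition coord_label : finType := (point_label * 'I_2)%type.

Definition point (x : {ffun coord_label -> K}) (q : point_label) : 'I_2 -> K :=
  fun c => x (q, c).

(* [msize f] is the total degree of f plus one, and 0 for f = 0. *)
Definition Gamma (x : {ffun coord_label -> K}) (f : {mpoly K[2]}) : Prop :=
  (msize f <= d.+1)%N /\
  forall (q : point_label) (a : 'X_{1..2}),
    (mdeg a <= tag q)%N -> (f^`M[a]).@[point x q] = 0.

Definition expected_dim : rat :=
  Num.max 0 ((d.+1 * d.+2)%:R / 2 -
             \sum_(j < m.+1) (p j)%:R * ((j.+1 * j.+2)%:R / 2)).

End Curves.

(* Main.v *)
(* A differential condition of order < M at a point p of the torus pairs the
   coefficients of f with a |-> l(a) p^a, where l is a polynomial of degree < M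
   in the exponent a.  Sending p to infinity along a one-parameter subgroup, one
   may trade the point for a "tile": cells swept off the support row by row,
   distinct numbers at most M of cells from the rows it meets (or whole rows),
   so that l can be interpolated there.  It therefore suffices to exhaust, by
   one tile per point, a staircase that has as many cells as there are
   conditions and fills the exponents by increasing degree.

   The points of order other than k go first; eating greedily from the top
   disturbs at most m + 1 rows, and the hypothesis on p_k leaves a large area to
   the remaining points, all of multiplicity M = k + 1 <= 13.  Their greedy
   tiles obey a chip recursion G_q = l_q + sum_i floor((G_{q-i} + i - 1) / M)
   on the row lengths l_q.  Up to the total number of tiles, the recursion
   contracts: its states satisfy explicit linear inequalities with finitely many
   solutions, which coalesce after some further rows into few shapes.  Each shape
   is finished by explicit tiles in other lattice directions.

   Maximal rank of the matrix of conditions is a Zariski open property, so one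
   placement of the points suffices. *)
From Stdlib Require Import ZArith Lia.
Require Import Defs.
From mathcomp Require Import all_boot all_order all_algebra zify ssrZ ring.
From mathcomp Require Import mpoly.

Set Implicit Arguments.
Unset Strict Implicit.
Unset Printing Implicit Defensive.

Import Order.TTheory GRing.Theory Num.Theory.
Local Open Scope ring_scope.
Delimit Scope Z_scope with Z.

(** Where the numbers come from. Put [mu = m + 1]. While the points of other orders are tiled, the
    cells reserved for the points of order k number p_k (k + 1)(k + 2) / 2, and more than 2 mu (2 mu
    - 1) of them guarantee that every tile finds rows long enough; this is the second term of the
    maximum. Those tiles leave at most [mu] irregular rows, and p_k > 6 mu then forces at least
    [window_size k.+1] full rows below them, enough for the finite verification to start; this is
    the first term. The verification is carried out for multiplicities up to 13, hence k <= 12.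

    The obstacle is the end: chip counts keep increasing only while the full rows have length about
    2M, so horizontal tiles cannot reach the bottom, and the states there depend on the number of
    tiles. Discounting k whole tiles commutes with the recursion, and the area determines k; the
    normalised states are therefore bounded independently of the number of points.

    Cells carry the total degree as second coordinate, so rows are homogeneous parts. The staircase
    depends on the number of conditions alone, and one placement of the points serves every degree
    d. *)

Definition cell : Type := (Z * Z)%type.

(** * Interpolation on parallel rows *)

Section Interpolation.

Variable K : fieldType.
Hypothesis charK : [pchar K] =i pred0.

Definition zK (z : Z) : K := (int_of_Z z)%:~R.

Lemma zKD a b : zK (a + b)%Z = zK a + zK b.
Proof. by rewrite /zK -[(a + b)%Z]/(a + b) rmorphD intrD. Qed.

Lemma zKM a b : zK (a * b)%Z = zK a * zK b.
Proof. by rewrite /zK -[(a * b)%Z]/(a * b) rmorphM intrM. Qed.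

Lemma zKB a b : zK (a - b)%Z = zK a - zK b.
Proof. by rewrite /zK -[(a - b)%Z]/(a - b) rmorphB intrB. Qed.

Lemma zK_nat n : zK (Z.of_nat n) = n%:R.
Proof. by rewrite /zK (_ : int_of_Z _ = n :> int) //; lia. Qed.

Lemma natrK_eq0 n : (n%:R == 0 :> K) = (n == 0)%N.
Proof. by move/pcharf0P: charK => ->. Qed.

Lemma intrK_eq0 (z : int) : (z%:~R == 0 :> K) = (z == 0).
Proof.
case: z => n; first by rewrite -pmulrn natrK_eq0.
by rewrite NegzE mulrNz oppr_eq0 -pmulrn natrK_eq0.
Qed.

Lemma zK_eq0 z : (zK z == 0) = (z == 0%Z).
Proof.
rewrite /zK intrK_eq0; apply/eqP/eqP => [h|->//].
by rewrite -(int_of_ZK z) h.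
Qed.

Lemma zK_inj : injective zK.
Proof.
move=> a b h; have: zK (a - b)%Z == 0 by rewrite zKB h subrr.
by rewrite zK_eq0 => /eqP; lia.
Qed.

(* Polynomial functions of degree < n on the exponent lattice. *)
Inductive polf : nat -> (cell -> K) -> Prop :=
| PolfZero n : polf n (fun=> 0)
| PolfConst n c : polf n.+1 (fun=> c)
| PolfAdd n f g : polf n f -> polf n g -> polf n (fun a => f a + g a)
| PolfMul1 n f : polf n f -> polf n.+1 (fun a => zK a.1 * f a)
| PolfMul2 n f : polf n f -> polf n.+1 (fun a => zK a.2 * f a)
| PolfExt n f g : polf n f -> f =1 g -> polf n g.

Lemma polfS n f : polf n f -> polf n.+1 f.
Proof.
elim=> {n f} [n|n c|n f g _ hf _ hg|n f _ hf|n f _ hf|n f g _ hf e].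
- exact: PolfZero.
- exact: PolfConst.
- exact: PolfAdd.
- exact: PolfMul1.
- exact: PolfMul2.
- exact: PolfExt e.
Qed.

Lemma polfW m n f : (m <= n)%N -> polf m f -> polf n f.
Proof.
move=> le hf; rewrite -(subnK le); elim: (n - m)%N => [//|j ih].
by rewrite addSn; apply: polfS.
Qed.

Lemma polfZ n c f : polf n f -> polf n (fun a => c * f a).
Proof.
elim=> {n f} [n|n d|n f g _ hf _ hg|n f _ hf|n f _ hf|n f g _ hf e].
- by apply: PolfExt (PolfZero n) _ => a /=; rewrite mulr0.
- by apply: PolfExt (PolfConst n (c * d)) _ => a.
- by apply: PolfExt (PolfAdd hf hg) _ => a; rewrite /= mulrDr.
- by apply: PolfExt (PolfMul1 hf) _ => a; rewrite /= mulrCA.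
- by apply: PolfExt (PolfMul2 hf) _ => a; rewrite /= mulrCA.
- by apply: PolfExt hf _ => a; rewrite e.
Qed.

Definition aff (t : Z * Z * Z) (a : cell) : Z :=
  (t.1.1 * a.1 + t.1.2 * a.2 + t.2)%Z.

Lemma polf_aff n t f : polf n f -> polf n.+1 (fun a => zK (aff t a) * f a).
Proof.
move=> hf; have h1 := PolfMul1 (polfZ (zK t.1.1) hf).
have h2 := PolfMul2 (polfZ (zK t.1.2) hf).
have h3 := polfS (polfZ (zK t.2) hf).
apply: PolfExt (PolfAdd (PolfAdd h1 h2) h3) _ => a /=.
by rewrite /aff !zKD !zKM; ring.
Qed.

Lemma polf_shift n t z f :
  polf n f -> polf n.+1 (fun a => (zK (aff t a) - zK z) * f a).
Proof.
move=> hf; apply: PolfExt (polf_aff (t.1, (t.2 - z)%Z) hf) _ => a.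
by rewrite -zKB /aff /=; congr (zK _ * _); lia.
Qed.

(** Newton's divided differences in the single coordinate [aff t]: each further cell costs one
    degree. *)
Lemma polf_lagrange t (S : seq cell) (phi : cell -> K) :
  {in S &, injective (aff t)} -> uniq S ->
  exists2 g, polf (size S) g & {in S, g =1 phi}.
Proof.
elim: S phi => [|a S ih] phi inj /=; first by exists (fun=> 0) => //; apply: PolfZero.
case/andP=> aS uS.
have [b c bS cS|g hg gE] :=
  ih (fun b => (phi b - phi a) / (zK (aff t b) - zK (aff t a))) _ uS.
  by apply: inj; rewrite inE ?bS ?cS orbT.
exists (fun b => phi a + (zK (aff t b) - zK (aff t a)) * g b).
  by apply: PolfAdd; [apply: PolfConst|apply: polf_shift].
move=> b; rewrite inE => /predU1P[->|bS]; first by rewrite subrr mul0r addr0.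
rewrite gE // mulrC divfK ?subrKC // subr_eq0.
apply/eqP => /(zK_inj) h; move: aS; rewrite -(inj b a) ?bS //.
  by rewrite inE bS orbT.
by rewrite inE eqxx.
Qed.

Section Rows.

(* The lattice is read through affine coordinates: [te] indexes parallel
   lines (rows) and [tx] orders the cells inside a row. *)
Variables tx te : Z * Z * Z.
Let X := aff tx.
Let E := aff te.

Definition row_inj (D : seq cell) :=
  {in D &, forall a b, E a = E b -> X a = X b -> a = b}.

(** At most one row carries the number [n.+1]. It is interpolated along [tx]; a correction
    multiplied by the linear form vanishing on that row then treats the other rows with one degree
    less. The distinct numbers [v] are the degrees still available when each row has its turn. *)
Lemma polf_rows n (D : seq cell) (v : Z -> nat) (phi : cell -> K) :
  uniq D -> row_inj D ->
  {in D, forall a, count (fun b => E b == E a) D <= v (E a) <= n}%N ->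
  {in D &, forall a b, v (E a) = v (E b) -> E a = E b} ->
  exists2 g, polf n g & {in D, g =1 phi}.
Proof.
elim: n D phi => [|n ih] D phi uD inj le_v inj_v.
  exists (fun=> 0); first exact: PolfZero.
  move=> a aD; have /andP[h1 h2] := le_v a aD.
  suff : (0 < count (fun b => E b == E a) D)%N by lia.
  by rewrite -has_count; apply/hasP; exists a.
have [/hasP[a aD /eqP va]|/hasPn no] :=
    boolP (has (fun a => v (E a) == n.+1) D); last first.
  have [|g hg gE] := ih D phi uD inj _ inj_v.
    by move=> a aD; have := le_v a aD; have := no a aD; lia.
  by exists g => //; apply: polfS.
pose S := [seq b <- D | E b == E a].
pose D' := [seq b <- D | E b != E a].
have szS : (size S <= n.+1)%N.
  by rewrite size_filter -va; have /andP[] := le_v a aD.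
have [b c||h hh hE] := @polf_lagrange tx S phi.
- rewrite !mem_filter => /andP[/eqP eb bD] /andP[/eqP ec cD].
  by apply: inj => //; rewrite eb ec.
- exact: filter_uniq.
have [|||g hg gE] :=
  ih D' (fun b => (phi b - h b) / (zK (E b) - zK (E a))) (filter_uniq _ uD).
- by move=> b c; rewrite !mem_filter => /andP[_ bD] /andP[_ cD]; apply: inj.
- move=> b; rewrite mem_filter => /andP[nb bD].
  have /andP[h1 h2] := le_v b bD; apply/andP; split.
    apply: leq_trans h1; rewrite count_filter; apply: sub_count => c /=.
    by case/andP.
  move: h2; rewrite leq_eqVlt => /predU1P[e|//]; case/eqP: nb.
  by apply: inj_v => //; rewrite e va.
- by move=> b c; rewrite !mem_filter => /andP[_ bD] /andP[_ cD]; apply: inj_v.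
exists (fun b => h b + (zK (E b) - zK (E a)) * g b).
  by apply: PolfAdd; [apply: polfW hh|apply: polf_shift].
move=> b bD; have [e|ne] := eqVneq (E b) (E a).
  by rewrite e subrr mul0r addr0 hE // mem_filter e eqxx.
rewrite gE ?mem_filter ?ne // mulrC divfK ?subrKC // subr_eq0.
by apply/eqP => /zK_inj; apply/eqP.
Qed.

(** Rows numbered higher than the row of [a] are killed whole, each by one linear factor, whatever
    their length. This brings the degree down to [v (E a)], where all remaining rows are short
    enough for [polf_rows] to interpolate the indicator of [a]. *)
Lemma polf_isolate n a (D : seq cell) (v : Z -> nat) :
  uniq (a :: D) -> row_inj (a :: D) ->
  (count (fun b => E b == E a) D < v (E a) <= n)%N ->
  {in D, forall b, (v (E b) <= n)%N /\
     ((v (E b) <= v (E a))%N -> (count (fun c => E c == E b) D <= v (E b))%N)} ->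
  {in a :: D &, forall b c, v (E b) = v (E c) -> E b = E c} ->
  exists l, [/\ polf n l, l a != 0 & {in D, forall b, l b = 0}].
Proof.
move=> uD inj /andP[lt_a le_n]; rewrite -(subnK le_n).
elim: (n - _)%N D uD inj lt_a => [|j ih] D uD inj lt_a le_v inj_v.
  have [||g hg gE] := @polf_rows (v (E a)) (a :: D) v (fun b => (b == a)%:R) uD inj.
  - move=> b; rewrite inE => /predU1P[->|bD].
      by rewrite /= eqxx add1n lt_a leqnn.
    have [h1 h2] := le_v b bD; rewrite h1 andbT /=.
    have [e|ne] := eqVneq (E a) (E b); first by rewrite -e add1n.
    exact: h2.
  - exact: inj_v.
  exists g; split=> //; first by rewrite gE ?mem_head // eqxx oner_eq0.
  move=> b bD; rewrite gE ?inE ?bD ?orbT //; have [e|//] := eqVneq b a.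
  by move: uD; rewrite /= -e bD.
have [/hasP[b bD /eqP vb]|/hasPn no] :=
    boolP (has (fun b => v (E b) == (j.+1 + v (E a))%N) D); last first.
  have [b bD|l [hl la l0]] := ih D uD inj lt_a _ inj_v.
    by have [h1 h2] := le_v b bD; split=> //; have := no b bD; lia.
  by exists l; split=> //; rewrite addSn; apply: polfS.
pose D' := [seq c <- D | E c != E b].
have sub c : c \in a :: D' -> c \in a :: D.
  by rewrite !inE mem_filter; case: eqP => //= _ /andP[].
have le_cnt P : (count P D' <= count P D)%N.
  by rewrite count_filter; apply: sub_count => c /= /andP[].
have [|c d cD dD||c|c d cD dD|l [hl la l0]] := ih D'.
- move: uD => /= /andP[aD uD]; rewrite filter_uniq // andbT.
  by apply: contra aD; rewrite mem_filter => /andP[].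
- by apply: inj; apply: sub.
- exact: leq_ltn_trans (le_cnt _) lt_a.
- rewrite mem_filter => /andP[nc cD]; have [h1 h2] := le_v c cD; split.
    move: h1; rewrite leq_eqVlt => /predU1P[e|]; last by rewrite addSn ltnS.
    by case/eqP: nc; apply: inj_v; rewrite ?inE ?cD ?bD ?orbT // e vb.
  by move=> /h2; apply: leq_trans.
- by apply: inj_v; apply: sub.
exists (fun c => (zK (E c) - zK (E b)) * l c); split.
- by rewrite addSn; apply: polf_shift.
- rewrite mulf_neq0 // subr_eq0; apply/eqP => /zK_inj e.
  by move: vb; rewrite -e; lia.
move=> c cD; have [->|ne] := eqVneq (E c) (E b); first by rewrite subrr mul0r.
by rewrite l0 ?mulr0 // mem_filter ne.
Qed.

End Rows.

End Interpolation.

(** * Degeneration of a point to a tile *)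

Section Nonspecial.

Variable K : fieldType.
Hypothesis charK : [pchar K] =i pred0.

Lemma poly_nonroot (p : {poly K}) : p != 0 -> exists2 s : K, s != 0 & p.[s] != 0.
Proof.
move=> p0; pose rs := [seq i%:R : K | i <- iota 1 (size p)].
have [rp|/allPn[s]] := boolP (all (root p) rs).
  have := max_poly_roots p0 rp; rewrite size_map size_iota ltnn.
  move=> /(_ _)/negP[]//; rewrite map_inj_in_uniq ?iota_uniq // => i j _ _ /eqP.
  wlog le_ij : i j / (i <= j)%N => [hw|].
    by case/orP: (leq_total i j) => [/hw//|/hw h]; rewrite eq_sym => /h.
  by rewrite eq_sym -subr_eq0 -natrB // natrK_eq0 // subn_eq0 => ?; lia.
case/mapP=> i; rewrite mem_iota => /andP[i0 _] -> nr.
by exists i%:R => //; rewrite natrK_eq0 //; lia.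
Qed.

Definition chi (p : K * K) (a : cell) : K :=
  p.1 ^ int_of_Z a.1 * p.2 ^ int_of_Z a.2.

Fixpoint conditions (Q : seq (nat * (K * K))) (f : cell -> K) : Prop :=
  if Q is q :: Q' then
    exists l g, [/\ polf q.1 l, conditions Q' g & f =1 fun a => l a * chi q.2 a + g a]
  else f =1 fun=> 0.

Lemma conditions_ext Q f g : conditions Q f -> f =1 g -> conditions Q g.
Proof.
case: Q => [|q Q] /=; first by move=> hf e a; rewrite -e hf.
by case=> l [h [hl hh hf]] e; exists l, h; split=> // a; rewrite -e hf.
Qed.

Lemma conditions0 Q : conditions Q (fun=> 0).
Proof.
elim: Q => [|q Q ih] //=; exists (fun=> 0), (fun=> 0); split=> //.
  exact: PolfZero.
by move=> a; rewrite mul0r addr0.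
Qed.

Lemma conditionsD Q f g :
  conditions Q f -> conditions Q g -> conditions Q (fun a => f a + g a).
Proof.
elim: Q f g => [|q Q ih] f g /=; first by move=> hf hg a; rewrite hf hg addr0.
case=> l [f' [hl hf' hf]] [m [g' [hm hg' hg]]].
exists (fun a => l a + m a), (fun a => f' a + g' a); split.
- exact: PolfAdd.
- exact: ih.
- by move=> a; rewrite hf hg mulrDl addrACA.
Qed.

Lemma conditionsZ Q c f : conditions Q f -> conditions Q (fun a => c * f a).
Proof.
elim: Q f => [|q Q ih] f /=; first by move=> hf a; rewrite hf mulr0.
case=> l [f' [hl hf' hf]].
exists (fun a => c * l a), (fun a => c * f' a); split.
- exact: polfZ.
- exact: ih.
- by move=> a; rewrite hf mulrDr mulrA.
Qed.

Lemma conditions_sum Q (I : finType) (f : I -> cell -> K) :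
  (forall i, conditions Q (f i)) -> conditions Q (fun a => \sum_i f i a).
Proof.
move=> h; elim: (index_enum I) => [|i r ih].
  by apply: conditions_ext (conditions0 Q) _ => a; rewrite big_nil.
by apply: conditions_ext (conditionsD (h i) ih) _ => a; rewrite big_cons.
Qed.

(* Fat points of multiplicities [P] can be placed so that their conditions,
   restricted to polynomials supported on [D], separate the monomials of [D];
   in particular those conditions have rank [size D]. *)
Definition NS (D : seq cell) (P : seq nat) : Prop :=
  exists2 Q : seq (nat * (K * K)),
    map fst Q = P &
    {in D, forall a, exists2 f, conditions Q f & {in D, forall b, f b = (b == a)%:R}}.

Lemma NS_nil : NS [::] [::].
Proof. by exists [::]. Qed.

Lemma NS_eq_mem D D' P : D =i D' -> NS D P -> NS D' P.
Proof.
move=> e [Q h1 h2]; exists Q => // a; rewrite -e => /h2[f hf fE].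
by exists f => // b; rewrite -e; apply: fE.
Qed.

Definition zdot (w : Z * Z) (a : cell) : Z := (w.1 * a.1 + w.2 * a.2)%Z.

Lemma chi_torus (w : Z * Z) (s : K) a b : s != 0 ->
  (zdot w b <= zdot w a)%Z ->
  let p := (s ^ (- int_of_Z w.1), s ^ (- int_of_Z w.2)) in
  s ^ (int_of_Z (zdot w a)) * chi p b = s ^+ Z.to_nat (zdot w a - zdot w b).
Proof.
move=> s0 le /=; rewrite /chi /= !exprz_exp -!expfzDr //.
rewrite -[RHS]/(s ^ (Posz _)); congr (s ^ _).
rewrite /zdot in le *; lia.
Qed.

(* The condition [l] attached to a cell [a] of [D1], taken at the point
   (s^-w1, s^-w2) and scaled by s^(w.a), tends to l(a) times the coordinate at
   [a] as s -> 0; determinants being polynomial in s, some s works. *)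
Lemma NS_tile (D : seq cell) (D1 : pred cell) M P (w : Z * Z) :
  uniq D ->
  {in D, forall a, D1 a -> exists l : cell -> K, [/\ polf M l, l a != 0 &
     {in D, forall b, b != a -> (zdot w a <= zdot w b)%Z -> l b = 0}]} ->
  NS [seq a <- D | ~~ D1 a] P -> NS D (M :: P).
Proof.
move=> uD hl [Q QP hQ].
pose N := size D; pose cl (i : 'I_N) := tnth (in_tuple D) i.
have clD i : cl i \in D by apply: mem_tnth.
have cl_inj i j : (cl i == cl j) = (i == j).
  rewrite /cl !(tnth_nth (0%Z, 0%Z)) /= nth_uniq //.
have clP a : a \in D -> exists i, a = cl i by move=> /(@tnthP _ _ (in_tuple D)).
pose p (s : K) := (s ^ (- int_of_Z w.1), s ^ (- int_of_Z w.2)).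
have row i : exists r : 'I_N -> {poly K},
    [/\ forall s, s != 0 -> exists2 f, conditions ((M, p s) :: Q) f &
            forall j, f (cl j) = (r j).[s],
        D1 (cl i) -> exists2 c, c != 0 & forall j, (r j).[0] = c *+ (i == j) &
        ~~ D1 (cl i) -> forall j, ~~ D1 (cl j) -> (r j).[0] = (i == j)%:R].
  have [d1|nd1] := boolP (D1 (cl i)).
    have [l [hl1 hl2 hl3]] := hl _ (clD i) d1.
    have zero j : i != j -> (zdot w (cl i) <= zdot w (cl j))%Z -> l (cl j) = 0.
      by move=> ne; apply: hl3 => //; rewrite cl_inj eq_sym.
    exists (fun j => l (cl j) *: 'X^(Z.to_nat (zdot w (cl i) - zdot w (cl j)))).
    split=> // [s s0|_].
      exists (fun b => s ^ (int_of_Z (zdot w (cl i))) * l b * chi (p s) b).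
        exists (fun b => s ^ (int_of_Z (zdot w (cl i))) * l b), (fun=> 0).
        split; [exact: polfZ|exact: conditions0|by move=> b; rewrite addr0].
      move=> j; rewrite hornerZ hornerXn mulrAC mulrC.
      have [->|ne] := eqVneq i j; first by rewrite chi_torus //; lia.
      case: (Z.le_gt_cases (zdot w (cl i)) (zdot w (cl j))) => le.
        by rewrite zero // !mul0r.
      by rewrite chi_torus //; lia.
    exists (l (cl i)) => // j; rewrite hornerZ hornerXn.
    have [->|ne] := eqVneq i j.
      by rewrite Z.sub_diag expr0 mulr1.
    case: (Z.le_gt_cases (zdot w (cl i)) (zdot w (cl j))) => le.
      by rewrite zero // mul0r.
    by rewrite expr0n (_ : (_ == _)%N = false) ?mulr0 //; lia.
  have [|f hf fE] := hQ (cl i); first by rewrite mem_filter nd1 clD.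
  exists (fun j => (f (cl j))%:P); split=> // [s s0|_ j dj].
    exists f; last by move=> j; rewrite hornerC.
    exists (fun=> 0), f; split=> //; first exact: PolfZero.
    by move=> b; rewrite mul0r add0r.
  by rewrite hornerC fE ?mem_filter ?dj ?clD // cl_inj eq_sym.
have [r hr] := fin_all_exists row.
pose A : 'M[{poly K}]_N := \matrix_(i, j) r i j.
(* At s = 0 the matrix is block triangular: the rows of cells in [D1] are diagonal with nonzero
   entries, and the other rows are the identity on the columns outside [D1]. *)
have detA : \det A != 0.
  apply/eqP => d0; have: \det (map_mx (horner_eval 0) A) = 0 :> K.
    by rewrite det_map_mx d0 rmorph0.
  move/eqP/det0P => [v v0 hv]; case/eqP: v0.
  apply/rowP => j; rewrite mxE.
  have vA j' : \sum_i v 0 i * (r i j').[0] = 0.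
    have /rowP/(_ j') := hv; rewrite [LHS]mxE [RHS]mxE => h; rewrite -[RHS]h.
    by apply: eq_bigr => i _; rewrite !mxE.
  have vn j' : ~~ D1 (cl j') -> v 0 j' = 0.
    move=> nj; have := vA j'; rewrite (bigD1 j') //= big1 ?addr0 => [|i ne].
      by have [_ _ ->] := hr j'; rewrite ?nj // eqxx mulr1.
    have [d1|nd1] := boolP (D1 (cl i)).
      have [_ /(_ d1)[c _ ->] _] := hr i.
      by rewrite (negPf ne) mulr0n mulr0.
    by have [_ _ ->] := hr i; rewrite ?nd1 // (negPf ne) mulr0.
  have [d1|] := boolP (D1 (cl j)); last exact: vn.
  have := vA j; rewrite (bigD1 j) //= big1 ?addr0 => [|i ne].
    have [_ /(_ d1)[c c0 ->] _] := hr j.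
    by rewrite eqxx => /eqP; rewrite mulf_eq0 (negPf c0) orbF => /eqP.
  have [d1i|nd1] := boolP (D1 (cl i)); last by rewrite vn // mul0r.
  have [_ /(_ d1i)[c _ ->] _] := hr i.
  by rewrite (negPf ne) mulr0n mulr0.
have [s s0 ds] := poly_nonroot detA.
pose B := map_mx (horner_eval s) A.
have uB : B \in unitmx.
  by rewrite unitmxE det_map_mx unitfE.
have /fin_all_exists2[f hf fE] : forall i, exists2 f : cell -> K,
    conditions ((M, p s) :: Q) f & forall j, f (cl j) = B i j.
  move=> i; have [/(_ s s0)[f hf fE] _ _] := hr i.
  by exists f => // j; rewrite fE !mxE.
exists ((M, p s) :: Q); first by rewrite /= QP.
move=> a /clP[i ->]; exists (fun b => \sum_k invmx B i k * f k b).
  by apply: conditions_sum => k; apply: conditionsZ.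
move=> b /clP[j ->]; rewrite cl_inj.
have /matrixP/(_ i j) := mulVmx uB; rewrite !mxE eq_sym => <-.
by apply: eq_bigr => k _; rewrite fE.
Qed.

(** The tile is the far end of each row, [v] cells or fewer. Seen from a cell of the tile, a row
    further out either has a larger number and is killed by a linear factor, or has few enough cells
    to be interpolated. *)
Lemma NS_rows (tx te : Z * Z * Z) (D : seq cell) (D1 : pred cell)
    (v : Z -> nat) M P :
  uniq D -> row_inj tx te D ->
  {in D, forall a, D1 a ->
     (count (fun b => (aff te b == aff te a) && (aff tx a <? aff tx b)%Z) D
        < v (aff te a) <= M)%N} ->
  {in D &, forall a b, D1 a -> (aff te a < aff te b)%Z ->
     (v (aff te b) <= M)%N /\ ((v (aff te b) <= v (aff te a))%N ->
        (count (fun c => aff te c == aff te b) D <= v (aff te b))%N)} ->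
  {in D &, forall a b, v (aff te a) = v (aff te b) -> v (aff te a) <> 0%N ->
     aff te a = aff te b} ->
  NS [seq a <- D | ~~ D1 a] P -> NS D (M :: P).
Proof.
move=> uD inj hbite habove injv.
have [B hB] : exists B, {in D, forall a, (Z.abs (aff tx a) < B)%Z}.
  elim: (D) => [|a S [B hB]]; first by exists 0%Z.
  exists (Z.max B (Z.abs (aff tx a) + 1))%Z => b; rewrite inE.
  by case/predU1P => [->|/hB]; lia.
(* Since [B] exceeds every [tx] in absolute value, this weight orders the cells lexicographically,
   by row and then inside the row. *)
pose w := (2 * B * te.1.1 + tx.1.1, 2 * B * te.1.2 + tx.1.2)%Z.
apply: (@NS_tile D D1 M P w) => // a aD d1.
pose D' := [seq b <- D | (b != a) &&
   ((aff te a <? aff te b) || ((aff te a =? aff te b) && (aff tx a <? aff tx b)))%Z].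
have D'D b : b \in D' -> b \in D by rewrite mem_filter => /andP[].
have uD' : uniq (a :: D').
  by rewrite /= filter_uniq // mem_filter eqxx.
have sub b : b \in a :: D' -> b \in D.
  by rewrite inE => /predU1P[->//|]; apply: D'D.
(* Numbers are distinct only where nonzero, so rows numbered 0 must be excluded: by [habove] such a
   row lying further out would be empty. *)
have pos b : b \in a :: D' -> v (aff te b) <> 0%N.
  rewrite inE => /predU1P[->|]; first by have := hbite a aD d1; lia.
  rewrite mem_filter => /andP[/andP[_ h] bD] v0.
  have [e|ne] := eqVneq (aff te a) (aff te b).
    by have := hbite a aD d1; rewrite e v0; lia.
  have lt : (aff te a < aff te b)%Z by move: ne h => /eqP; lia.
  have [_] := habove a b aD bD d1 lt; rewrite v0 => /(_ isT).
  rewrite leqNgt -has_count => /negP[]; apply/hasP.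
  by exists b.
have cnt : (count (fun b => aff te b == aff te a) D' < v (aff te a) <= M)%N.
  have /andP[h1 h2] := hbite a aD d1; rewrite h2 andbT.
  apply: leq_ltn_trans h1; rewrite count_filter; apply: sub_count => b /=.
  by case/and3P=> /eqP e _; rewrite e eqxx /=; lia.
have [|b bD'|b c bD cD e|l [hl la l0]] := @polf_isolate K charK tx te M a D' v uD' _ cnt.
- by move=> b c bD cD; apply: inj; apply: sub.
- have bD := D'D b bD'; move: bD'; rewrite mem_filter => /andP[/andP[_ h] _].
  have [e|ne] := eqVneq (aff te a) (aff te b).
    by rewrite -e; move: cnt => /andP[h1 h2]; split=> // _; apply: ltnW.
  have lt : (aff te a < aff te b)%Z by move: ne h => /eqP; lia.
  have [h1 h2] := habove a b aD bD d1 lt; split=> // /h2; apply: leq_trans.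
  by rewrite count_filter; apply: sub_count => c /= /andP[].
- by apply: injv => //; [apply: sub|apply: sub|apply: pos].
exists l; split=> // b bD ne le; apply: l0; rewrite mem_filter ne bD andbT /=.
have hw : (zdot w b - zdot w a = 2 * B * (aff te b - aff te a) + (aff tx b - aff tx a))%Z.
  by rewrite /zdot /w /aff /=; ring.
have bnd := hB a aD; have bnd' := hB b bD.
case: (Z.lt_trichotomy (aff te a) (aff te b)) => [|[e|lt]]; [lia| |nia].
have : aff tx a <> aff tx b by move=> e'; case/eqP: ne; apply/esym/inj.
by move: hw; rewrite e Z.sub_diag; lia.
Qed.

End Nonspecial.

Local Open Scope nat_scope.

(** * Tiles in stacks of rows *)

(* A stack of left-justified rows, listed from the top; the bottom row is at
   height 0. *)
Fixpoint cells (s : seq nat) : seq cell :=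
  if s is b :: s' then
    [seq (Z.of_nat x, Z.of_nat (size s')) | x <- iota 0 b] ++ cells s'
  else [::].

Lemma cellsP s a :
  reflect (exists x e, [/\ a = (Z.of_nat x, Z.of_nat e), e < size s &
                         x < nth 0 s (size s - e.+1)]) (a \in cells s).
Proof.
elim: s => [|b s ih] /=; first by constructor; case=> x [e []].
rewrite mem_cat; apply: (iffP orP) => [[/mapP[x]|/ih]|].
- rewrite mem_iota => /andP[_ xb] ->; exists x, (size s); split=> //.
  by rewrite subnn.
- case=> x [e [-> le lx]]; exists x, e; split=> //; first by lia.
  by rewrite subSS (_ : size s - e = (size s - e.+1).+1) //; lia.
- case=> x [e [ea le lx]]; subst a.
  have [eq|ne] := eqVneq e (size s).
    left; apply/mapP; exists x; last by rewrite eq.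
    by move: lx; rewrite eq subSS subnn mem_iota.
  right; apply/ih; exists x, e; split=> //; first by lia.
  by move: lx; rewrite subSS (_ : size s - e = (size s - e.+1).+1) //; lia.
Qed.

Lemma cells_uniq s : uniq (cells s).
Proof.
elim: s => //= b s ih; rewrite cat_uniq ih andbT.
rewrite map_inj_uniq ?iota_uniq => [|x y []]; last by lia.
apply/hasPn => a /cellsP[x [e [-> le _]]]; apply/negP => /mapP[y _ []]; lia.
Qed.

Lemma size_cells s : size (cells s) = sumn s.
Proof. by elim: s => //= b s ih; rewrite size_cat size_map size_iota ih. Qed.

Definition subs (s v : seq nat) := [seq p.1 - p.2 | p <- zip s v].

Lemma size_subs s v : size v = size s -> size (subs s v) = size s.
Proof. by move=> e; rewrite size_map size_zip e minnn. Qed.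

Lemma nth_subs s v i : size v = size s -> nth 0 (subs s v) i = nth 0 s i - nth 0 v i.
Proof.
move=> e; have [lt|ge] := ltnP i (size s).
  by rewrite (nth_map (0, 0)) ?size_zip ?e ?minnn // nth_zip.
by rewrite !nth_default ?size_subs ?e.
Qed.

Lemma count_le_interval (D : seq cell) (p : pred cell) e i n :
  uniq D ->
  {in D, forall a, p a -> exists x, a = (Z.of_nat x, e) /\ i <= x < i + n} ->
  count p D <= n.
Proof.
move=> uD h; rewrite -size_filter.
rewrite -[X in _ <= X](size_iota i) -(size_map (fun x => (Z.of_nat x, e))).
apply: uniq_leq_size; first exact: filter_uniq.
move=> a; rewrite mem_filter => /andP[pa aD].
have [x [-> hx]] := h a aD pa.
by apply/mapP; exists x => //; rewrite mem_iota.
Qed.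

Section Shapes.

Variable K : fieldType.
Hypothesis charK : [pchar K] =i pred0.
Let NS := NS K.

(** Rows are horizontal and bitten from the right. In the separation hypothesis row [i] lies above
    row [j]: a larger bite lets a linear factor kill row [i], and a row swallowed whole is short
    enough to be interpolated. *)
Lemma NS_shape (s v : seq nat) M P :
  size v = size s ->
  (forall i, nth 0 v i <= nth 0 s i) -> (forall i, nth 0 v i <= M) ->
  (forall i j, i < j < size s -> 0 < nth 0 v j ->
     nth 0 v j < nth 0 v i \/ (nth 0 v i = nth 0 s i /\ nth 0 v i <> nth 0 v j)) ->
  NS (cells (subs s v)) P -> NS (cells s) (M :: P).
Proof.
move=> szv le_s le_M sep hNS.
pose row (e : Z) := size s - (Z.to_nat e).+1.
pose D1 (a : cell) := nth 0 s (row a.2) - nth 0 v (row a.2) <= Z.to_nat a.1.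
pose w (e : Z) := nth 0 v (row e).
have X a : aff (1, 0, 0)%Z a = a.1 by rewrite /aff; cbn [fst snd]; lia.
have E a : aff (0, 1, 0)%Z a = a.2 by rewrite /aff; cbn [fst snd]; lia.
apply: (@NS_rows K charK (1, 0, 0)%Z (0, 1, 0)%Z (cells s) D1 w).
- exact: cells_uniq.
- by move=> [x e] [x' e'] _ _; rewrite !E !X /= => -> ->.
- move=> a /cellsP[x [e [-> le lx]]]; rewrite /D1 /w /row /= E /= !Nat2Z.id => hx.
  rewrite le_M andbT; set i := size s - e.+1 in lx hx *.
  apply: (@leq_ltn_trans (nth 0 s i - x.+1)); last by have := le_s i; lia.
  apply: (@count_le_interval _ _ (Z.of_nat e) x.+1); first exact: cells_uniq.
  move=> b /cellsP[y [e' [-> le' ly]]]; rewrite !X !E /= => /andP[/eqP h1 h2].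
  have ee : e' = e by lia.
  by subst e'; exists y; split=> //; move: ly; rewrite -/i; lia.
- move=> a b /cellsP[x [e [-> le lx]]] /cellsP[y [e' [-> le' ly]]].
  rewrite /D1 /w /row /= !E /= !Nat2Z.id => hx lt; split=> // hv.
  set i := size s - e.+1 in lx hx hv *; set j := size s - e'.+1 in ly hv *.
  have ji : j < i < size s by rewrite /i /j; lia.
  have [] := sep j i ji; [lia|lia|] => -[-> _].
  apply: (@count_le_interval _ _ (Z.of_nat e') 0); first exact: cells_uniq.
  move=> c /cellsP[z [f [-> lf lz]]]; rewrite !E /= => /eqP h.
  have ff : f = e' by lia.
  by subst f; exists z; split=> //; rewrite add0n.
- move=> a b /cellsP[x [e [-> le lx]]] /cellsP[y [e' [-> le' ly]]].
  rewrite /w /row /= !E /= !Nat2Z.id.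
  set i := size s - e.+1 in lx *; set j := size s - e'.+1 in ly *.
  move=> h h0.
  case: (ltngtP i j) => ij; last by rewrite /i /j in ij; lia.
    have [] := sep i j; [rewrite /i /j in ij *; lia|lia|lia|tauto].
  have [] := sep j i; [rewrite /i /j in ij *; lia|lia|lia|].
  by case=> _ /(_ (esym h)).
apply: NS_eq_mem hNS => a; apply/cellsP/idP => [[x [e [-> le lx]]]|].
  rewrite size_subs // in le lx; rewrite nth_subs // in lx.
  rewrite mem_filter /D1 /row /= !Nat2Z.id; apply/andP; split; first by lia.
  by apply/cellsP; exists x, e; split=> //; lia.
rewrite mem_filter /D1 => /andP[h /cellsP[x [e [ea le lx]]]].
exists x, e; rewrite size_subs // nth_subs //; split=> //.
by move: h; rewrite ea /row /= !Nat2Z.id; lia.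
Qed.

Lemma NS_zeros n s P : NS (cells s) P -> NS (cells (nseq n 0 ++ s)) P.
Proof. by elim: n. Qed.

Lemma perm_bites M (A : seq nat) : sorted ltn A -> all (fun x => 0 < x < M) A ->
  perm_eq (A ++ [seq x <- rev (iota 1 M) | x \notin A]) (iota 1 M).
Proof.
move=> sA hA; apply: uniq_perm; last 1 first.
- move=> x; rewrite mem_cat mem_filter mem_rev; case: (boolP (x \in A)) => //= xA.
  by have /allP/(_ x xA) := hA; rewrite mem_iota; lia.
- rewrite cat_uniq filter_uniq ?rev_uniq ?iota_uniq // andbT.
  rewrite (sorted_uniq ltn_trans ltnn) //=.
  by apply/hasPn => x; rewrite mem_filter => /andP[].
- exact: iota_uniq.
Qed.

(** The short rows [A] are swallowed whole, and the numbers of 1, ..., M that are not among their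
    lengths are bitten off the long rows [B] in decreasing order. Each number occurs once, so the
    tile has M (M + 1) / 2 cells, the number of conditions. *)
Lemma NS_bite M (A B rest P : seq nat) :
  let V := [seq x <- rev (iota 1 M) | x \notin A] in
  sorted ltn A -> all (fun x => 0 < x < M) A -> all (leq M) B ->
  size A + size B = M ->
  NS (cells (subs B V ++ rest)) P -> NS (cells (A ++ B ++ rest)) (M :: P).
Proof.
move=> V sA hA hB szM hNS.
have pV := perm_bites sA hA.
have szV : size V = size B.
  by have := perm_size pV; rewrite size_cat size_iota /V -szM; apply: addnI.
have sV : sorted gtn V.
  by apply: sorted_filter; [exact: rev_trans ltn_trans|rewrite rev_sorted iota_ltn_sorted].
have Vle x : x \in V -> 0 < x <= M.
  by rewrite mem_filter mem_rev mem_iota => /andP[_]; lia.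
pose v := A ++ V ++ nseq (size rest) 0.
have nv i : nth 0 v i = if i < size A then nth 0 A i else
    if i < M then nth 0 V (i - size A) else 0.
  rewrite /v nth_cat; case: ifP => // iA; rewrite nth_cat szV.
  move: iA; case: (ltnP (i - size A) (size B)) => h1; case: (ltnP i M) => h2 // iA.
  - by lia.
  - by lia.
  by rewrite nth_nseq if_same.
have ns i : nth 0 (A ++ B ++ rest) i = if i < size A then nth 0 A i else
    if i < M then nth 0 B (i - size A) else nth 0 rest (i - M).
  rewrite nth_cat; case: ifP => // iA; rewrite nth_cat.
  move: iA; case: (ltnP (i - size A) (size B)) => h1; case: (ltnP i M) => h2 // iA.
  - by lia.
  - by lia.
  by congr nth; lia.
have nA i : i < size A -> 0 < nth 0 A i < M.
  by move=> h; apply: (allP hA); apply: mem_nth.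
have nV i : i < size B -> 0 < nth 0 V i <= M.
  by move=> h; apply: Vle; apply: mem_nth; rewrite szV.
have nB i : i < size B -> M <= nth 0 B i.
  by move=> h; apply: (allP hB); apply: mem_nth.
apply: (@NS_shape _ v).
- by rewrite !size_cat size_nseq szV.
- move=> i; rewrite nv ns; case: ifP => // h1; case: ifP => // h2.
  have hb : i - size A < size B by lia.
  by have := nV _ hb; have := nB _ hb; lia.
- move=> i; rewrite nv; case: ifP => [/nA|h1]; first by lia.
  case: ifP => // h2; have hb : i - size A < size B by lia.
  by have := nV _ hb; lia.
- move=> i j /andP[ij jsz]; rewrite !nv !ns.
  case: (ltnP j (size A)) => jA; last case: (ltnP j M) => jM //.
    rewrite (ltn_trans ij jA) => _; right; split=> //.
    have := sorted_ltn_nth ltn_trans 0 sA i j; rewrite !inE jA (ltn_trans ij jA).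
    by move=> /(_ isT isT ij); lia.
  move=> _; case: (ltnP i (size A)) => iA.
    right; split=> // e.
    have : nth 0 V (j - size A) \in V by apply: mem_nth; lia.
    by rewrite mem_filter -e mem_nth.
  left; rewrite (ltn_trans ij jM).
  have tr : transitive gtn by apply: rev_trans ltn_trans.
  by apply: (sorted_ltn_nth tr 0 sV); rewrite ?inE ?szV; lia.
rewrite /subs zip_cat // map_cat zip_cat ?szV // map_cat.
rewrite (_ : map _ (zip A A) = nseq (size A) 0); last first.
  by elim: (A) => //= x A' ->; rewrite subnn.
rewrite (_ : map _ (zip rest _) = rest); last first.
  by elim: (rest) => //= x A' ->; rewrite subn0.
exact: NS_zeros.
Qed.

End Shapes.

(** * Greedy removal of tiles from a staircase *)

Fixpoint full d := if d is d'.+1 then d :: full d' else [::].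

Lemma size_full d : size (full d) = d.
Proof. by elim: d => //= d ->. Qed.

Lemma nth_full d i : nth 0 (full d) i = d - i.
Proof. by elim: d i => [|d ih] [|i] //=; rewrite ?nth_nil // ih. Qed.

Lemma drop_full q d : drop q (full d) = full (d - q).
Proof. by elim: d q => [|d ih] [|q] //=; rewrite ih. Qed.

Lemma sumn_full d : sumn (full d) * 2 = d * d.+1.
Proof. by elim: d => //= d ih; nia. Qed.

(* Lengths of consecutive irregular rows, from the top: nondecreasing, and
   strictly increasing below the threshold [t]. *)
Definition grows (t : nat) : rel nat := fun x y => (x < y) || (t <= x) && (x == y).

Lemma grows_trans t : transitive (grows t).
Proof. by move=> y x z; rewrite /grows; lia. Qed.

Definition stair (t : nat) (irr : seq nat) (d : nat) : bool :=
  [&& sorted (grows t) irr, all (leq 1) irr & all (fun x => x <= d.+1) irr].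

Lemma sorted_gtn_bounds (V : seq nat) M i :
  sorted gtn V -> all (fun x => 0 < x <= M) V -> i < size V ->
  size V - i <= nth 0 V i <= M - i.
Proof.
move=> sV aV iV.
have pos k : k < size V -> 0 < nth 0 V k <= M.
  by move=> kV; apply: (allP aV); apply: mem_nth.
have dec k : k.+1 < size V -> nth 0 V k.+1 < nth 0 V k.
  by move/(sortedP 0): sV => /(_ k).
apply/andP; split.
  rewrite -(subKn (ltnW iV)); set q := size V - i.
  have : 0 < q <= size V by rewrite /q; lia.
  elim: q => [//|[|q] ih] hq; first by have := pos (size V - 1); lia.
  have := dec (size V - q.+2); rewrite (_ : (size V - q.+2).+1 = size V - q.+1); last by lia.
  by move=> /(_ _); have := ih; lia.
elim: i iV => [|i ih] iV; first by have := pos 0 iV; lia.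
by have := ih (ltnW iV); have := dec i iV; have := pos _ iV; lia.
Qed.

Lemma sumn_subs s v : size v = size s -> (forall i, nth 0 v i <= nth 0 s i) ->
  sumn (subs s v) + sumn v = sumn s.
Proof.
elim: s v => [|b s ih] [|c v] //= [szv] h.
have := h 0; have := ih v szv (fun i => h i.+1); rewrite /subs /=; lia.
Qed.

Section Greedy.

Variable K : fieldType.
Hypothesis charK : [pchar K] =i pred0.
Let NS := NS K.

(** The staircase form survives a tile because decreasing bites make nondecreasing rows strictly
    increasing. Only where the tile digs into full rows, whose lengths fall by one, may ties arise;
    [t + M <= d] keeps them at or above the threshold, so that rows shorter than a later
    multiplicity are still distinct. *)
Lemma NS_greedy t M irr d P :
  0 < M <= t -> stair t irr d -> (M <= size irr) || (t + M <= d) ->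
  exists irr', let d' := d - (M - size irr) in
    [/\ stair t irr' d', size irr' <= maxn (size irr) M,
        (sumn (irr' ++ full d') + sumn (iota 1 M) = sumn (irr ++ full d)) &
        NS (cells (irr' ++ full d')) P -> NS (cells (irr ++ full d)) (M :: P)].
Proof.
move=> /andP[M0 Mt] /and3P[sI pI bI] hM.
pose j := find (leq M) irr.
pose s := irr ++ full d.
have jI : j <= size irr := find_size _ _.
have inc i : i.+1 < size irr -> grows t (nth 0 irr i) (nth 0 irr i.+1).
  by move/(sortedP 0): sI => /(_ i).
have bnd i : nth 0 irr i <= d.+1.
  have [iI|iI] := ltnP i (size irr); last by rewrite nth_default.
  by apply: (allP bI); apply: mem_nth.
have pos i : i < size irr -> 0 < nth 0 irr i.
  by move=> iI; apply: (allP pI); apply: mem_nth.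
have lo i : i < j -> nth 0 irr i < M.
  by move=> ij; rewrite ltnNge; apply/negbT; apply: (before_find 0 ij).
have hj : j < size irr -> M <= nth 0 irr j.
  by move=> h; apply: (nth_find 0); rewrite has_find.
have hi i : j <= i < size irr -> M <= nth 0 irr i.
  case/andP; elim: i => [|i ih] ji iI.
    by move: ji hj; rewrite leqn0 => /eqP ->; apply.
  move: ji; rewrite leq_eqVlt => /predU1P[ji|ji].
    by rewrite -ji; apply: hj; rewrite ji.
  have := ih ji (ltnW iI); have := inc i iI; rewrite /grows; lia.
pose A := take j irr.
have szA : size A = j by rewrite size_takel.
have nA i : i < j -> nth 0 A i = nth 0 irr i by move=> ij; rewrite nth_take.
have sA : sorted ltn A.
  apply/(sortedP 0) => i; rewrite szA => ij; rewrite !nA //; last by lia.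
  have := inc i (leq_trans ij jI); have := lo i (ltnW ij); rewrite /grows; lia.
have aA : all (fun x => 0 < x < M) A.
  apply/(all_nthP 0) => i; rewrite szA => ij; rewrite nA // lo // andbT.
  by apply: pos; lia.
have jM : j < M.
  suff : size A <= size (iota 1 M.-1) by rewrite size_iota szA; lia.
  apply: uniq_leq_size; first exact: (sorted_uniq ltn_trans ltnn).
  by move=> x /(allP aA); rewrite mem_iota; lia.
pose B := take (M - j) (drop j s).
have szs : size s = size irr + d by rewrite size_cat size_full.
have szB : size B = M - j.
  by rewrite size_takel // size_drop szs; case/orP: hM; lia.
have ns i : nth 0 s i = if i < size irr then nth 0 irr i else d - (i - size irr).
  by rewrite nth_cat nth_full.
have nB i : i < M - j -> nth 0 B i = nth 0 s (j + i).
  by move=> h; rewrite nth_take // nth_drop.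
have aB : all (leq M) B.
  apply/(all_nthP 0) => i; rewrite szB => iB; rewrite nB // ns.
  case: ifP => h; first by apply: hi; lia.
  by case/orP: hM; lia.
have eqs : s = A ++ B ++ drop M s.
  rewrite -{1}(cat_take_drop j s); congr (_ ++ _).
    by rewrite take_cat /A; case: ltngtP jI => // e _; rewrite e subnn take0 cats0 take_size.
  rewrite -{1}(cat_take_drop (M - j) (drop j s)) drop_drop; congr (_ ++ drop _ _).
  by lia.
pose V := [seq x <- rev (iota 1 M) | x \notin A].
have pV : perm_eq (A ++ V) (iota 1 M) := perm_bites sA aA.
have szV : size V = M - j.
  by have := perm_size pV; rewrite size_cat size_iota szA; lia.
have sV : sorted gtn V.
  by apply: sorted_filter; [exact: rev_trans ltn_trans|rewrite rev_sorted iota_ltn_sorted].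
have aV : all (fun x => 0 < x <= M) V.
  by apply/allP => x; rewrite mem_filter mem_rev mem_iota add1n ltnS => /andP[].
have bV i : i < M - j -> (M - j) - i <= nth 0 V i <= M - i.
  by rewrite -szV; apply: sorted_gtn_bounds.
have dV i : i.+1 < M - j -> nth 0 V i.+1 < nth 0 V i.
  by move/(sortedP 0): sV => /(_ i); rewrite szV.
have zV i : M - j <= i -> nth 0 V i = 0.
  by move=> h; rewrite nth_default // szV.
pose w := subs B V ++ drop M irr.
have szw : size w = maxn (size irr) M - j.
  by rewrite size_cat size_subs ?szB // size_drop; clear -jM jI; lia.
have nw i : i < size w -> nth 0 w i = nth 0 s (j + i) - nth 0 V i.
  move=> iw; rewrite nth_cat size_subs ?szV ?szB //.
  case: ltnP => h; first by rewrite nth_subs ?szV // nB.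
  rewrite zV // subn0 nth_drop ns ifT; last by clear -iw szw jM h; lia.
  by congr nth; clear -h jM; lia.
pose d' := d - (M - size irr).
have dropE : drop M s = drop M irr ++ full d'.
  rewrite drop_cat /d'; case: ltnP => h.
    by rewrite (eqP (ltnW h)) subn0.
  by rewrite drop_full [drop M irr]drop_oversize.
have sw : sorted (grows t) w.
  apply/(sortedP 0) => i iw; rewrite !nw ?(ltnW iw) // !ns addnS.
  have [k1|k1] := ltnP (j + i).+1 (size irr).
    rewrite (ltnW k1); have := inc _ k1; have := hi (j + i); have := hi (j + i).+1.
    rewrite /grows; have [h|h] := ltnP i.+1 (M - j).
      by have := dV i h; have := bV i; have := bV i.+1 h; clear -h k1 Mt jM; lia.
    have [h'|h'] := ltnP i (M - j); last by rewrite !zV //; clear -k1; lia.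
    by have := bV i h'; rewrite [nth 0 V i.+1]zV //; clear -h h' k1 Mt jM; lia.
  (* The lower row is now a full one. Lengths fall by at most one and bites by at least one, so the
     order is kept, and a tie has length at least [d - M >= t]. *)
  have h : i.+1 < M - j by clear -iw szw k1 jM; lia.
  have := dV i h; have := bV i; have := bV i.+1 h.
  case: ifP => k2; have := bnd (j + i); have := hi (j + i); rewrite /grows.
    by clear -hM h k1 k2 Mt M0 jM jI; case/orP: hM; lia.
  by clear -hM h k1 k2 Mt M0 jM jI; case/orP: hM; lia.
have bw : all (fun x => x <= d'.+1) w.
  apply/(all_nthP 0) => i iw; rewrite nw // ns.
  have := bnd (j + i); have := bV i; rewrite /d'.
  rewrite szw in iw; clear -iw jM jI M0 hM.
  by case: ifP => h1; case: (ltnP i (M - j)) => h2; lia.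
have pw x l : path (grows t) x l -> all (leq 1) l.
  move=> /(order_path_min (@grows_trans t)) /allP h.
  by apply/allP => y /h; rewrite /grows; clear -M0 Mt; lia.
have sumV : sumn A + sumn V = sumn (iota 1 M).
  by rewrite -sumn_cat; apply: perm_sumn.
have sumB : sumn (subs B V) + sumn V = sumn B.
  apply: sumn_subs => [|i]; first by rewrite szV szB.
  have [h|h] := ltnP i (M - j); last by rewrite zV.
  have := bV i h; have /(all_nthP 0)/(_ i) := aB; rewrite szB => /(_ h); clear -h; lia.
have sums : sumn s = sumn A + sumn B + sumn (drop M irr ++ full d').
  by rewrite [in LHS]eqs dropE !sumn_cat !addnA.
have hNS : NS (cells (w ++ full d')) P -> NS (cells s) (M :: P).
  rewrite eqs dropE /w -catA; apply: (NS_bite charK sA aA aB).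
  by rewrite szA szB subnKC // ltnW.
have sumw : sumn (w ++ full d') + sumn (iota 1 M) = sumn s.
  by rewrite sums /w !sumn_cat; clear -sumV sumB; lia.
(* Growth is strict below [t], so only the first row can be exhausted; it is then dropped. *)
have [w0|w0] := boolP (0 < nth 0 w 0).
  exists w; split=> //; last by rewrite szw leq_subr.
  rewrite /stair sw bw andbT /=; case: (w) sw w0 => //= x w' sw' x0.
  by rewrite x0 (pw _ _ sw').
exists (behead w); split.
- rewrite /stair.
  case: (w) sw bw w0 => //= x w' sw' /andP[_ ->]; rewrite andbT -leqNgt leqn0 => /eqP x0.
  by rewrite (path_sorted sw') (pw _ _ sw').
- by rewrite size_behead szw -subnS leq_subr.
- by move: sumw w0; case: (w) => //= x w'; rewrite -eqn0Ngt => h /eqP x0; rewrite -h x0.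
- move=> h; apply: hNS; case: (w) w0 h => //= x w'; rewrite -eqn0Ngt => /eqP ->.
  by [].
Qed.

Lemma stair_sumn t irr d : stair t irr d -> sumn irr <= size irr * d.+1.
Proof.
by case/and3P=> _ _; elim: irr => //= x irr ih /andP[hx /ih]; nia.
Qed.

Lemma sumn_iota1 M : sumn (iota 1 M) * 2 = M * M.+1.
Proof.
elim: M => // M ih; have -> : iota 1 M.+1 = iota 1 M ++ [:: M.+1].
  by rewrite -(addn1 M) iotaD add1n addn1.
by rewrite sumn_cat mulnDl ih /=; lia.
Qed.

(** [A] is the area kept for the tiles to come; its lower bound is what makes [NS_greedy] applicable
    at every step. *)
Lemma NS_greedy_all mu Ms irr d A Q :
  4 * mu ^ 2 < A + 2 * mu ->
  all (fun M => 0 < M <= mu) Ms -> stair mu irr d -> size irr <= mu ->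
  sumn (irr ++ full d) = sumn [seq sumn (iota 1 M) | M <- Ms] + A ->
  exists irr' d',
    [/\ stair mu irr' d', size irr' <= mu, sumn (irr' ++ full d') = A &
        NS (cells (irr' ++ full d')) Q -> NS (cells (irr ++ full d)) (Ms ++ Q)].
Proof.
move=> hA; elim: Ms irr d => [|M Ms ih] irr d /=.
  by move=> _ st sz sumE; exists irr, d.
move=> /andP[hM hMs] st sz sumE.
have [|irr1 [st1 sz1 sum1 ns1]] := @NS_greedy mu M irr d (Ms ++ Q) hM st.
  (* With fewer than [M] irregular rows and [d < mu + M] the area would be at most (M - 1)(mu + M) +
     (mu + M - 1)(mu + M) / 2, too small by [hA]. *)
  have := stair_sumn st; have := sumn_full d; have := sumn_iota1 M.
  rewrite sumn_cat in sumE.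
  case: (leqP M (size irr)) => //= h1 e1 e2 le; rewrite leqNgt; apply/negP => h2.
  have : sumn irr <= M.-1 * (mu + M) by nia.
  have : sumn (full d) * 2 <= (mu + M).-1 * (mu + M) by nia.
  by case/andP: hM => M0 Mmu; nia.
have [||irr' [d' [st' sz' sum' ns']]] := ih irr1 (d - (M - size irr)) hMs st1.
- by move: sz1; case/andP: hM; lia.
- by rewrite sumE in sum1; lia.
by exists irr', d'; split=> // h; apply/ns1/ns'.
Qed.

Lemma stair_weaken t t' irr d : t' <= t -> stair t irr d -> stair t' irr d.
Proof.
move=> le /and3P[h1 h2 h3]; rewrite /stair h2 h3 /= andbT.
by apply: sub_sorted h1 => x y; rewrite /grows; lia.
Qed.

(* The condition on consecutive row lengths under which the chip counts increase
   strictly. *)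
Definition adm (M : nat) : rel nat := fun x y =>
  [|| x == 0, x < y, (x == y) && (M <= x) | (x == y.+1) && (2 * M <= x)].

(** Tiles are eaten as long as the next one must stay above the lowest [D0] rows. At most M rows
    then lie above these; padded with empty rows to exactly M, they form the initial window of the
    chip recursion. *)
Lemma NS_greedy_down M D0 irr d n :
  0 < M -> 2 * M <= D0 <= d -> stair M irr d ->
  sumn (irr ++ full d) = n * sumn (iota 1 M) ->
  exists b n', [/\ size b = M, sorted (adm M) (rcons b D0),
     sumn (b ++ full D0) = n' * sumn (iota 1 M) &
     NS (cells (b ++ full D0)) (nseq n' M) -> NS (cells (irr ++ full d)) (nseq n M)].
Proof.
move=> M0; elim: n irr d => [|n ih] irr d hD st sumE.
  by move: sumE (sumn_full d); rewrite sumn_cat mul0n; nia.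
have [le|lt] := leqP (size irr + (d - D0)) M.
  exists (nseq (M - (size irr + (d - D0))) 0 ++ irr ++ take (d - D0) (full d)), n.+1.
  have cutE : take (d - D0) (full d) ++ full D0 = full d.
    rewrite -[RHS](cat_take_drop (d - D0)) drop_full; congr (_ ++ full _); lia.
  have szt : size (take (d - D0) (full d)) = d - D0.
    by rewrite size_takel // size_full; lia.
  split.
  - by rewrite !size_cat size_nseq szt; lia.
  - have nz : forall q s, sorted (adm M) s -> sorted (adm M) (nseq q 0 ++ s).
      by elim=> //= q ihq s /ihq; case: (_ ++ s) => //= x s' ->.
    rewrite !rcons_cat; apply: nz.
    have ramp : sorted (adm M) (rcons (take (d - D0) (full d)) D0).
      have -> : rcons (take (d - D0) (full d)) D0 = take (d - D0).+1 (full d).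
        by rewrite (take_nth 0) ?size_full ?nth_full; [congr rcons; lia|lia].
      apply/(sortedP 0) => i; rewrite size_takel ?size_full; last by lia.
      by move=> hi; rewrite !nth_take ?nth_full; [rewrite /adm; lia|lia|lia].
    case/and3P: st => sI pI bI.
    have {sI} : sorted (adm M) irr.
      by apply: sub_sorted sI => x y; rewrite /grows /adm; lia.
    case: irr {sumE le} pI bI => [//|x irr] pI bI /=.
    rewrite cat_path => -> /=.
    have := ramp; have : head 0 (rcons (take (d - D0) (full d)) D0) = d.
      case: (ltnP 0 (d - D0)) => h.
        by rewrite -nth0 nth_rcons szt h nth_take // nth_full subn0.
      by rewrite (_ : d - D0 = 0) ?take0 /=; lia.
    case: (rcons _ _) => //= y l -> ->; rewrite andbT.
    have : last x irr <= d.+1 by apply: (allP bI); apply: mem_last.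
    by rewrite /adm; lia.
  - by rewrite -sumE !sumn_cat sumn_nseq mul0n -[sumn (full d)](congr1 sumn cutE) sumn_cat; lia.
  by rewrite -!catA cutE => h; move: h; elim: (_ - _).
have hM : 0 < M <= M by rewrite M0 leqnn.
have [|irr' [st' sz' sum' ns']] := @NS_greedy M M irr d (nseq n M) hM st.
  by apply/orP; right; lia.
have [||b [n' [h1 h2 h3 h4]]] := ih irr' (d - (M - size irr)) _ st'.
- by lia.
- by move: sum'; rewrite sumE; lia.
by exists b, n'; split=> // h; apply/ns'/h4.
Qed.

End Greedy.

Lemma count_upset (p : pred nat) M :
  (forall i j, i <= j < M -> p i -> p j) ->
  forall i, i < M -> p i = (M - count p (iota 0 M) <= i).
Proof.
elim: M p => [//|M ih] p up i iM.
have up' : forall i j, i <= j < M -> p i.+1 -> p j.+1.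
  by move=> a b h; apply: up; lia.
have E : count p (iota 0 M.+1) = p 0 + count (fun j => p j.+1) (iota 0 M).
  by rewrite /= -[1]addn0 iotaDl count_map.
have le : count (fun j => p j.+1) (iota 0 M) <= M.
  by rewrite -[X in _ <= X](size_iota 0 M) count_size.
rewrite E; case: i iM => [|i] iM.
  case p0 : (p 0); last by lia.
  suff -> : count (fun j => p j.+1) (iota 0 M) = M by lia.
  rewrite -[RHS](size_iota 0 M); apply/eqP; rewrite -all_count.
  apply/allP => j; rewrite mem_iota => /andP[_ jM].
  by apply: (up 0) => //; lia.
rewrite (ih _ up' i); last by lia.
case p0 : (p 0); last by lia.
have : p i.+1 by apply: (up 0) => //; lia.
by rewrite (ih _ up' i); lia.
Qed.

(** * Chips *)

Section Chips.

(* The chip count [g q] is the number of cells that tiles of multiplicity [M]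
   have met in the rows up to [q], each tile meeting M chips in total: the r-th
   chip of a tile met in row [q - i] reappears i rows lower.  Hence tile number
   [n] is complete at row [q] once [g q >= n.+1 * M]. *)
Variables (M : nat) (l g : nat -> nat) (R : nat).
Hypothesis M0 : 0 < M.
Hypothesis g0 : forall q, q < M -> g q = 0.
Hypothesis l0 : forall q, q < M -> l q = 0.
Hypothesis gE : forall q, M <= q -> q < R ->
  g q = l q + \sum_(i < M) (g (q - i.+1) + i) %/ M.
Hypothesis g_lt : forall q, q.+1 < R -> 0 < g q -> g q < g q.+1.

(** The cells of row [q] that remain after [n] tiles: chips of that row belonging to later tiles,
    less those passed on by the M rows above. Truncated subtraction discards the completed tiles. *)
Definition left n q := (g q - n * M) - \sum_(i < M) ((g (q - i.+1) + i) %/ M - n).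

Lemma g_ltD q r : q + r < R -> 0 < g q -> g q + r <= g (q + r).
Proof.
elim: r => [|r ih] qR gq; first by rewrite !addn0.
have := ih _ gq; rewrite !addnS => h; have := @g_lt (q + r).
by have := qR; rewrite addnS; lia.
Qed.

Lemma g_prev q i : M <= q < R -> i < M -> g (q - i.+1) = 0 \/ g (q - i.+1) + i < g q.
Proof.
move=> qR iM; have [|gp] := posnP (g (q - i.+1)); [by left|right].
have := @g_ltD (q - i.+1) i.+1; rewrite (_ : q - i.+1 + i.+1 = q); last by lia.
by move=> /(_ _ gp); lia.
Qed.

(** This says that the outer subtraction of [left] never truncates: strict increase gives
    [g (q - i.+1) + i < g q], so each of the M terms is at most [(g q - n * M).-1 %/ M]. *)
Lemma left_ge n q : q < R ->
  \sum_(i < M) ((g (q - i.+1) + i) %/ M - n) <= g q - n * M.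
Proof.
move=> qR; have [qM|Mq] := ltnP q M.
  rewrite big1 // => i _; rewrite g0; last by lia.
  by rewrite add0n divn_small ?sub0n.
have bound (i : 'I_M) : (g (q - i.+1) + i) %/ M - n <= (g q - n * M).-1 %/ M.
  have qMR : M <= q < R by rewrite Mq.
  have [->|lt] := g_prev qMR (ltn_ord i); first by rewrite add0n divn_small.
  rewrite leq_subLR -divnMDl // leq_div2r //; lia.
apply: (@leq_trans (\sum_(i < M) (g q - n * M).-1 %/ M)); first exact: leq_sum.
rewrite sum_nat_const card_ord [M * _]mulnC; apply: leq_trans (leq_trunc_div _ _) _.
exact: leq_pred.
Qed.

Lemma left0 q : q < R -> left 0 q = l q.
Proof.
move=> qR; rewrite /left mul0n subn0; have [qM|Mq] := ltnP q M.
  by rewrite g0 ?l0 ?sub0n.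
by rewrite gE // (eq_bigr _ (fun i _ => subn0 _)) addnK.
Qed.

Section OneTile.

Variable n : nat.
(** [c q] counts the chips that tile [n] holds at row [q]. The delay [i] is late when [i.+1] rows
    earlier the tile held fewer than [M - i] chips, so that the corresponding release has not yet
    taken place. *)
Let c q := minn (g q - n * M) M.
Let late q i := c (q - i.+1) + i < M.
Let bite q := left n q - left n.+1 q.

Lemma c_mono p q : p <= q -> q < R -> 0 < c p -> minn M (c p + (q - p)) <= c q.
Proof.
move=> pq qR cp; have := @g_ltD p (q - p); rewrite subnKC // => /(_ qR).
by rewrite /c in cp *; lia.
Qed.

Lemma late_up q i j : M <= q < R -> i <= j < M -> late q i -> late q j.
Proof.
move=> qR ij; rewrite /late => hi; have [->|cp] := posnP (c (q - j.+1)); first by lia.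
by have := @c_mono (q - j.+1) (q - i.+1) _ _ cp; lia.
Qed.

Let lateness q := count (late q) (iota 0 M).

Lemma lateP q i : M <= q < R -> i < M -> late q i = (M - lateness q <= i).
Proof.
by move=> qR; apply: count_upset => a b ab; apply: late_up.
Qed.

Lemma lateness_le q : lateness q <= M.
Proof. by rewrite -[X in _ <= X](size_iota 0 M) count_size. Qed.

(** Passing from [n] to [n.+1] lowers [g q - n * M] by [c q], and lowers a release term by one
    exactly when its delay is not late. *)
Lemma left_step q : M <= q < R ->
  left n q + (M - lateness q) = left n.+1 q + c q.
Proof.
move=> qR; have /andP[Mq qR'] := qR.
have h := @left_ge n q qR'; have h' := @left_ge n.+1 q qR'.
suff : \sum_(i < M) ((g (q - i.+1) + i) %/ M - n) =
       \sum_(i < M) ((g (q - i.+1) + i) %/ M - n.+1) + (M - lateness q).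
  by move: h h'; rewrite /left /c mulSn; lia.
have -> : M - lateness q = \sum_(i < M) ~~ late q i.
  have -> : lateness q = \sum_(i < M) late q i.
    rewrite /lateness -sum1_count big_mkcond /= -{1}(subn0 M) -/(index_iota 0 M).
    by rewrite big_mkord; apply: eq_bigr => i _; case: (late q i).
  suff : \sum_(i < M) late q i + \sum_(i < M) ~~ late q i = M by lia.
  rewrite -big_split /= (eq_bigr (fun=> 1)) ?sum1_card ?card_ord // => i _.
  by case: (late q i).
rewrite -big_split; apply: eq_bigr => i _ /=.
set x := g _ + i.
suff -> : (~~ late q i : nat) = (n.+1 <= x %/ M) by lia.
by rewrite leq_divRL // mulSn /late /c /x; have := ltn_ord i; lia.
Qed.

(** Before completion delay 0 is late, hence all delays are, lateness being upward closed; the tile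
    takes whatever is left of the row. *)
Lemma bite_early q : M <= q < R -> g q <= n.+1 * M ->
  left n.+1 q = 0 /\ left n q = c q.
Proof.
move=> qR gq; have /andP[Mq qR'] := qR.
have l1 : left n.+1 q = 0 by rewrite /left; lia.
have h := left_step qR; have := lateness_le q.
suff : lateness q = M by rewrite l1 in h *; lia.
have late0 : late q 0.
  have := g_prev qR M0; rewrite /late /c; lia.
by move: late0; rewrite lateP //; have := lateness_le q; lia.
Qed.

Lemma bite_late q : M <= q < R -> n.+1 * M < g q ->
  left n q = left n.+1 q + lateness q.
Proof.
move=> qR gq; have := left_step qR; have := lateness_le q; rewrite /c.
by rewrite mulSn in gq; lia.
Qed.

Lemma left_lt_M m q : q < M -> left m q = 0.
Proof. by move=> qM; rewrite /left g0. Qed.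

Lemma bite_le q : q < R -> left n.+1 q <= left n q <= left n.+1 q + M.
Proof.
move=> qR; have [qM|Mq] := ltnP q M; first by rewrite !left_lt_M.
have qMR : M <= q < R by rewrite Mq.
have [h|h] := leqP (g q) (n.+1 * M).
  by have [-> ->] := bite_early qMR h; rewrite /c; lia.
by rewrite (bite_late qMR h); have := lateness_le q; lia.
Qed.

(** This is the pattern of [NS_bite] in terms of chips. An unfinished tile swallows rows whole, with
    strictly increasing bites [c]; a finished one bites off its lateness, which strictly decreases
    and avoids the values of [c] taken before. *)
Lemma bite_sep p q : p < q < R -> 0 < bite q ->
  bite q < bite p \/ (bite p = left n p /\ bite p <> bite q).
Proof.
move=> /andP[pq qR]; have [qM|Mq] := ltnP q M; first by rewrite {1}/bite !(left_lt_M _ qM).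
have qMR : M <= q < R by rewrite Mq.
have [pM|Mp] := ltnP p M.
  have -> : bite p = 0 by rewrite /bite !(left_lt_M _ pM).
  by rewrite (left_lt_M _ pM) => h; right; split=> //; lia.
have pMR : M <= p < R by lia.
rewrite /bite; have [hp|hp] := leqP (g p) (n.+1 * M).
  have [-> ->] := bite_early pMR hp; rewrite subn0.
  have [hq|hq] := leqP (g q) (n.+1 * M).
    have [-> ->] := bite_early qMR hq; rewrite subn0 => cq; right; split=> //.
    have [cp|cp] := posnP (c p); first by lia.
    have := @g_ltD p (q - p); rewrite subnKC ?(ltnW pq) // => /(_ qR).
    by rewrite mulSn in hq; rewrite /c in cp cq *; lia.
  rewrite (bite_late qMR hq) addKn => lq; right; split=> // e.
  (* If [lateness q = c p], the delay [q - p.+1] would be late both exactly when its sum with [c p]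
     is below M and exactly when that sum is at least M. If this delay is M or more, the delay
     [M.-1] is contradictory instead, since the tile already holds chips at row [q - M]. *)
  have [i0|i0] := leqP M (q - p.+1).
    have : late q M.-1 by rewrite lateP //; lia.
    rewrite /late prednK // => h.
    have cp : 0 < c p by rewrite e.
    have := @c_mono p (q - M) _ _ cp; lia.
  have := lateP qMR i0; rewrite /late (_ : q - (q - p.+1).+1 = p); last by lia.
  have := lateness_le q; lia.
have hq : n.+1 * M < g q.
  apply: leq_trans hp _; have := @g_ltD p (q - p); rewrite subnKC; last by lia.
  by move=> /(_ qR); lia.
rewrite (bite_late pMR hp) (bite_late qMR hq) !addKn => lq; left.
have cp : c p = M by rewrite /c; rewrite mulSn in hp; lia.
have lM := lateness_le q.
have [iq|iq] := boolP (late q (M - lateness q)); last by rewrite lateP in iq; lia.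
have dq : q - p <= M - lateness q.
  rewrite leqNgt; apply/negP => h.
  have := @c_mono p (q - (M - lateness q).+1); rewrite cp => /(_ _ _ M0).
  by move: iq; rewrite /late; lia.
have : late p (M - lateness q - (q - p)).
  move: iq; rewrite /late (_ : p - _ = q - (M - lateness q).+1); last by lia.
  lia.
by rewrite lateP //; lia.
Qed.

End OneTile.

Variable K : fieldType.
Hypothesis charK : [pchar K] =i pred0.

Lemma NS_chips n tail P :
  NS K (cells (mkseq (left n) R ++ tail)) P ->
  NS K (cells (mkseq l R ++ tail)) (nseq n M ++ P).
Proof.
elim: n P => [|n ih] P h /=.
  rewrite (_ : mkseq l R = mkseq (left 0) R) //; apply/eq_in_map => q.
  by rewrite mem_iota add0n => /andP[_ qR]; rewrite left0.
rewrite -[M :: _]/(nseq n.+1 M ++ P) -addn1 nseqD -catA; apply: ih.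
pose v := mkseq (fun q => left n q - left n.+1 q) R ++ nseq (size tail) 0.
have nv q : nth 0 v q = if q < R then left n q - left n.+1 q else 0.
  rewrite nth_cat size_mkseq; case: ifP => qR; first by rewrite nth_mkseq.
  by rewrite nth_nseq if_same.
have ns q : q < R -> nth 0 (mkseq (left n) R ++ tail) q = left n q.
  by move=> qR; rewrite nth_cat size_mkseq qR nth_mkseq.
apply: (@NS_shape K charK _ v).
- by rewrite !size_cat !size_mkseq size_nseq.
- by move=> q; rewrite nv; case: ifP => // qR; rewrite ns //; lia.
- by move=> q; rewrite nv; case: ifP => // qR; have := bite_le n qR; lia.
- move=> p q /andP[pq _]; rewrite !nv; case: ifP => // qR bq.
  by rewrite (ltn_trans pq qR) ns ?(ltn_trans pq qR) //; apply: bite_sep; rewrite ?pq.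
rewrite (_ : subs _ v = mkseq (left n.+1) R ++ tail) //.
apply: (@eq_from_nth _ 0).
  by rewrite size_subs !size_cat !size_mkseq ?size_nseq.
move=> q; rewrite size_subs ?size_cat ?size_mkseq ?size_nseq // => qR.
rewrite nth_subs ?size_cat ?size_mkseq ?size_nseq // nv !nth_cat !size_mkseq.
case: ifP => hR; last by rewrite subn0.
by rewrite !nth_mkseq //; have := bite_le n hR; lia.
Qed.

End Chips.

(** * Enumeration of the normalised states *)

Definition zrange (lo hi : Z) : seq Z :=
  [seq (lo + Z.of_nat i)%Z | i <- iota 0 (Z.to_nat (hi - lo + 1))].

Fixpoint zadd (u v : seq Z) : seq Z :=
  match u, v with
  | x :: u', y :: v' => (x + y)%Z :: zadd u' v'
  | _, _ => v
  end.

(** The entries sum to [h] by Hermite's identity, so chips are conserved. *)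
Definition release (M : nat) (h : Z) : seq Z :=
  [seq ((h + Z.of_nat i) / Z.of_nat M)%Z | i <- iota 0 M].

Definition step (M : nat) (e : seq Z) (x : Z) : seq Z :=
  zadd (rcons (behead e) x) (release M (head 0%Z e)).

(* Maximum, minimum and value of the sums over suffixes. *)
Fixpoint suffixes (u : seq Z) : Z * Z * Z :=
  if u is x :: u' then
    let: (hi, lo, s) := suffixes u' in
    let s' := (s + x)%Z in (Z.max hi s', Z.min lo s', s')
  else (0, 0, 0)%Z.

Fixpoint zsum (a : seq Z) : Z := if a is x :: a' then (x + zsum a')%Z else 0%Z.

Fixpoint dotz (a b : seq Z) : Z :=
  match a, b with x :: a', y :: b' => (x * y + dotz a' b')%Z | _, _ => 0%Z end.

Section Bounds.
Variables (M : nat) (D0 kappa : Z).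
Let Mz := Z.of_nat M.
Let c := (Mz * (Mz + 1) / 2)%Z.
Let tri := (D0 * (D0 + 1) / 2)%Z.
Let ramp := [seq Z.of_nat i | i <- iota 0 M].

(* The state before the first step is [b - k (M - i)]_i, where [b] lists the
   lengths of the M irregular rows and their area determines [k].  The factor [c]
   clears the denominator of [k]; what remains is linear in [b], and [b + ramp]
   is nondecreasing with values in [0, D0 + M]. *)
Definition start_range (a : seq Z) : Z * Z :=
  let A := dotz a [seq (Mz - j)%Z | j <- ramp] in
  let u := [seq (c * x - A)%Z | x <- a] in
  let: (hi, lo, _) := suffixes u in
  let r := (A * (kappa * c - tri) - dotz u ramp)%Z in
  ((D0 + Mz) * lo + r, (D0 + Mz) * hi + r)%Z.

Definition input (t : nat) : Z := (D0 - Z.of_nat t)%Z.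

(* A functional of state t.+1, multiplied by [M], is a functional of state [t] up
   to a rounding error, which is a sum over a suffix of [M x - S]. *)
Fixpoint range_aux (t : nat) (a : seq Z) : Z * Z * Z :=
  if t is t'.+1 then
    let S := zsum a in
    let b := [seq (Mz * x)%Z | x <- a] in
    let: (lo, hi, p) := range_aux t' (S :: belast (head 0%Z b) (behead b)) in
    let: (ehi, elo, _) := suffixes [seq (x - S)%Z | x <- b] in
    let x := (last 0%Z b * input t')%Z in
    (lo + p * (x + elo), hi + p * (x + ehi), p * Mz)%Z
  else let: (lo, hi) := start_range a in (lo, hi, c).

Definition range (t : nat) (a : seq Z) : Z * Z :=
  let: (lo, hi, p) := range_aux t a in (- (- lo / p), hi / p)%Z.
End Bounds.

(* Ordered tries hold sets of words of equal length: [TN d ch sib] stands for the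
   words of [ch] preceded by [d], together with those of [sib]. *)
Inductive trie := TE | TN of Z & trie & trie.

Fixpoint tinsert (w : seq Z) : trie -> trie :=
  if w is x :: w' then
    let ins := tinsert w' in
    fix go (t : trie) : trie :=
      if t is TN d ch sib then
        match (x ?= d)%Z with
        | Eq => TN d (ins ch) sib
        | Lt => TN x (ins TE) t
        | Gt => TN d ch (go sib)
        end
      else TN x (ins TE) TE
  else id.

Fixpoint twords (n : nat) : trie -> seq (seq Z) :=
  if n is n'.+1 then
    let rec := twords n' in
    fix go (t : trie) : seq (seq Z) :=
      if t is TN d ch sib then map (cons d) (rec ch) ++ go sib else [::]
  else fun=> [:: [::]].

Definition within (r : Z * Z) (x : Z) := ((r.1 <=? x) && (x <=? r.2))%Z.

Section Sweep.
Variable M : nat.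

(* A state lists the sum and the last of the contents chosen so far, then the
   chips released to the following rows. *)
Definition sweep1 (w : Z) (rH rP rd : Z * Z) (tbl : seq (Z * seq Z)) (t : trie) (s : seq Z) : trie :=
  match s with
  | P :: h :: z0 :: z =>
    let lo := (z0 + Z.max (- ((2 * P - rH.1) / w)) (Z.max (rP.1 - P) (h + rd.1)))%Z in
    let hi := (z0 + Z.min ((rH.2 - 2 * P) / w) (Z.min (rP.2 - P) (h + rd.2)))%Z in
    foldl (fun t gr =>
      if within (lo, hi) gr.1 then
        let x := (gr.1 - z0)%Z in tinsert [:: (P + x)%Z, x & zadd z gr.2] t
      else t) t tbl
  | _ => t
  end.

Definition sweep_step (w : Z) (rg rH rP rd : Z * Z) (S : seq (seq Z)) : seq (seq Z) :=
  let tbl := [seq (g, release M g) | g <- zrange rg.1 rg.2] in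
  twords M.+2 (foldl (sweep1 w rH rP rd tbl) TE S).

Definition dedup (S : seq (seq Z)) : seq (seq Z) :=
  twords M (foldl (fun t w => tinsert w t) TE S).

End Sweep.

Section Run.
Variables (M : nat) (D0 kappa : Z) (T : nat).
Let unit j := nseq j 0%Z ++ 1%Z :: nseq (M - j.+1) 0%Z.
Let rg j := range M D0 kappa (T + j) (unit 0).
Let rP j := range M D0 kappa T (nseq j.+1 1%Z ++ nseq (M - j.+1) 0%Z).
(** Any linear functional of the state may serve as a sieve, since [range] bounds it for every true
    state; the choice affects only the size of the enumeration. The coefficients used here are
    constant on the contents already chosen, so the stored sum suffices to test them. *)
Let rH j := range M D0 kappa T
  (nseq j 2%Z ++ (2 + Z.of_nat (M - j.+1))%Z :: nseq (M - j.+1) 0%Z).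
Let rd j := if j is j'.+1 then
  range M D0 kappa T (nseq j' 0%Z ++ [:: -1; 1]%Z ++ nseq (M - j.+1) 0%Z) else rP 0.

Fixpoint sweep (j : nat) : seq (seq Z) :=
  if j is j'.+1 then
    sweep_step M (2 + Z.of_nat (M - j)) (rg j') (rH j') (rP j') (rd j') (sweep j')
  else [:: nseq M.+2 0%Z].

Definition window_states : seq (seq Z) :=
  [seq zadd (drop 2 s) [seq input D0 (T + j) | j <- iota 0 M] | s <- sweep M].

Fixpoint down (u : nat) : seq (seq Z) :=
  if u is u'.+1 then dedup M [seq step M e (input D0 (T + M + u')) | e <- down u']
  else dedup M window_states.
End Run.

Lemma size_zadd u v : size (zadd u v) = size v.
Proof. by elim: u v => [|x u ih] [|y v] //=; rewrite ih. Qed.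

Lemma nth_zadd u v i : size u = size v ->
  nth 0%Z (zadd u v) i = (nth 0 u i + nth 0 v i)%Z.
Proof.
elim: u v i => [|x u ih] [|y v] [|i] //= [e]; exact: ih.
Qed.

Lemma size_release M h : size (release M h) = M.
Proof. by rewrite size_map size_iota. Qed.

Lemma nth_release M h i : i < M ->
  nth 0%Z (release M h) i = ((h + Z.of_nat i) / Z.of_nat M)%Z.
Proof. by move=> iM; rewrite (nth_map 0) ?size_iota // nth_iota. Qed.

Lemma size_step M e x : size (step M e x) = M.
Proof. by rewrite size_zadd size_release. Qed.

Lemma nth_step M e x i : 0 < M -> size e = M -> i < M ->
  nth 0%Z (step M e x) i =
  ((if (i.+1 < M)%N then nth 0 e i.+1 else x) + (nth 0 e 0%N + Z.of_nat i) / Z.of_nat M)%Z.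
Proof.
move=> M0 se iM; rewrite nth_zadd ?size_release; last by rewrite size_rcons size_behead se prednK.
rewrite nth_release // nth0 nth_rcons size_behead se nth_behead.
case: (ltnP i.+1 M) => h; first by rewrite ifT //; lia.
rewrite ifF; last by lia.
by rewrite ifT //; lia.
Qed.

Lemma dotzDr a u v : size u = size v ->
  dotz a (zadd u v) = (dotz a u + dotz a v)%Z.
Proof.
elim: a u v => [|x a ih] [|y u] [|z v] //= [e]; rewrite ?ih //; lia.
Qed.

Lemma dotz_rcons a b x y : size a = size b ->
  dotz (rcons a x) (rcons b y) = (dotz a b + x * y)%Z.
Proof.
by elim: a b => [|u a ih] [|v b] //=; [lia|case=> e; rewrite ih //; lia].
Qed.

Lemma dotz_scale k a b : dotz [seq (k * x)%Z | x <- a] b = (k * dotz a b)%Z.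
Proof. by elim: a b => [|x a ih] [|y b] //=; rewrite ?ih; lia. Qed.

Lemma dotz_scale_sub k s a b : size a = size b ->
  dotz [seq (k * x - s)%Z | x <- a] b = (k * dotz a b - s * zsum b)%Z.
Proof. by elim: a b => [|x a ih] [|y b] //=; [lia|case=> e; rewrite ih //; lia]. Qed.

Lemma zsum_affine k s a :
  zsum [seq (k * x - s)%Z | x <- a] = (k * zsum a - Z.of_nat (size a) * s)%Z.
Proof. by elim: a => [|x a ih]; cbn [map zsum size]; [|rewrite ih]; lia. Qed.

Lemma suffixes_bound u : let: (hi, lo, s) := suffixes u in
  s = zsum u /\ (lo <= 0 <= hi)%Z /\
  forall i, (lo <= zsum (drop i u) <= hi)%Z.
Proof.
elim: u => [|x u] /=; first by split=> //; split=> // i; rewrite /=; lia.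
case: (suffixes u) => [[hi lo] s] [es [h0 h]]; split; first by rewrite es; lia.
split; first by lia.
by case=> [|i] /=; [rewrite -/(zsum u) es; lia|have := h i; lia].
Qed.

(* Summation by parts. *)
Lemma dotz_monotone u y (top : Z) :
  size u = size y -> path Z.leb 0%Z y -> all (fun x => x <=? top)%Z y -> (0 <= top)%Z ->
  let: (hi, lo, _) := suffixes u in (top * lo <= dotz u y <= top * hi)%Z.
Proof.
move=> sz py ay t0; suff : forall p, (p <= top)%Z -> path Z.leb p y ->
  let: (hi, lo, s) := suffixes u in
  (p * s + (top - p) * lo <= dotz u y <= p * s + (top - p) * hi)%Z.
  by move=> /(_ 0%Z t0 py); case: (suffixes u) => [[hi lo] s]; lia.
elim: u y sz {py} ay => [|x u ih] [|z y] //= sz; first by move=> _ p _ _; lia.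
case: sz => sz /andP[/Z.leb_le zt ay] p pt /andP[/Z.leb_le pz py].
have := ih y sz ay z zt py.
by case: (suffixes u) => [[hi lo] s]; nia.
Qed.

(** [release] is the constant quotient plus the indicator of the last [h mod M] positions. Hence
    every rounding error is a sum over a suffix, and [suffixes] bounds it. *)
Lemma release_dot M a h : 0 < M -> size a = M ->
  let r := (h mod Z.of_nat M)%Z in
  dotz a (release M h) =
  (h / Z.of_nat M * zsum a + zsum (drop (M - Z.to_nat r) a))%Z.
Proof.
move=> M0 sa r; have hr := Z.mod_pos_bound h (Z.of_nat M).
have nr i : i < M -> ((h + Z.of_nat i) / Z.of_nat M =
    h / Z.of_nat M + if (M - Z.to_nat r <= i)%N then 1 else 0)%Z.
  move=> iM; have hd := Z.div_mod h (Z.of_nat M).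
  case: leqP => hi; symmetry.
    by apply: (Z.div_unique _ _ _ (r + Z.of_nat i - Z.of_nat M)); rewrite /r in hi *; lia.
  by apply: (Z.div_unique _ _ _ (r + Z.of_nat i)); rewrite /r in hi *; lia.
have -> : release M h = [seq (h / Z.of_nat M + if (M - Z.to_nat r <= i)%N then 1 else 0)%Z
    | i <- iota 0 M].
  by apply/eq_in_map => i; rewrite mem_iota add0n => /andP[_ iM]; apply: nr.
move: (h / _)%Z (M - _) => q m; rewrite -sa => {sa nr hr r}.
have gen : forall k, dotz a [seq (q + if (m <= i)%N then 1 else 0)%Z | i <- iota k (size a)]
    = (q * zsum a + zsum (drop (m - k) a))%Z.
  elim: a => [|x a ih] k /=; first by lia.
  rewrite ih; case: (leqP m k) => hk.
    have -> : m - k = 0 by lia.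
    have -> : m - k.+1 = 0 by lia.
    by rewrite !drop0 /=; ring.
  have -> : m - k = (m - k.+1).+1 by lia.
  by rewrite /=; ring.
by rewrite gen subn0.
Qed.

Section Bounds.

Variables (M : nat) (D0 kappa : Z) (F : nat -> seq Z) (T : nat).
Let Mz := Z.of_nat M.
Let c := (Mz * (Mz + 1) / 2)%Z.
Let tri := (D0 * (D0 + 1) / 2)%Z.
Hypothesis M0 : 0 < M.
Hypothesis D00 : (0 <= D0)%Z.
Variables (b : seq Z) (k : Z).
Hypothesis sb : size b = M.
Hypothesis bmono : path Z.leb 0%Z (zadd [seq Z.of_nat i | i <- iota 0 M] b).
Hypothesis btop : all (fun x => x <=? D0 + Mz)%Z (zadd [seq Z.of_nat i | i <- iota 0 M] b).
Hypothesis kE : ((k + kappa) * c = zsum b + tri)%Z.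
Hypothesis F0 : F 0 = zadd b [seq (- k * (Mz - Z.of_nat i))%Z | i <- iota 0 M].
Hypothesis FS : forall t, F t.+1 = step M (F t) (input D0 t).

Lemma size_F t : size (F t) = M.
Proof. by case: t => [|t]; rewrite ?FS ?size_step // F0 size_zadd size_map size_iota. Qed.

Lemma start_range_sound a : size a = M ->
  ((start_range M D0 kappa a).1 <= c * dotz a (F 0) <= (start_range M D0 kappa a).2)%Z.
Proof.
move=> sa; rewrite /start_range -/Mz -/c -/tri.
move: bmono btop; set ramp := [seq Z.of_nat i | i <- iota 0 M] => bm bt.
set A := dotz a _; set u := [seq _ | x <- a].
have su : size u = M by rewrite size_map.
have sr : size ramp = M by rewrite size_map size_iota.
have := @dotz_monotone u (zadd ramp b) (D0 + Mz)%Z _ bm bt.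
case: (suffixes u) => [[hi lo] s] /=.
rewrite size_zadd su sb => /(_ erefl) h.
have {}h := h ltac:(rewrite /Mz; lia).
rewrite dotzDr ?sr // in h.
have -> : (c * dotz a (F 0) = dotz u b + A * (kappa * c - tri))%Z.
  rewrite F0 dotzDr ?size_map ?size_iota //.
  have -> : [seq (- k * (Mz - Z.of_nat i))%Z | i <- iota 0 M] =
            [seq (- k * x)%Z | x <- [seq (Mz - j)%Z | j <- ramp]].
    by rewrite /ramp -!map_comp.
  have -> : dotz a [seq (- k * x)%Z | x <- [seq (Mz - j)%Z | j <- ramp]] = (- k * A)%Z.
    rewrite /A; elim: (a) [seq (Mz - j)%Z | j <- ramp] => [|x a' ih] [|y l] //=; rewrite ?ih; lia.
  by rewrite /u dotz_scale_sub ?sa ?sb //; lia.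
by rewrite /=; lia.
Qed.

Lemma range_aux_sound t a : size a = M ->
  let: (lo, hi, p) := range_aux M D0 kappa t a in
  (0 < p)%Z /\ (lo <= p * dotz a (F t) <= hi)%Z.
Proof.
have c0 : (0 < c)%Z.
  by rewrite /c /Mz; apply: Z.div_str_pos; nia.
elim: t a => [|t ih] a sa /=.
  have := start_range_sound sa; rewrite /=.
  by case: (start_range _ _ _ _) => lo hi /=; rewrite -/Mz -/c; lia.
set S := zsum a; set bb := [seq _ | x <- a].
have sbb : size bb = M by rewrite size_map.
have -> : [seq (x - S)%Z | x <- bb] = [seq (Mz * x - S)%Z | x <- a] by rewrite -map_comp.
have := suffixes_bound [seq (Mz * x - S)%Z | x <- a].
case: (suffixes _) => [[ehi elo] s] [_ [_ hs]].
have := ih (S :: belast (head 0%Z bb) (behead bb)).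
have sz1 : size (S :: belast (head 0%Z bb) (behead bb)) = M.
  by rewrite /= size_belast size_behead sbb prednK.
move=> /(_ sz1); case: (range_aux _ _ _ _ _) => [[lo hi] p] [p0 hF].
split; first by rewrite /Mz; nia.
have bE : bb = rcons (belast (head 0%Z bb) (behead bb)) (last 0%Z bb).
  by case: (bb) sbb M0 => [<- //|x l] _ _ /=; rewrite -lastI.
have sF := size_F t.
case FE : (F t) sF => [|h e]; first by move=> e0; have := M0; rewrite -e0.
move=> /= se; have seb : size (belast (head 0%Z bb) (behead bb)) = size e.
  by rewrite size_belast size_behead sbb -se.
have key : (Mz * dotz a (F t.+1) = dotz (S :: belast (head 0%Z bb) (behead bb)) (F t)
    + last 0%Z bb * input D0 t + zsum (drop (M - Z.to_nat (h mod Mz)) [seq (Mz * x - S)%Z | x <- a]))%Z.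
  rewrite FS FE /step /= dotzDr ?size_release ?size_rcons ?se // release_dot // -/Mz.
  rewrite Z.mul_add_distr_l -dotz_scale -/bb {1}bE dotz_rcons // -/S.
  have -> : zsum (drop (M - Z.to_nat (h mod Mz)) [seq (Mz * x - S)%Z | x <- a]) =
    (Mz * zsum (drop (M - Z.to_nat (h mod Mz)) a) - (h mod Mz) * S)%Z.
    have hm : (0 <= h mod Mz < Mz)%Z by apply: Z.mod_pos_bound; rewrite /Mz; lia.
    rewrite -map_drop.
    have hn : (h mod Mz = Z.of_nat (size (drop (M - Z.to_nat (h mod Mz)) a)))%Z.
      by rewrite size_drop sa /Mz in hm *; lia.
    by rewrite {3}hn; apply: zsum_affine.
  have hS : (S * h = S * (Mz * (h / Mz) + h mod Mz))%Z.
    by rewrite -Z.div_mod // /Mz; lia.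
  by lia.
have := hs (M - Z.to_nat (h mod Mz)); nia.
Qed.

Lemma range_sound t a : size a = M ->
  ((range M D0 kappa t a).1 <= dotz a (F t) <= (range M D0 kappa t a).2)%Z.
Proof.
move=> sa; rewrite /range; have := range_aux_sound t sa.
case: (range_aux _ _ _ _ _) => [[lo hi] p] [p0 h] /=; split.
  suff : (- dotz a (F t) <= - lo / p)%Z by lia.
  by apply: Z.div_le_lower_bound; nia.
by apply: Z.div_le_lower_bound; nia.
Qed.

End Bounds.

Lemma tinsert_mem n w t : size w = n -> w \in twords n (tinsert w t).
Proof.
elim: n w t => [|n ih] [|x w] //= t [sw]; elim: t => [|d ch _ sib ihs] /=.
  by rewrite cats0 map_f // ih.
case: Z.compare_spec => [e|_|_] /=; rewrite mem_cat.
- by rewrite e map_f // ih.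
- by rewrite map_f // ih.
by rewrite ihs orbT.
Qed.

Lemma tinsert_sub n w t : size w = n -> {subset twords n t <= twords n (tinsert w t)}.
Proof.
elim: n w t => [|n ih] [|x w] //= t; first by move=> _ y.
case=> sw; elim: t => [|d ch _ sib ihs] //= y.
case: Z.compare_spec => [e|_|_] /=; rewrite ?mem_cat.
- case/orP=> [/mapP[y' hy' ->]|->]; last by rewrite orbT.
  by rewrite map_f //; apply: ih.
- by move=> ->; rewrite orbT.
by case/orP=> [->|/ihs ->]; rewrite ?orbT.
Qed.

(** Tries only grow along the fold, so it is enough that one element of the list inserts [w],
    whatever the trie it meets. *)
Lemma foldl_words (A : eqType) n (f : trie -> A -> trie) (a : A) (l : seq A) w t :
  {in l, forall a t, {subset twords n t <= twords n (f t a)}} ->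
  a \in l -> (forall t, w \in twords n (f t a)) -> w \in twords n (foldl f t l).
Proof.
move=> sub al hw.
have grow : forall l' t', {subset l' <= l} -> w \in twords n t' -> w \in twords n (foldl f t' l').
  elim=> //= b l' ih t' hl h; apply: ih => [c cl|]; first by apply: hl; rewrite inE cl orbT.
  by apply: sub => //; apply: hl; apply: mem_head.
elim: l t al sub grow => //= b l ih t; rewrite inE => /predU1P[ab|al] sub grow.
  by rewrite -ab; apply: grow (hw t) => c cl; rewrite inE cl orbT.
apply: ih => // [c cl|l' t' hl]; first by apply: sub; rewrite inE cl orbT.
by apply: grow => c /hl cl; rewrite inE cl orbT.
Qed.

Lemma dedup_mem n S w : {in S, forall w, size w = n} -> w \in S -> w \in dedup n S.
Proof.
move=> hS wS; apply: (foldl_words (a := w)) => // [v vS t|t].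
  by apply: tinsert_sub; apply: hS.
by apply: tinsert_mem; apply: hS.
Qed.

Lemma mem_zrange lo hi x : (lo <= x <= hi)%Z -> x \in zrange lo hi.
Proof.
move=> h; apply/mapP; exists (Z.to_nat (x - lo)); last by lia.
by rewrite mem_iota; lia.
Qed.

Arguments tinsert : simpl never.
Arguments twords : simpl never.
Arguments Z.mul : simpl never.

Lemma sweep1_sub M w rH rP rd (tbl : seq (Z * seq Z)) t s :
  (forall x, x \in tbl -> size x.2 = M) -> size s = M.+2 ->
  {subset twords M.+2 t <= twords M.+2 (sweep1 w rH rP rd tbl t s)}.
Proof.
move=> szr; case: s => [|P [|h [|z0 z]]] // _ v; rewrite /sweep1 //.
elim: tbl t szr => [t _ //|x l ih t szr hv] /=; apply: ih => [y yl|].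
  by apply: szr; rewrite inE yl orbT.
case: ifP => // _; apply: tinsert_sub hv.
by rewrite /= size_zadd szr ?mem_head.
Qed.

Lemma dotz_nil_r a : dotz a [::] = 0%Z.
Proof. by case: a. Qed.

Lemma dotz_zeros n l : dotz (nseq n 0%Z) l = 0%Z.
Proof. by elim: n l => [|n ih] [|x l] //=; rewrite ih. Qed.

Lemma dotz_zeros_cat n a l : dotz (nseq n 0%Z ++ a) l = dotz a (drop n l).
Proof. by elim: n l => [|n ih] [|x l] //=; rewrite ?dotz_nil_r // ih. Qed.

Lemma dotz_const_cat n v a l : n <= size l ->
  dotz (nseq n v ++ a) l = (v * zsum (take n l) + dotz a (drop n l))%Z.
Proof.
elim: n l => [|n ih] [|x l] //= h; rewrite ?take0 ?drop0 /=; try by lia.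
by rewrite ih //; lia.
Qed.

Lemma dotz_head n l : dotz (nseq 0 0%Z ++ 1%Z :: nseq n 0%Z) l = head 0%Z l.
Proof.
case: l => [|x l] //.
by rewrite -[LHS]/(1 * x + dotz (nseq n 0%Z) l)%Z dotz_zeros -[RHS]/x; lia.
Qed.

Section Sweep.

Variables (M : nat) (D0 kappa : Z) (T : nat) (F : nat -> seq Z).
Hypothesis M0 : 0 < M.
Hypothesis sF : forall t, size (F t) = M.
Hypothesis FS : forall t, F t.+1 = step M (F t) (input D0 t).
Hypothesis rangeP : forall t a, size a = M ->
  ((range M D0 kappa t a).1 <= dotz a (F t) <= (range M D0 kappa t a).2)%Z.

Let H j := nth 0%Z (F T) j.

(** The chips that the first [j] rows of the window at [T] have passed on to the positions of the
    window at [T + j]. *)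
Fixpoint released (j : nat) : seq Z :=
  if j is j'.+1 then
    zadd (behead (released j')) (release M (H j' + head 0%Z (released j')))
  else nseq M 0%Z.

Lemma size_released j : size (released j) = M.
Proof. by case: j => [|j] /=; rewrite ?size_nseq // size_zadd size_release. Qed.

Lemma nth_zadd_behead z r i : size z = size r -> i < size r ->
  nth 0%Z (zadd (behead z) r) i = (nth 0 z i.+1 + nth 0 r i)%Z.
Proof.
case: z => [|x z] /=; first by case: r.
elim: r x z i => [//|y r ih] x [|x' z] [|i] //= [e] hi; rewrite ?(ih x') // ?e //.
Qed.

Lemma nth_F j i : j <= M -> i < M ->
  nth 0%Z (F (T + j)) i =
  (nth 0 (released j) i + if (j + i < M)%N then H (j + i) else input D0 (T + (j + i - M)))%Z.
Proof.
elim: j i => [|j ih] i jM iM; first by rewrite addn0 /= nth_nseq if_same add0n iM.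
have hE : nth 0%Z (F (T + j)) 0 = (H j + head 0 (released j))%Z.
  by rewrite ih // ?(ltnW jM) // addn0 jM nth0; lia.
rewrite addnS FS nth_step // hE.
rewrite /= nth_zadd_behead ?size_release ?size_released // nth_release // addSnnS.
have [h|h] := ltnP i.+1 M; first by rewrite ih ?(ltnW jM) //; lia.
rewrite ifF; last by lia.
rewrite (nth_default _ (_ : size (released j) <= i.+1)) ?size_released //.
rewrite (_ : j + i.+1 - M = j); last by lia.
lia.
Qed.

Lemma size_twords n (w : seq Z) t : w \in twords n t -> size w = n.
Proof.
elim: n w t => [|n ih] w t; first by rewrite inE => /eqP ->.
elim: t => // d ch _ sib ihs; rewrite mem_cat => /orP[/mapP[w' /ih h ->]|/ihs//].
by rewrite /= h.
Qed.

Lemma size_sweep i w : w \in sweep M D0 kappa T i -> size w = M.+2.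
Proof.
case: i => [|i] /=; last exact: size_twords.
by rewrite inE => /eqP ->; rewrite /= size_nseq.
Qed.

Let prev j := if j is j'.+1 then H j' else 0%Z.

Lemma sweep_step_mem j : j < M ->
  [:: zsum (take j (F T)), prev j & released j] \in sweep M D0 kappa T j ->
  [:: zsum (take j.+1 (F T)), H j & released j.+1] \in sweep M D0 kappa T j.+1.
Proof.
move=> jM hS.
pose w := (2 + Z.of_nat (M - j.+1))%Z.
pose rg := range M D0 kappa (T + j) (nseq 0 0%Z ++ 1%Z :: nseq (M - 1) 0%Z).
pose rH := range M D0 kappa T (nseq j 2%Z ++ w :: nseq (M - j.+1) 0%Z).
pose rP := range M D0 kappa T (nseq j.+1 1%Z ++ nseq (M - j.+1) 0%Z).
pose rd := if j is j'.+1 then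
  range M D0 kappa T (nseq j' 0%Z ++ [:: -1; 1]%Z ++ nseq (M - j.+1) 0%Z)
  else range M D0 kappa T (nseq 1 1%Z ++ nseq (M - 1) 0%Z).
have -> : sweep M D0 kappa T j.+1 = sweep_step M w rg rH rP rd (sweep M D0 kappa T j) by [].
rewrite /sweep_step; set tbl := [seq _ | g <- _].
pose g := (H j + head 0%Z (released j))%Z.
have jF : j < size (F T) by rewrite sF.
have takeE : zsum (take j.+1 (F T)) = (zsum (take j (F T)) + H j)%Z.
  rewrite (take_nth 0%Z jF) -cats1 /H; elim: (take j _) => [|x l ih] /=; first by lia.
  by rewrite ih; lia.
have hg : (rg.1 <= g <= rg.2)%Z.
  have := rangeP (T + j) (a := nseq 0 0%Z ++ 1%Z :: nseq (M - 1) 0%Z).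
  rewrite -/rg dotz_head => /(_ _); rewrite size_cat /= size_nseq subn1 prednK // => /(_ erefl).
  by have := nth_F (ltnW jM) M0; rewrite addn0 jM nth0 /g nth0; lia.
have hP : (rP.1 <= zsum (take j (F T)) + H j <= rP.2)%Z.
  have := rangeP T (a := nseq j.+1 1%Z ++ nseq (M - j.+1) 0%Z).
  rewrite size_cat !size_nseq subnKC // => /(_ erefl).
  rewrite dotz_const_cat ?sF // dotz_zeros takeE -/rP; lia.
have hH : (rH.1 <= 2 * zsum (take j (F T)) + w * H j <= rH.2)%Z.
  have := rangeP T (a := nseq j 2%Z ++ w :: nseq (M - j.+1) 0%Z).
  rewrite size_cat /= !size_nseq addnS -addSn subnKC // => /(_ erefl).
  rewrite dotz_const_cat ?sF ?(ltnW jM) // (drop_nth 0%Z jF) /= dotz_zeros -/rH -/(H j); lia.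
have hd : (rd.1 <= H j - prev j <= rd.2)%Z.
  rewrite /rd /prev; move: hP; rewrite /rP; case: (j) jM jF => [|i] iM iF hP.
    by move: hP; rewrite take0 [zsum _]/=; lia.
  have sz : size (nseq i 0%Z ++ [:: -1; 1]%Z ++ nseq (M - i.+2) 0%Z) = M.
    by rewrite !size_cat /= !size_nseq; lia.
  have := rangeP T sz.
  rewrite dotz_zeros_cat (drop_nth 0%Z (ltnW iF)) (drop_nth 0%Z iF).
  rewrite -[dotz ([:: -1; 1]%Z ++ _) _]/(-1 * H i +
    (1 * H i.+1 + dotz (nseq (M - i.+2) 0%Z) (drop i.+2 (F T))))%Z.
  by rewrite dotz_zeros; lia.
have w0 : (0 < w)%Z by rewrite /w; lia.
have szr x : x \in tbl -> size x.2 = M by case/mapP=> y _ ->; rewrite size_release.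
apply: (foldl_words _ _ hS) => [s sS t|t]; first exact: sweep1_sub szr (size_sweep sS).
have := size_released j; rewrite /sweep1; case rE : (released j) => [|z0 z] /= sz.
  by have := M0; rewrite -sz.
have gtbl : (g, release M g) \in tbl.
  by apply/mapP; exists g => //; apply: mem_zrange.
apply: (foldl_words _ _ gtbl) => [x /szr xl t' v|t'] /=.
  by case: ifP => // _ hv; apply: tinsert_sub hv; rewrite /= size_zadd xl.
have h1 : (- ((2 * zsum (take j (F T)) - rH.1) / w) <= H j)%Z.
  suff : (- H j <= (2 * zsum (take j (F T)) - rH.1) / w)%Z by lia.
  by apply: Z.div_le_lower_bound; nia.
have h2 : (H j <= (rH.2 - 2 * zsum (take j (F T))) / w)%Z.
  by apply: Z.div_le_lower_bound; nia.
have gE : g = (z0 + H j)%Z by rewrite /g rE /=; lia.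
rewrite ifT; last by rewrite /within /= gE; lia.
have -> : (g - z0)%Z = H j by rewrite gE; lia.
rewrite -takeE rE /= (_ : (H j + z0)%Z = g); last by rewrite gE; lia.
by apply: tinsert_mem; rewrite /= size_zadd size_release.
Qed.

Lemma sweep_mem j : j <= M ->
  [:: zsum (take j (F T)), prev j & released j] \in sweep M D0 kappa T j.
Proof.
elim: j => [|j ih] jM; first by rewrite take0 inE.
by apply: sweep_step_mem => //; apply: ih; apply: ltnW.
Qed.

(** After M steps every original content has left the window. The state is then made of released
    chips and fresh inputs alone, which is why the sweep may forget the individual contents and
    merge partial states. *)
Lemma window_states_mem : F (T + M) \in window_states M D0 kappa T.
Proof.
apply/mapP; exists [:: zsum (take M (F T)), prev M & released M]; first exact: sweep_mem.
apply: (@eq_from_nth _ 0%Z); first by rewrite sF size_zadd size_map size_iota.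
move=> i; rewrite sF => iM; rewrite nth_F // ifF; last by lia.
rewrite [drop 2 _]/= drop0 nth_zadd ?size_released ?size_map ?size_iota //.
by rewrite (nth_map 0) ?size_iota // nth_iota // add0n addKn.
Qed.

Lemma down_mem u : F (T + M + u) \in down M D0 kappa T u.
Proof.
elim: u => [|u ih] /=; apply: dedup_mem.
- by move=> w /mapP[s _ ->]; rewrite size_zadd size_map size_iota.
- by rewrite addn0; apply: window_states_mem.
- by move=> w /mapP[s _ ->]; rewrite size_step.
by rewrite addnS FS; apply/mapP; exists (F (T + M + u)).
Qed.

End Sweep.

(** * Explicit tilings *)

(** The linear form ordering the cells inside a row comes first, the form indexing the rows
    second. *)
Definition direction : Type := (Z * Z) * (Z * Z).

Definition group_rows (f : cell -> Z) (s : seq cell) : seq (seq cell) :=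
  foldr (fun a rows =>
    match rows with
    | (b :: r) :: rows' => if (f a =? f b)%Z then (a :: b :: r) :: rows' else [:: a] :: rows
    | _ => [:: a] :: rows
    end) [::] s.

Lemma flatten_group_rows f s : flatten (group_rows f s) = s.
Proof.
elim: s => //= a s; case: (group_rows f s) => [|[|b r] rows] //= <- //.
by case: (f a =? f b)%Z.
Qed.

(** A mere proposal: the largest number still available, or the whole row if it is shorter. Repeated
    numbers may result; [bites_ok] rejects them. *)
Fixpoint greedy_bites (S : seq nat) (rows : seq (seq cell)) : seq nat :=
  match S, rows with
  | m :: _, r :: rows' =>
    let b := minn m (size r) in b :: greedy_bites (rem b S) rows'
  | _, _ => [::]
  end.

(** The clause on [v'] is the separation hypothesis of [NS_shape], here for rows in an arbitrary
    lattice direction. *)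
Fixpoint bites_ok (M : nat) (rows : seq (seq cell)) (v : seq nat) : bool :=
  match rows, v with
  | r :: rows', k :: v' =>
    [&& k <= size r, k <= M,
        all (fun j => [|| j == 0, j < k | (k == size r) && (k != j)]) v' &
        bites_ok M rows' v']
  | _, [::] => true
  | [::], _ :: _ => false
  end.

Fixpoint bite_rows (rows : seq (seq cell)) (v : seq nat) : seq (seq cell) :=
  match rows, v with
  | r :: rows', k :: v' => drop k r :: bite_rows rows' v'
  | _, _ => rows
  end.

Definition row_ok (tx te : cell -> Z) (r : seq cell) : bool :=
  if r is a :: r' then
    path (fun a b => (tx b <? tx a)%Z) a r' && all (fun b => te b =? te a)%Z r'
  else false.

Definition rows_ok (tx te : cell -> Z) (rows : seq (seq cell)) : bool :=
  all (row_ok tx te) rows &&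
  sorted (fun r r' => (te (head (0, 0)%Z r') <? te (head (0, 0)%Z r))%Z) rows.

(* The key sorts by rows and then inside the rows as long as the cells are small;
   [rows_ok] checks the outcome. *)
Definition bite (M : nat) (d : direction) (D : seq cell) : option (seq cell) :=
  let tx := aff (d.1, 0%Z) in let te := aff (d.2, 0%Z) in
  let keyed := [seq ((1024 * te a + tx a)%Z, a) | a <- D] in
  let D' := [seq x.2 | x <- sort (fun x y => (y.1 <=? x.1)%Z) keyed] in
  let rows := group_rows te D' in
  let v := greedy_bites (rev (iota 1 M)) rows in
  if rows_ok tx te rows && bites_ok M rows v then Some (flatten (bite_rows rows v))
  else None.

Fixpoint bites (M : nat) (ds : seq direction) (D : seq cell) : bool :=
  if ds is d :: ds' then
    if bite M d D is Some D' then bites M ds' D' else false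
  else nilp D.

Section Soundness.

Variable K : fieldType.
Hypothesis charK : [pchar K] =i pred0.

Lemma bites_okP M rows v : bites_ok M rows v ->
  [/\ size v <= size rows,
      forall i, nth 0 v i <= size (nth [::] rows i),
      forall i, nth 0 v i <= M &
      forall i j, i < j -> 0 < nth 0 v j -> nth 0 v j < nth 0 v i \/
        (nth 0 v i = size (nth [::] rows i) /\ nth 0 v i <> nth 0 v j)].
Proof.
elim: rows v => [|r rows ih] [|k v] //=.
- by split=> // [i|i|i j]; rewrite !nth_nil.
- by split=> // [i|i|i j]; rewrite !nth_nil.
case/and4P=> h1 h2 /(all_nthP 0) h3 /ih[i1 i2 i3 i4]; split=> //.
- by case.
- by case.
case=> [|i] [|j] //= ij hj; last exact: i4.
have jv : j < size v by rewrite ltnNge; apply: contraL hj => h; rewrite nth_default.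
by have := h3 j jv; lia.
Qed.

Lemma mem_bite_rows rows v a : uniq (flatten rows) ->
  reflect (exists i, i < size rows /\ a \in drop (nth 0 v i) (nth [::] rows i))
          (a \in flatten (bite_rows rows v)).
Proof.
move=> _; elim: rows v => [|r rows ih] v /=.
  by case: v => [|k v]; constructor; case=> i [].
case: v => [|k v] /=.
  rewrite mem_cat; apply: (iffP orP) => [[h|/flattenP[s hs h]]|[[|i] [hi h]]].
  - by exists 0; rewrite drop0.
  - have := hs; rewrite -index_mem => hi.
    by exists (index s rows).+1; rewrite nth_nil drop0 /= nth_index.
  - by left; rewrite drop0 in h.
  - by right; apply/flattenP; exists (nth [::] rows i); [apply: mem_nth|rewrite nth_nil drop0 in h].
rewrite mem_cat; apply: (iffP orP) => [[h|/ih[i [hi h]]]|[[|i] [hi h]]].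
- by exists 0.
- by exists i.+1.
- by left.
- by right; apply/ih; exists i.
Qed.

(** Rows are listed by decreasing [te] and their cells by decreasing [tx], so dropping an initial
    piece of each list removes the far ends, as [NS_rows] demands. *)
Lemma NS_bite_rows (d : direction) M (rows : seq (seq cell)) (v : seq nat) P :
  let tx := aff (d.1, 0%Z) in let te := aff (d.2, 0%Z) in
  rows_ok tx te rows -> bites_ok M rows v ->
  NS K (flatten (bite_rows rows v)) P -> NS K (flatten rows) (M :: P).
Proof.
move=> tx te /andP[/(all_nthP [::]) rok rsort] /bites_okP[szv v_le v_M v_sep] hNS.
pose row i := nth [::] rows i.
pose E i := te (head (0, 0)%Z (row i)).
have teE i a : a \in row i -> te a = E i.
  have [hi|hi] := ltnP i (size rows); last by rewrite /row nth_default.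
  have := rok i hi; rewrite /E -/(row i); case: (row i) => //= b r /andP[_ /allP h].
  by rewrite inE => /predU1P[->//|/h/Z.eqb_eq].
have txS i : sorted (fun a b => (tx b <? tx a)%Z) (row i).
  have [hi|hi] := ltnP i (size rows); last by rewrite /row nth_default.
  by have := rok i hi; rewrite -/(row i); case: (row i) => //= b r /andP[].
have trx : transitive (fun a b => (tx b <? tx a)%Z) by move=> y x z; lia.
have txU i : uniq (row i) by apply: (sorted_uniq trx) => // a; lia.
have Edec i j : i < j < size rows -> (E j < E i)%Z.
  case/andP=> ij jr.
  have tr : transitive (fun r r' => (te (head (0, 0)%Z r') <? te (head (0, 0)%Z r))%Z).
    by move=> y x z; lia.
  have := sorted_ltn_nth tr [::] rsort i j; rewrite !inE (ltn_trans ij jr) jr.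
  by move=> /(_ isT isT ij) /Z.ltb_lt.
have memP (a : cell) : reflect (exists2 i, i < size rows & a \in row i) (a \in flatten rows).
  apply: (iffP flattenP) => [[s hs h]|[i hi h]]; last by exists (row i) => //; apply: mem_nth.
  by exists (index s rows); [rewrite index_mem|rewrite /row nth_index].
have Einj i j : i < size rows -> j < size rows -> E i = E j -> i = j.
  move=> hi hj e; case: (ltngtP i j) => // ij.
    by have := Edec i j; rewrite ij hj => /(_ isT); lia.
  by have := Edec j i; rewrite ij hi => /(_ isT); lia.
have uD : uniq (flatten rows).
  have : forall n, uniq (flatten (drop n rows)).
    move=> n; have [m] := ubnP (size rows - n); elim: m n => // m ih n hm.
    have [hn|hn] := ltnP n (size rows); last by rewrite drop_oversize.
    rewrite (drop_nth [::] hn) /= cat_uniq txU ih ?andbT; last by lia.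
    apply/hasPn => a /flattenP[s /(nthP [::])[i]]; rewrite size_drop => hi <-.
    rewrite nth_drop => /teE e1; apply/negP => /teE e2.
    have h1 : n.+1 + i < size rows by rewrite -ltn_subRL.
    by have := Einj _ _ h1 hn; rewrite -e1 -e2 => /(_ erefl); lia.
  by move=> /(_ 0); rewrite drop0.
pose ix e := find (fun r => te (head (0, 0)%Z r) =? e)%Z rows.
have ixE i : i < size rows -> ix (E i) = i.
  move=> hi; have hh : has (fun r => te (head (0, 0)%Z r) =? E i)%Z rows.
    by apply/hasP; exists (row i); [apply: mem_nth|rewrite Z.eqb_refl].
  apply: Einj => //; first by rewrite -has_find.
  by have /Z.eqb_eq := nth_find [::] hh.
pose w e := nth 0 v (ix e).
pose D1 (a : cell) := index a (row (ix (te a))) < w (te a).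
have cntE (S : seq cell) i (p : pred cell) : i < size rows ->
    (forall a, p a -> a \in flatten rows -> a \in S) -> count p (flatten rows) <= size S.
  move=> hi h; rewrite -size_filter; apply: uniq_leq_size; first exact: filter_uniq.
  by move=> a; rewrite mem_filter => /andP[pa aD]; apply: h.
have idx i a b : a \in row i -> b \in row i -> (tx a < tx b)%Z -> index b (row i) < index a (row i).
  move=> ha hb lt; rewrite ltnNge; apply/negP; rewrite leq_eqVlt => /predU1P[e|lt'].
    by move: lt; rewrite -(nth_index (0, 0)%Z ha) e nth_index //; lia.
  have := sorted_ltn_nth trx (0, 0)%Z (txS i) (index a (row i)) (index b (row i)).
  by rewrite !inE !index_mem ha hb !nth_index // => /(_ isT isT lt') /Z.ltb_lt; lia.
apply: (@NS_rows K charK (d.1, 0%Z) (d.2, 0%Z) (flatten rows) D1 w).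
- exact: uD.
- move=> a b /memP[i hi ai] /memP[j hj bj]; rewrite -/te -/tx (teE i) // (teE j) // => e1 e2.
  have ij := Einj i j hi hj e1; subst j.
  apply/eqP/idPn => ne; have ab : index a (row i) != index b (row i).
    apply: contra ne => /eqP e; by rewrite -(nth_index (0, 0)%Z ai) e nth_index.
  case: (ltngtP (index a (row i)) (index b (row i))) ab => // lt' _.
    have := sorted_ltn_nth trx (0, 0)%Z (txS i) (index a (row i)) (index b (row i)).
    by rewrite !inE !index_mem ai bj !nth_index // => /(_ isT isT lt') /Z.ltb_lt; lia.
  have := sorted_ltn_nth trx (0, 0)%Z (txS i) (index b (row i)) (index a (row i)).
  by rewrite !inE !index_mem ai bj !nth_index // => /(_ isT isT lt') /Z.ltb_lt; lia.
- move=> a /memP[i hi ai]; rewrite -/te -/tx /D1 /w (teE i) // ixE // => hd.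
  rewrite v_M andbT; apply: leq_ltn_trans hd.
  rewrite -(size_takel (index_size a (row i))); apply: (cntE _ i _ hi) => b /andP[/eqP e lt].
  move=> /memP[j hj bj]; rewrite (teE j) // in e; have ij := Einj j i hj hi e; subst j.
  have h := idx i a b ai bj; rewrite -(nth_index (0, 0)%Z bj).
  rewrite -(nth_take (0, 0)%Z (h _)); last by lia.
  by apply: mem_nth; rewrite size_takel ?index_size //; apply: h; lia.
- move=> a b /memP[i hi ai] /memP[j hj bj]; rewrite -/te -/tx /D1 /w (teE i) // (teE j) // !ixE //.
  move=> hd lt; split=> // hv.
  have ji : j < i.
    rewrite ltnNge; apply/negP; rewrite leq_eqVlt => /predU1P[e|ij]; first by subst j; lia.
    by have := Edec i j; rewrite ij hj => /(_ isT); lia.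
  have [] := v_sep j i ji; [lia|lia|move=> [-> _]].
  apply: (cntE _ j _ hj) => c /eqP e /memP[k hk ck]; rewrite (teE k) // in e.
  by rewrite -(Einj k j hk hj e).
- move=> a b /memP[i hi ai] /memP[j hj bj]; rewrite -/te /w (teE i) // (teE j) // !ixE //.
  move=> e h0; case: (ltngtP i j) => [ij|ji|->//].
    by have [] := v_sep i j ij; [lia|lia|move=> [_]; rewrite e].
  by have [] := v_sep j i ji; [lia|lia|move=> [_]; rewrite e].
apply: NS_eq_mem hNS => a; rewrite mem_filter.
apply/(mem_bite_rows _ _ uD)/andP => [[i [hi h]]|[h /memP[i hi ai]]].
  have ai : a \in row i by apply: mem_drop h.
  split; last by apply/memP; exists i.
  rewrite /D1 /w (teE i) // ixE // -leqNgt leqNgt; apply/negP => hlt.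
  have := txU i; rewrite -(cat_take_drop (nth 0 v i) (row i)) cat_uniq => /and3P[_ /hasP hn _].
  apply: hn; exists a => //; rewrite -(nth_index (0, 0)%Z ai) -(nth_take (0, 0)%Z hlt).
  by apply: mem_nth; rewrite size_takel // ; apply: v_le.
exists i; split=> //; move: h; rewrite /D1 /w (teE i) // ixE // -leqNgt => h.
rewrite -(nth_index (0, 0)%Z ai) -{1}(subnKC h) -nth_drop; apply: mem_nth.
have ai' : index a (row i) < size (row i) by rewrite index_mem.
by rewrite size_drop ltn_sub2r // (leq_ltn_trans h).
Qed.

Lemma biteP M d D D' P : bite M d D = Some D' -> NS K D' P -> NS K D (M :: P).
Proof.
rewrite /bite; set D2 := [seq _ | _ <- sort _ _]; case: ifP => // /andP[h1 h2] [<-].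
move=> /(NS_bite_rows h1 h2); rewrite flatten_group_rows; apply: NS_eq_mem => a.
rewrite /D2; apply/mapP/idP => [[x]|aD].
  by rewrite mem_sort => /mapP[b bD ->] ->.
by exists ((1024 * aff (d.2, 0%Z) a + aff (d.1, 0%Z) a)%Z, a); rewrite // mem_sort map_f.
Qed.

Lemma bitesP M ds D : bites M ds D -> NS K D (nseq (size ds) M).
Proof.
elim: ds D => [|d ds ih] D /=; first by move/nilP => ->; apply: NS_nil.
by case h: (bite M d D) => [D'|//] /ih; apply: biteP h.
Qed.

End Soundness.

Fixpoint heads (M : nat) (D0 : Z) (t n : nat) (e : seq Z) : seq Z :=
  if n is n'.+1 then head 0%Z e :: heads M D0 t.+1 n' (step M e (input D0 t)) else [::].

(** This computes [left] from normalised chip counts. The sum stops at [j] because rows above the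
    window have nothing to release for the tiles after the first [N]. *)
Definition rest_row (M : nat) (N : Z) (gs : seq Z) (j : nat) : nat :=
  Z.to_nat (Z.max 0 (nth 0 gs j - N * Z.of_nat M) -
    zsum [seq Z.max 0 ((nth 0 gs (j - i.+1)%N + Z.of_nat i) / Z.of_nat M - N) | i <- iota 0 j])%Z.

Definition rest_shape (M D0 t : nat) (N : Z) (e : seq Z) : seq nat :=
  let gs := heads M (Z.of_nat D0) t M e in
  [seq rest_row M N gs j | j <- iota 0 M] ++ full (D0 - t).

(* [N] is the number of tiles completed by row [t], relative to the offset. *)
Definition certify (M D0 : nat) (kappa : Z) (t : nat) (e : seq Z) (ds : seq direction) : bool :=
  let N := (- (- head 0 e / Z.of_nat M))%Z in
  (N + Z.of_nat (size ds) =? kappa)%Z && bites M ds (cells (rest_shape M D0 t N e)).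

Definition window_check (M D0 : nat) (kappa : Z) (T u : nat) (certs : seq (seq direction)) : bool :=
  let t := T + M + u in
  (* The second test keeps the full rows in the range of the strict increase at length 2M or
     more. *)
  [&& 0 < M, 2 * M + t <= D0 + 2, t <= D0 &
      all2 (certify M D0 kappa t) (down M (Z.of_nat D0) kappa T u) certs].

(** * The chip recursion of a given window and its normalisation *)

Lemma of_nat_divn a b : Z.of_nat (a %/ b) = (Z.of_nat a / Z.of_nat b)%Z.
Proof.
case: b => [|b]; first by rewrite divn0 Zdiv_0_r.
apply: (Z.div_unique _ _ _ (Z.of_nat (a %% b.+1))); last first.
  by rewrite {1}(divn_eq a b.+1) Nat2Z.inj_add Nat2Z.inj_mul; lia.
by left; have := ltn_pmod a (ltn0Sn b); lia.
Qed.

(** Course-of-values recursion: the counts of all rows before [q], most recent first. *)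
Fixpoint history (M : nat) (l : nat -> nat) (q : nat) : seq nat :=
  if q is q'.+1 then
    let h := history M l q' in
    (if q' < M then 0 else l q' + \sum_(i < M) (nth 0 h i + i) %/ M) :: h
  else [::].

Definition chips M l q := head 0 (history M l q.+1).

Lemma nth_history M l q i : i < q -> nth 0 (history M l q) i = chips M l (q - i.+1).
Proof.
elim: q i => [//|q ih] [|i] h; first by rewrite subn1.
by rewrite subSS -ih.
Qed.

Lemma chips_lt M l q : q < M -> chips M l q = 0.
Proof. by rewrite /chips /= => ->. Qed.

Lemma chipsE M l q : M <= q ->
  chips M l q = l q + \sum_(i < M) (chips M l (q - i.+1) + i) %/ M.
Proof.
move=> Mq; rewrite {1}/chips /= ltnNge Mq /=; congr (_ + _).
by apply: eq_bigr => i _; rewrite nth_history //; apply: leq_trans Mq.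
Qed.

Lemma sum_shift_le M (t u : nat -> nat) : 0 < M -> (forall i, u i <= t i.+1) ->
  \sum_(i < M) u i + t 0 <= \sum_(i < M) t i + u M.-1.
Proof.
case: M => // m _ ut; rewrite big_ord_recr /= [X in _ <= X + _]big_ord_recl /= /bump /=.
have : \sum_(i < m) u i <= \sum_(i < m) t (1 + i) by apply: leq_sum => i _; apply: ut.
by move=> h; rewrite addnAC [t 0 + _]addnC !leq_add2r.
Qed.

(** Shifting the release terms by one row can only raise them, so the gain is at least the new term
    [g q %/ M] minus the oldest one. The oldest is also the smallest, whence [g q] is at least [l q]
    plus M times it, and the gain is at least [l q %/ M]. This dictates the clauses of [adm]. *)
Lemma chips_increase M l q : 0 < M -> M <= q ->
  (forall r, r < q -> 0 < chips M l r -> chips M l r < chips M l r.+1) ->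
  chips M l q + l q.+1 + l q %/ M <= chips M l q.+1 + l q.
Proof.
move=> M0 Mq inc; set g := chips M l in inc *.
have inc' r s : r + s <= q -> 0 < g r -> g r + s <= g (r + s).
  elim: s => [|s ih] h gr; first by rewrite !addn0.
  have h1 := ih (ltnW _) gr; rewrite !addnS in h *.
  by have := inc (r + s) h; have := h1 h; lia.
pose Tf i := (g (q - i) + i) %/ M; pose U i := (g (q - i.+1) + i) %/ M.
have gq : g q = l q + \sum_(i < M) U i by rewrite /g chipsE.
have gq1 : g q.+1 = l q.+1 + \sum_(i < M) Tf i.
  by rewrite /g chipsE //; apply: leqW.
have UT i : U i <= Tf i.+1 by rewrite /U /Tf leq_div2r // addnS leqnSn.
have UM i : i < M -> U M.-1 <= U i.
  move=> iM; rewrite /U prednK //.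
  have [->|gp] := posnP (g (q - M)); first by rewrite add0n divn_small // prednK.
  apply: leq_div2r; have := @inc' (q - M) (M - i.+1) _ gp.
  by rewrite (_ : q - M + (M - i.+1) = q - i.+1); lia.
have U0 : M * U M.-1 <= \sum_(i < M) U i.
  rewrite -[M in M * _]card_ord -sum_nat_const; apply: leq_sum => i _; exact: UM.
have T0 : U M.-1 + l q %/ M <= Tf 0.
  rewrite /Tf subn0 addn0 gq addnC.
  have : (l q + M * U M.-1) %/ M <= (l q + \sum_(i < M) U i) %/ M by apply: leq_div2r; lia.
  by rewrite addnC [M * _]mulnC divnMDl // addnC.
by have := sum_shift_le M0 UT; lia.
Qed.

Section Window.

Variables (K : fieldType) (charK : [pchar K]%R =i pred0).
Variables (M D0 : nat) (kappa : Z) (b : seq nat) (n : nat) (t2 : nat).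
Hypothesis M0 : 0 < M.
Hypothesis sb : size b = M.
Hypothesis badm : sorted (adm M) (rcons b D0).
Hypothesis t2D : 2 * M + t2 <= D0 + 2.
Hypothesis t2le : t2 <= D0.
Hypothesis Mt2 : M <= t2.

Let l q := nth 0 (nseq M 0 ++ b ++ full D0) q.
Let g := chips M l.

Lemma l_lt q : q < M -> l q = 0.
Proof. by move=> qM; rewrite /l nth_cat size_nseq qM nth_nseq qM. Qed.

Lemma l_window i : i < M -> l (M + i) = nth 0 b i.
Proof.
move=> iM; rewrite /l nth_cat size_nseq ifF; last by lia.
by rewrite addKn nth_cat sb iM.
Qed.

Lemma l_full i : l (2 * M + i) = D0 - i.
Proof.
rewrite /l nth_cat size_nseq ifF; last by lia.
rewrite nth_cat sb ifF; last by lia.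
by rewrite nth_full; lia.
Qed.

Lemma b_adm i : i < M -> adm M (nth 0 b i) (l (M + i).+1).
Proof.
move=> iM; move/(sortedP 0): badm => /(_ i); rewrite size_rcons sb ltnS => /(_ iM).
rewrite nth_rcons sb iM -addnS; have [h|h] := ltnP i.+1 M.
  by rewrite nth_rcons sb h l_window.
rewrite nth_rcons sb ifF; last by lia.
rewrite ifT; last by lia.
by rewrite (_ : M + i.+1 = 2 * M + 0) ?l_full ?subn0 //; lia.
Qed.

(** By [adm] an empty row has only empty rows above it, so no chip has been met yet. *)
Lemma b_zero i : i < M -> nth 0 b i = 0 -> forall q, q <= M + i -> g q = 0.
Proof.
move=> iM bi q; elim/ltn_ind: q => q ih qi.
have [qM|Mq] := ltnP q M; first exact: chips_lt.
rewrite /g chipsE // big1 => [|j _].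
  have : forall r, r <= i -> nth 0 b (i - r) = 0.
    elim=> [|r ihr] ri; first by rewrite subn0.
    have h1 : i - r.+1 < M by lia.
    have := b_adm h1; rewrite -addnS l_window; last by lia.
    rewrite (_ : (i - r.+1).+1 = i - r) ?ihr ?(ltnW ri) //; last by lia.
    by rewrite /adm; lia.
  move=> /(_ (M + i - q)); rewrite (_ : i - _ = q - M); last by lia.
  have := @l_window (q - M); rewrite subnKC // addn0 => ->; last by lia.
  by apply; lia.
rewrite -/(g _) ih ?add0n ?divn_small //; last by lia.
by move: (ltn_ord j); lia.
Qed.

Lemma g_lt q : q.+1 < 2 * M + t2 -> 0 < g q -> g q < g q.+1.
Proof.
elim/ltn_ind: q => q ih qR gq.
have [qM|Mq] := ltnP q M; first by move: gq; rewrite /g chips_lt.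
have inc r : r < q -> 0 < g r -> g r < g r.+1.
  by move=> rq; apply: ih => //; apply: ltn_trans qR.
have := chips_increase M0 Mq inc; rewrite -/g.
suff : l q < l q.+1 + l q %/ M by lia.
have [q2|q2] := ltnP q (2 * M).
  have iM : q - M < M by lia.
  have := l_window iM; have := b_adm iM; rewrite subnKC // => ad lq.
  have bn : nth 0 b (q - M) <> 0.
    by move=> h; move: gq; rewrite (b_zero iM h) //; lia.
  move: ad; rewrite lq /adm; case/or4P => [|h|/andP[/eqP <- h]|/andP[/eqP h h2]].
  - by lia.
  - by rewrite (leq_trans h) // leq_addr.
  - by rewrite -[X in X < _]addn0 ltn_add2l divn_gt0.
  rewrite [X in X < _]h; have : 2 <= nth 0 b (q - M) %/ M by rewrite leq_divRL.
  by lia.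
have := l_full (q - 2 * M); have := l_full (q.+1 - 2 * M).
rewrite !subnKC ?(leqW q2) // => -> ->.
have : 2 <= (D0 - (q - 2 * M)) %/ M by rewrite leq_divRL //; lia.
by lia.
Qed.

(** The cells of row [M + t + j] together with the chips passed on to it by the rows before
    [M + t]. *)
Let content t j := l (M + t + j) + \sum_(i < M | j <= i) (g (M + t + j - i.+1) + i) %/ M.

Lemma content0 j : j < M -> content 0 j = nth 0 b j.
Proof.
move=> jM; rewrite /content addn0 l_window // big1 ?addn0 // => i ji.
rewrite /g chips_lt ?add0n ?divn_small //; lia.
Qed.

Lemma content_head t : content t 0 = g (M + t).
Proof. by rewrite /content !addn0 /g (chipsE _ (leq_addr _ _)). Qed.

Lemma contentS t j : j < M ->
  content t.+1 j = (if j.+1 < M then content t j.+1 else l (2 * M + t)) + (g (M + t) + j) %/ M.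
Proof.
move=> jM; have -> : (if j.+1 < M then content t j.+1 else l (2 * M + t)) = content t j.+1.
  case: ltnP => // h; rewrite /content big1 ?addn0 => [|i hi]; last by have := ltn_ord i; lia.
  by congr l; lia.
rewrite /content -[RHS]addnA; have -> : M + t.+1 + j = M + t + j.+1 by lia.
congr (_ + _); rewrite (bigD1 (Ordinal jM)) //= addnC; congr (_ + _).
  by apply: eq_bigl => i; rewrite -val_eqE /=; lia.
by rewrite (_ : M + t + j.+1 - j.+1 = M + t) // addnK.
Qed.

Let contents t := [seq Z.of_nat (content t j) | j <- iota 0 M].

Lemma nth_contents t i : i < M -> nth 0%Z (contents t) i = Z.of_nat (content t i).
Proof. by move=> iM; rewrite (nth_map 0) ?size_iota // nth_iota. Qed.

Let k := (Z.of_nat n - kappa)%Z.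
(** Discounting [k] tiles lowers each release by [k], and position [i] of the window has received
    [M - i] releases. [step] preserves this offset, the new input arriving lowered by [k] through
    the last release; [kappa] is the number of tiles that remain. *)
Let offset := [seq (- k * (Z.of_nat M - Z.of_nat i))%Z | i <- iota 0 M].

Fixpoint shifted t := if t is t'.+1 then step M (shifted t') (input (Z.of_nat D0) t')
  else zadd (map Z.of_nat b) offset.

Lemma shiftedE t : t <= D0.+1 -> shifted t = zadd (contents t) offset.
Proof.
have so : size offset = M by rewrite size_map size_iota.
have sc t' : size (contents t') = M by rewrite size_map size_iota.
have no i : i < M -> nth 0%Z offset i = (- k * (Z.of_nat M - Z.of_nat i))%Z.
  by move=> iM; rewrite (nth_map 0) ?size_iota // nth_iota.
elim: t => [|t ih] tD /=.
  congr zadd; apply: (@eq_from_nth _ 0%Z); rewrite ?size_map ?sc ?sb ?size_iota //.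
  by move=> i iM; rewrite nth_contents // content0 // (nth_map 0) ?sb.
rewrite ih ?(ltnW tD) //; apply: (@eq_from_nth _ 0%Z); first by rewrite size_step size_zadd.
move=> i; rewrite size_step => iM.
rewrite nth_step // ?size_zadd // !nth_zadd ?so ?sc //.
rewrite (no i iM) (no 0 M0) !(nth_contents _ M0) (nth_contents _ iM) content_head contentS //.
have -> : ((Z.of_nat (g (M + t)) + - k * (Z.of_nat M - Z.of_nat 0) + Z.of_nat i) / Z.of_nat M
    = Z.of_nat ((g (M + t) + i) %/ M) - k)%Z.
  rewrite (_ : (_ + _ + _ = Z.of_nat (g (M + t) + i) + (- k) * Z.of_nat M)%Z); last by lia.
  rewrite Z.div_add ?of_nat_divn; lia.
case: ltnP => h; first by rewrite no // nth_contents //; lia.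
have -> : (Z.of_nat M - Z.of_nat i = 1)%Z by lia.
by rewrite l_full /input Nat2Z.inj_add; lia.
Qed.

Lemma head_shifted t : t <= D0.+1 ->
  head 0%Z (shifted t) = (Z.of_nat (g (M + t)) - k * Z.of_nat M)%Z.
Proof.
move=> tD; rewrite shiftedE // -nth0 nth_zadd ?size_map ?size_iota //.
by rewrite nth_contents // content_head (nth_map 0) ?size_iota // nth_iota //; lia.
Qed.

Lemma nth_heads t m j : j < m -> t + j <= D0.+1 ->
  nth 0%Z (heads M (Z.of_nat D0) t m (shifted t)) j =
  (Z.of_nat (g (M + (t + j))) - k * Z.of_nat M)%Z.
Proof.
elim: m t j => [//|m ih] t [|j] /= jm tD.
  by rewrite addn0 in tD *; apply: head_shifted.
by rewrite -[step _ _ _]/(shifted t.+1) ih ?addSnnS.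
Qed.

Let p := M + t2.
Let R := 2 * M + t2.
(** The double negation makes this a ceiling: enough tiles to account for every chip up to row
    [p]. *)
Let N' := (- (- head 0 (shifted t2) / Z.of_nat M))%Z.
Let N := Z.to_nat (k + N').

Lemma N_bounds : (0 <= k + N')%Z /\ g p <= N * M.
Proof.
have h := head_shifted (leqW t2le); rewrite -/p in h.
have M0' : (0 < Z.of_nat M)%Z by lia.
have h1 : (head 0 (shifted t2) <= N' * Z.of_nat M)%Z.
  by rewrite /N'; have := Z.mul_div_le (- head 0 (shifted t2))%Z _ M0'; lia.
have h2 : (Z.of_nat (g p) <= (k + N') * Z.of_nat M)%Z by lia.
have h3 : (0 <= k + N')%Z by nia.
by split=> //; rewrite /N; nia.
Qed.

Lemma g_mono q r : q + r < R -> 0 < g q -> g q + r <= g (q + r).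
Proof.
elim: r => [|r ih] qr gq; first by rewrite !addn0.
by rewrite !addnS in qr *; have := g_lt qr; have := ih (ltnW qr) gq; lia.
Qed.

Lemma left_top q : q < p -> left M g N q = 0.
Proof.
move=> qp; have [_ hN] := N_bounds; rewrite /left.
suff : g q <= N * M by lia.
apply: leq_trans hN; have [->//|gq] := posnP (g q).
by have := @g_mono q (p - q) _ gq; rewrite subnKC ?(ltnW qp) // /R /p; lia.
Qed.

Lemma rest_rowE j : j < M ->
  rest_row M N' (heads M (Z.of_nat D0) t2 M (shifted t2)) j = left M g N (p + j).
Proof.
move=> jM; have [k0 hN] := N_bounds; have NE : Z.of_nat N = (k + N')%Z by rewrite /N; lia.
have late (i : nat) : j <= i -> i < M -> (g (p + j - i.+1) + i) %/ M <= N.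
  move=> ji iM; have [->|gq] := posnP (g (p + j - i.+1)); first by rewrite add0n divn_small.
  rewrite -ltnS ltn_divLR // mulSn.
  by have := @g_mono (p + j - i.+1) (i.+1 - j) _ gq;
     rewrite (_ : p + j - i.+1 + (i.+1 - j) = p); rewrite /R /p in hN *; lia.
have -> : left M g N (p + j) =
    (g (p + j) - N * M) - sumn [seq (g (p + j - i.+1) + i) %/ M - N | i <- iota 0 j].
  rewrite /left; congr (_ - _).
  rewrite -(big_mkord xpredT (fun i => (g (p + j - i.+1) + i) %/ M - N)).
  rewrite (@big_cat_nat _ _ _ j) //= ?(ltnW jM) //.
  rewrite [X in _ + X]big_nat [X in _ + X]big1 ?addn0 => [|i /andP[ji iM]]; last by have := late i ji iM; lia.
  by rewrite sumnE big_map /index_iota subn0.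
have tM : t2 + M <= D0.+2 by lia.
rewrite /rest_row nth_heads //; last by lia.
have -> : zsum [seq Z.max 0 ((nth 0 (heads M (Z.of_nat D0) t2 M (shifted t2)) (j - i.+1)%N + Z.of_nat i)
       / Z.of_nat M - N') | i <- iota 0 j]%Z =
    Z.of_nat (sumn [seq (g (p + j - i.+1) + i) %/ M - N | i <- iota 0 j]).
  have : {in iota 0 j, forall i, i < j} by move=> i; rewrite mem_iota.
  elim: (iota 0 j) => //= i s ihs hs; rewrite ihs => [|i' hi']; last by apply: hs; rewrite inE hi' orbT.
  have ij : i < j by apply: hs; apply: mem_head.
  rewrite nth_heads; [|lia|lia].
  have -> : M + (t2 + (j - i.+1)) = p + j - i.+1 by rewrite /p; lia.
  rewrite (_ : (_ - _ + _ = Z.of_nat (g (p + j - i.+1) + i) + (- k) * Z.of_nat M)%Z); last by lia.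
  by rewrite Z.div_add -?of_nat_divn; lia.
by rewrite addnA -/p; nia.
Qed.

(** The first [N] tiles follow the chips and empty all rows above [p]; the explicit directions
    finish the remaining shape. The equation in [certify] makes the total equal to [n]. *)
Lemma NS_certified ds :
  certify M D0 kappa t2 (shifted t2) ds -> NS K (cells (b ++ full D0)) (nseq n M).
Proof.
have [k0 hN] := N_bounds.
case/andP=> /Z.eqb_eq; rewrite -/N' => szds /(bitesP charK) h.
have nE : n = N + size ds by rewrite /N /k in szds *; lia.
rewrite nE nseqD -[cells _]/(cells (nseq 0 0 ++ b ++ full D0)).
have -> : cells (nseq 0 0 ++ b ++ full D0) = cells (nseq M 0 ++ b ++ full D0).
  by elim: (M).
have -> : nseq M 0 ++ b ++ full D0 = mkseq l R ++ full (D0 - t2).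
  rewrite -[LHS](cat_take_drop R); congr (_ ++ _).
    apply: (@eq_from_nth _ 0) => [|i]; rewrite size_takel ?size_mkseq //.
    - by rewrite !size_cat size_nseq sb size_full /R; lia.
    - by move=> iR; rewrite nth_take // nth_mkseq.
    - by rewrite !size_cat size_nseq sb size_full /R; lia.
  rewrite drop_cat size_nseq ifF; last by rewrite /R; lia.
  rewrite drop_cat sb ifF; last by rewrite /R; lia.
  by rewrite drop_full; congr full; rewrite /R; lia.
apply: (@NS_chips M l g R M0) => //.
- exact: chips_lt.
- exact: l_lt.
- by move=> q Mq _; apply: chipsE.
- exact: g_lt.
have -> : mkseq (left M g N) R = nseq p 0 ++
    [seq rest_row M N' (heads M (Z.of_nat D0) t2 M (shifted t2)) j | j <- iota 0 M].
  have -> : R = p + M by rewrite /R /p; lia.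
  rewrite /mkseq iotaD map_cat add0n; congr (_ ++ _).
    apply: (@eq_from_nth _ 0); rewrite size_map size_iota ?size_nseq // => i ip.
    by rewrite (nth_map 0) ?size_iota // nth_iota // nth_nseq ip left_top.
  rewrite -[p]addn0 iotaDl -map_comp; apply/eq_in_map => j; rewrite mem_iota => /andP[_ jM].
  by rewrite /= rest_rowE.
by rewrite -catA; apply: NS_zeros.
Qed.

Hypothesis areaE : sumn (b ++ full D0) = n * sumn (iota 1 M).

(** Under [adm] lengths fall by at most one per row, so [b_i + i] is nondecreasing; the last row has
    at most [D0 + 1] cells, which gives the bound [D0 + M]. The area hypothesis supplies the
    equation for [k]. *)
Lemma range_shifted t a : size a = M ->
  ((range M (Z.of_nat D0) kappa t a).1 <= dotz a (shifted t) <= (range M (Z.of_nat D0) kappa t a).2)%Z.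
Proof.
have sz1 : size (zadd [seq Z.of_nat i | i <- iota 0 M] (map Z.of_nat b)) = M.
  by rewrite size_zadd size_map.
have n1 i : i < M -> nth 0%Z (zadd [seq Z.of_nat i | i <- iota 0 M] (map Z.of_nat b)) i
    = (Z.of_nat i + Z.of_nat (nth 0%N b i))%Z.
  move=> iM; rewrite nth_zadd ?size_map ?size_iota ?sb //.
  by rewrite !(nth_map 0) ?size_iota ?sb // nth_iota.
have step1 i : i.+1 < M -> nth 0 b i <= (nth 0 b i.+1).+1.
  move=> iM; have := b_adm (ltnW iM); rewrite -addnS l_window // /adm; lia.
have top i : i < M -> nth 0 b i + i <= D0 + M.
  move=> iM; rewrite -(subKn (ltnW iM)); have : M - i <= M by lia.
  have : 0 < M - i by lia.
  elim: (M - i) => // -[|r] ih _ rM.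
    have := @b_adm M.-1; rewrite prednK // => /(_ (leqnn _)).
    have -> : (M + M.-1).+1 = 2 * M + 0 by lia.
    by rewrite l_full subn0 subn1 /adm; lia.
  have := step1 (M - r.+2); have := ih isT (ltnW rM).
  by rewrite (_ : (M - r.+2).+1 = M - r.+1); lia.
move=> sa; apply: (@range_sound M (Z.of_nat D0) kappa shifted M0 _ (map Z.of_nat b) k) => //.
- lia.
- by rewrite size_map.
- have srt : sorted Z.leb (zadd [seq Z.of_nat i | i <- iota 0 M] (map Z.of_nat b)).
    apply/(sortedP 0%Z) => i; rewrite sz1 => iM; rewrite !n1 // ?(ltnW iM) //.
    by have := step1 i iM; lia.
  have := n1 0 M0; case: (zadd _ _) srt => //= x s -> ->; lia.
- apply/(all_nthP 0%Z) => i; rewrite sz1 => iM; rewrite n1 //.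
  by have := top i iM; lia.
have zs : forall s, zsum (map Z.of_nat s) = Z.of_nat (sumn s).
  by elim=> //= x s ->; lia.
rewrite zs; move: areaE (sumn_iota1 M) (sumn_full D0); rewrite sumn_cat => h1 h2 h3.
have -> : (Z.of_nat M * (Z.of_nat M + 1) / 2 = Z.of_nat (sumn (iota 1 M)))%Z.
  by symmetry; apply: Z.div_unique_exact => //; lia.
have -> : (Z.of_nat D0 * (Z.of_nat D0 + 1) / 2 = Z.of_nat (sumn (full D0)))%Z.
  by symmetry; apply: Z.div_unique_exact => //; lia.
by rewrite /k; nia.
Qed.

End Window.

Lemma NS_window (K : fieldType) (charK : [pchar K]%R =i pred0) M D0 kappa T u certs b n :
  window_check M D0 kappa T u certs ->
  size b = M -> sorted (adm M) (rcons b D0) ->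
  sumn (b ++ full D0) = n * sumn (iota 1 M) ->
  NS K (cells (b ++ full D0)) (nseq n M).
Proof.
case/and4P=> M0 h1 h2 hall sb badm area.
have Mt : M <= T + M + u by lia.
pose F := shifted M D0 kappa b n.
have sF t : size (F t) = M.
  by case: t => [|t]; rewrite /F /= ?size_step // size_zadd size_map size_iota.
have memF : F (T + M + u) \in down M (Z.of_nat D0) kappa T u.
  apply: down_mem => // t a sa; exact: (range_shifted kappa M0 sb badm h1 h2 Mt area t sa).
have := hall; rewrite all2E => /andP[/eqP sz /(all_nthP ([::], [::]))].
set S := down _ _ _ _ _ in memF sz *.
move=> /(_ (index (F (T + M + u)) S)); rewrite size_zip -sz minnn index_mem => /(_ memF).
rewrite nth_zip // nth_index //=.
exact: (NS_certified charK M0 sb badm h1 h2 Mt).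
Qed.

(* Number of untouched full rows at which the finite verification starts. *)
Definition window_size (M : nat) : nat :=
  nth 0 [:: 0; 0; 7; 12; 19; 26; 34; 42; 52; 62; 72; 84; 95; 108] M.

Definition directions : seq direction :=
  [::
   ((-3, -1), (1, 0)); ((3, 1), (1, 0)); ((-3, 1), (-1, 0));
   ((3, -1), (-1, 0)); ((1, -3), (0, 1)); ((-1, 3), (0, 1));
   ((-1, -3), (0, -1)); ((1, 3), (0, -1)); ((-2, -3), (1, 1));
   ((2, 3), (1, 1)); ((-3, -2), (-1, -1)); ((3, 2), (-1, -1));
   ((-3, 2), (1, -1)); ((3, -2), (1, -1)); ((-2, 3), (-1, 1));
   ((2, -3), (-1, 1)); ((-3, -1), (-2, -1)); ((3, 1), (-2, -1));
   ((-1, -3), (1, 2)); ((1, 3), (1, 2)); ((-3, 1), (2, -1));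
   ((3, -1), (2, -1)); ((-3, 2), (-2, 1)); ((3, -2), (-2, 1));
   ((-2, 3), (1, -2)); ((2, -3), (1, -2)); ((-1, 3), (-1, 2))]%Z.

Definition route (w : seq nat) : seq direction :=
  [seq nth ((0, 0), (0, 0))%Z directions i | i <- w].

(* Row lengths [window_size M], the normalising shift, the number of rows after
   which the states are enumerated and the number of further rows before the
   finite certificates apply were found by experiment. *)
Definition routes2 : seq (seq nat) :=
  [::
   [:: 13]].

Definition routes3 : seq (seq nat) :=
  [::
   [:: 7; 9; 0; 3; 7]; [:: 9; 12; 10; 5; 7]].

Definition routes4 : seq (seq nat) :=
  [::
   [:: 4; 0; 3; 12; 7]; [:: 3; 11; 11; 6; 19]; [:: 12; 3; 19; 0; 7]].

Definition routes5 : seq (seq nat) :=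
  [::
   [:: 1; 6; 0; 5; 15; 12]; [:: 1; 14; 15; 15; 13; 23];
   [:: 0; 8; 5; 6; 15; 1]; [:: 5; 9; 4; 7; 7; 7]; [:: 6; 11; 11; 9; 5]].

Definition routes6 : seq (seq nat) :=
  [::
   [:: 3; 6; 13; 2; 0; 13]; [:: 1; 0; 2; 21; 20; 2]; [:: 3; 3; 1; 10; 11; 6];
   [:: 7; 1; 3; 11; 4; 4]; [:: 0; 12; 10; 11; 8; 5]; [:: 5; 6; 7; 12; 5; 13]].

Definition routes7 : seq (seq nat) :=
  [::
   [:: 0; 2; 6; 10; 14; 14; 1]; [:: 4; 1; 4; 6; 7; 2; 5];
   [:: 3; 24; 6; 13; 2; 1; 7]; [:: 5; 4; 9; 1; 8; 4; 4];
   [:: 6; 12; 3; 4; 10; 5]; [:: 0; 13; 12; 6; 10; 7];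
   [:: 12; 7; 4; 6; 10; 6]; [:: 6; 4; 3; 19; 5; 0]; [:: 0; 9; 6; 3; 6; 7];
   [:: 12; 6; 0; 10; 4; 8]].

Definition routes8 : seq (seq nat) :=
  [::
   [:: 6; 2; 7; 15; 12; 4; 15]; [:: 3; 9; 4; 7; 6; 10; 5];
   [:: 4; 2; 7; 2; 12; 15; 5]; [:: 2; 15; 8; 3; 6; 7; 7];
   [:: 4; 3; 3; 10; 11; 4; 9]; [:: 4; 6; 3; 1; 9; 11; 7]].

Definition routes9 : seq (seq nat) :=
  [::
   [:: 6; 1; 3; 16; 16; 6; 7; 3]; [:: 4; 7; 7; 12; 2; 14; 26; 15];
   [:: 1; 7; 10; 16; 4; 3; 9; 3]; [:: 12; 10; 7; 24; 5; 15; 15; 6];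
   [:: 2; 12; 13; 3; 5; 7; 13; 5]; [:: 7; 25; 5; 7; 15; 3; 3; 4];
   [:: 12; 10; 3; 16; 1; 2; 4; 6]; [:: 12; 7; 24; 6; 5; 2; 3; 5];
   [:: 6; 12; 13; 2; 7; 15; 13; 15]; [:: 13; 5; 5; 13; 21; 2; 20; 14]].

Definition routes10 : seq (seq nat) :=
  [::
   [:: 3; 5; 10; 2; 5; 1; 14; 4; 0]; [:: 1; 1; 12; 9; 2; 15; 3; 4; 2];
   [:: 5; 0; 5; 26; 2; 3; 13; 0; 14]; [:: 12; 0; 20; 2; 0; 20; 15; 20; 23];
   [:: 7; 24; 1; 0; 6; 5; 13; 15; 0]; [:: 5; 14; 15; 22; 12; 23; 13; 22; 21];
   [:: 6; 13; 3; 0; 4; 4; 3; 0; 8]; [:: 3; 25; 5; 24; 24; 5; 25; 12; 25];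
   [:: 5; 0; 6; 4; 3; 4; 3; 4; 1]; [:: 5; 4; 5; 3; 11; 13; 15; 14; 3];
   [:: 13; 5; 13; 12; 1; 2; 12; 12; 0]; [:: 4; 13; 7; 10; 11; 4; 10; 11; 6];
   [:: 8; 7; 3; 16; 3; 8; 8; 9; 3]].

Definition routes11 : seq (seq nat) :=
  [::
   [:: 1; 3; 8; 10; 4; 6; 9; 7]; [:: 1; 7; 3; 8; 3; 9; 7; 4];
   [:: 3; 24; 13; 3; 1; 10; 1; 11]; [:: 12; 1; 3; 3; 8; 9; 6; 4];
   [:: 0; 21; 5; 2; 12; 21; 12; 1]; [:: 6; 7; 6; 10; 4; 12; 2; 6]].

Definition routes12 : seq (seq nat) :=
  [::
   [:: 7; 6; 13; 5; 20; 14; 0; 14; 2]; [:: 12; 10; 6; 4; 0; 5; 14; 0; 5];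
   [:: 4; 12; 11; 2; 12; 2; 14; 24; 4]; [:: 3; 0; 5; 14; 21; 12; 3; 6; 15];
   [:: 12; 1; 12; 4; 19; 18; 4; 5; 14]; [:: 2; 15; 13; 0; 12; 1; 5; 0; 13];
   [:: 0; 20; 5; 15; 22; 1; 2; 0; 20]; [:: 4; 1; 3; 4; 9; 4; 2; 15; 1];
   [:: 3; 0; 13; 1; 3; 3; 2; 6; 1]; [:: 4; 0; 7; 2; 6; 2; 14; 6; 3];
   [:: 7; 3; 17; 5; 11; 2; 14; 5; 4]; [:: 12; 0; 0; 4; 6; 4; 3; 4; 3];
   [:: 4; 2; 12; 11; 0; 6; 14; 0; 13]; [:: 7; 10; 16; 3; 4; 1; 9; 4; 0];
   [:: 12; 4; 10; 0; 6; 2; 14; 0; 13]; [:: 0; 5; 15; 6; 3; 5; 0; 5; 2]].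

Definition routes13 : seq (seq nat) :=
  [::
   [:: 1; 3; 8; 5; 15; 22; 4; 7; 4]; [:: 1; 4; 18; 6; 18; 4; 5; 6; 0];
   [:: 3; 1; 1; 11; 10; 4; 3; 9; 1]; [:: 4; 6; 1; 9; 9; 4; 7; 2; 15];
   [:: 7; 1; 25; 8; 1; 12; 12; 9; 4]; [:: 4; 7; 1; 4; 9; 4; 3; 10; 1];
   [:: 7; 2; 25; 2; 13; 1; 7; 7; 1]; [:: 6; 0; 6; 6; 4; 7; 2; 15; 3];
   [:: 1; 7; 3; 1; 4; 10; 3; 9; 0]; [:: 7; 10; 13; 6; 4; 2; 7; 0; 14];
   [:: 5; 1; 3; 25; 8; 2; 15; 1; 15]; [:: 3; 1; 1; 11; 4; 16; 3; 9; 3];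
   [:: 3; 11; 11; 13; 11; 5; 11; 11; 4]; [:: 3; 1; 9; 7; 9; 9; 4; 12; 7];
   [:: 5; 1; 1; 7; 9; 10; 4; 0; 5]; [:: 2; 5; 7; 1; 0; 14; 6; 14; 2];
   [:: 2; 12; 24; 2; 12; 5; 5; 5; 13]; [:: 1; 7; 8; 3; 17; 4; 3; 9; 3];
   [:: 0; 9; 9; 7; 6; 17; 4; 4; 1]; [:: 0; 8; 12; 3; 9; 17; 4; 4; 3];
   [:: 4; 13; 0; 2; 20; 14; 13; 3; 6]; [:: 7; 1; 8; 6; 4; 3; 16; 9; 3];
   [:: 4; 0; 7; 5; 0; 13; 12; 7; 12]; [:: 0; 1; 9; 4; 12; 11; 10; 4; 3];
   [:: 3; 1; 11; 1; 4; 16; 16; 9; 0]; [:: 0; 12; 9; 6; 16; 9; 4; 4; 1];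
   [:: 4; 5; 14; 0; 3; 0; 13; 3; 5]; [:: 3; 5; 4; 14; 1; 4; 0; 12; 6];
   [:: 1; 2; 2; 0; 21; 3; 20; 23; 3]].

Lemma window_check2 : window_check 2 7 4 3 0 (map route routes2).
Proof. vm_compute. reflexivity. Qed.

Lemma window_check3 : window_check 3 12 10 3 0 (map route routes3).
Proof. vm_compute. reflexivity. Qed.

Lemma window_check4 : window_check 4 19 10 7 0 (map route routes4).
Proof. vm_compute. reflexivity. Qed.

Lemma window_check5 : window_check 5 26 11 11 0 (map route routes5).
Proof. vm_compute. reflexivity. Qed.

Lemma window_check6 : window_check 6 34 19 10 6 (map route routes6).
Proof. vm_compute. reflexivity. Qed.

Lemma window_check7 : window_check 7 42 19 14 6 (map route routes7).
Proof. vm_compute. reflexivity. Qed.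

Lemma window_check8 : window_check 8 52 19 20 6 (map route routes8).
Proof. vm_compute. reflexivity. Qed.

Lemma window_check9 : window_check 9 62 20 26 6 (map route routes9).
Proof. vm_compute. reflexivity. Qed.

Lemma window_check10 : window_check 10 72 31 20 17 (map route routes10).
Proof. vm_compute. reflexivity. Qed.

Lemma window_check11 : window_check 11 84 37 21 25 (map route routes11).
Proof. vm_compute. reflexivity. Qed.

Lemma window_check12 : window_check 12 95 35 29 24 (map route routes12).
Proof. vm_compute. reflexivity. Qed.

Lemma window_check13 : window_check 13 108 30 43 19 (map route routes13).
Proof. vm_compute. reflexivity. Qed.

Lemma windows M : 2 <= M <= 13 -> exists kappa T u certs,
  window_check M (window_size M) kappa T u certs.
Proof.
case: M => [|[|[|[|[|[|[|[|[|[|[|[|[|[|M]]]]]]]]]]]]]] // _.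
- by do 4 eexists; exact: window_check2.
- by do 4 eexists; exact: window_check3.
- by do 4 eexists; exact: window_check4.
- by do 4 eexists; exact: window_check5.
- by do 4 eexists; exact: window_check6.
- by do 4 eexists; exact: window_check7.
- by do 4 eexists; exact: window_check8.
- by do 4 eexists; exact: window_check9.
- by do 4 eexists; exact: window_check10.
- by do 4 eexists; exact: window_check11.
- by do 4 eexists; exact: window_check12.
- by do 4 eexists; exact: window_check13.
Qed.

(** * Tiling with all multiplicities *)

Section Total.

Variable K : fieldType.
Hypothesis charK : [pchar K]%R =i pred0.

Lemma NS_simple s n : sumn s = n -> NS K (cells s) (nseq n 1).
Proof.
elim: n s => [|n ih] s; elim: s => [|[|b] s ihs] sE //.
- exact: NS_nil.
- exact: ihs.
- exact: ihs.
apply: (@NS_bite K charK 1 [::] [:: b.+1] s (nseq n 1)) => //=.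
by apply: (ih (b.+1 - 1 :: s)); rewrite /= in sE *; lia.
Qed.

Lemma NS_homogeneous M irr d n :
  0 < M <= 13 -> window_size M <= d -> stair M irr d ->
  sumn (irr ++ full d) = n * sumn (iota 1 M) ->
  NS K (cells (irr ++ full d)) (nseq n M).
Proof.
case/andP=> M0 M13 hd st area.
have [M1|M2] := leqP M 1.
  have M1' : M = 1 by lia.
  by subst M; apply: NS_simple; rewrite area /= muln1.
have [|kappa [T [u [certs hc]]]] := windows (M := M); first by rewrite M2.
have [|b [n' [sb badm area' hns]]] := NS_greedy_down charK M0 (D0 := window_size M) _ st area.
  by rewrite hd andbT; move: hc => /and4P[_ h _ _]; lia.
by apply: hns; apply: NS_window hc sb badm area'.
Qed.

(** The origin of 6(m + 1). The right side grows faster in [mu] than the left, so [mu = M] is the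
    worst case; for M >= 2 each table entry is the largest for which the inequality holds there. *)
Lemma window_size_bound M mu : 0 < M <= 13 -> M <= mu ->
  sumn (full (window_size M).-1) + mu * window_size M < (6 * mu + 1) * sumn (iota 1 M).
Proof.
case/andP; case: M => [|[|[|[|[|[|[|[|[|[|[|[|[|[|M]]]]]]]]]]]]]] //= _ _ Mmu;
  rewrite /window_size /=; lia.
Qed.

Lemma NS_mixed mu M (Ms : seq nat) n r d :
  0 < M <= 13 -> M <= mu -> all (fun x => 0 < x <= mu) Ms ->
  6 * mu < n -> 4 * mu ^ 2 < n * sumn (iota 1 M) + 2 * mu ->
  r <= d ->
  r + sumn (full d) = sumn [seq sumn (iota 1 x) | x <- Ms] + n * sumn (iota 1 M) ->
  NS K (cells (r :: full d)) (Ms ++ nseq n M).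
Proof.
move=> hM Mmu hMs hn harea rd sumE.
have : exists irr, [/\ stair mu irr d, size irr <= mu,
    sumn (irr ++ full d) = r + sumn (full d) & cells (irr ++ full d) = cells (r :: full d)].
  case: r rd {sumE} => [|r] rd; first by exists [::].
  exists [:: r.+1]; split=> //=; last by lia.
  by rewrite /stair /=; lia.
case=> irr [st sz sE cE]; rewrite -cE.
have [|irr' [d' [st' sz' sum' hns]]] :=
  NS_greedy_all charK (nseq n M) harea hMs st sz; first by rewrite sE sumE.
apply: hns; apply: NS_homogeneous => //; last exact: stair_weaken st'.
(* With fewer than [window_size M] full rows, the at most [mu] irregular ones would have at most
   [window_size M] cells each, and the total would fall short of the area of [n] tiles. *)
rewrite leqNgt; apply/negP => lt.
have := window_size_bound hM Mmu; have := stair_sumn st'.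
rewrite sumn_cat in sum' => h1 h2.
have h3 : sumn (full d') <= sumn (full (window_size M).-1).
  by have := sumn_full d'; have := sumn_full (window_size M).-1; nia.
have h4 : size irr' * d'.+1 <= mu * window_size M by apply: leq_mul.
have h5 : (6 * mu + 1) * sumn (iota 1 M) <= n * sumn (iota 1 M).
  by rewrite leq_mul2r addn1 hn orbT.
lia.
Qed.

End Total.

Local Open Scope ring_scope.

(** * From exponents to curves *)

Section Basis.

Variable K : fieldType.

Definition expo (a : cell) : nat * nat := (Z.to_nat a.1, Z.to_nat (a.2 - a.1)).
(** The sheared coordinates make row e of the staircase the monomials of degree e, of which there
    are e + 1, just as in [full]. *)
Definition corner (x y : nat) : cell := (Z.of_nat x, Z.of_nat (x + y)).

Lemma expo_corner x y : expo (corner x y) = (x, y).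
Proof. by rewrite /expo /corner /=; congr pair; lia. Qed.

(* The coefficients produced by iterated partial derivatives of monomials. *)
Definition ffbasis (i j : nat) (a : cell) : K :=
  ((expo a).1 ^_ i * (expo a).2 ^_ j)%:R.

Lemma ffact_mul n i : (n * n ^_ i = n ^_ i.+1 + i * n ^_ i)%N.
Proof.
rewrite ffactnSr; have [le|lt] := leqP i n; first by rewrite [(i * _)%N]mulnC -mulnDr subnK // mulnC.
by rewrite (ffact_small lt) !muln0.
Qed.

(** Falling factorials span, because x times the i-th one is the next one plus i times itself. An
    arbitrary predicate [V] allows the induction to absorb a coordinate factor into [V]. *)
Lemma polf_ind_basis n (l : cell -> K) (V : (cell -> K) -> Prop) :
  polf n l ->
  V (fun=> 0) -> (forall f g, V f -> V g -> V (fun a => f a + g a)) ->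
  (forall c f, V f -> V (fun a => c * f a)) ->
  (forall f g, (forall x y, f (corner x y) = g (corner x y)) -> V f -> V g) ->
  (forall i j, (i + j < n)%N -> V (ffbasis i j)) -> V l.
Proof.
move=> hl; elim: hl V => {n l}
  [n|n c|n f g _ ihf _ ihg|n f _ ih|n f _ ih|n f g _ ih e] V V0 VD VZ VE VB.
- exact: V0.
- apply: VE (VZ c _ (VB 0 0 _)%N) => // x y.
  by rewrite /ffbasis !ffactn0 muln1 mulr1.
- exact: VD (ihf V V0 VD VZ VE VB) (ihg V V0 VD VZ VE VB).
- apply: (ih (fun h => V (fun a => zK K a.1 * h a))).
  + by apply: VE V0 => x y; rewrite mulr0.
  + by move=> f1 f2 h1 h2; apply: VE (VD _ _ h1 h2) => x y; rewrite mulrDr.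
  + by move=> c f1 h1; apply: VE (VZ c _ h1) => x y; rewrite mulrCA.
  + by move=> f1 f2 e h1; apply: VE h1 => x y; rewrite e.
  move=> i j ij; have h1 := VB i.+1 j ij; have h2 := VZ i%:R _ (VB i j (leqW ij)).
  apply: VE (VD _ _ h1 h2) => x y; rewrite /ffbasis expo_corner /= zK_nat.
  rewrite -!natrM -natrD; congr (_%:R).
  by rewrite [RHS]mulnA ffact_mul mulnDl mulnA.
- apply: (ih (fun h => V (fun a => zK K a.2 * h a))).
  + by apply: VE V0 => x y; rewrite mulr0.
  + by move=> f1 f2 h1 h2; apply: VE (VD _ _ h1 h2) => x y; rewrite mulrDr.
  + by move=> c f1 h1; apply: VE (VZ c _ h1) => x y; rewrite mulrCA.
  + by move=> f1 f2 e h1; apply: VE h1 => x y; rewrite e.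
  move=> i j ij; have h1 := VB i.+1 j ij; have h2 := VZ i%:R _ (VB i j (leqW ij)).
  have h3 : V (ffbasis i j.+1) by apply: VB; rewrite addnS.
  have h4 := VZ j%:R _ (VB i j (leqW ij)).
  apply: VE (VD _ _ (VD _ _ h1 h2) (VD _ _ h3 h4)) => x y.
  rewrite /ffbasis expo_corner /= zK_nat -!natrM -!natrD; congr (_%:R).
  rewrite mulnDl [(x * _)%N]mulnA ffact_mul [(y * _)%N]mulnCA ffact_mul.
  by rewrite mulnDl mulnDr mulnA [(j * _)%N]mulnCA.
- apply: VE (ih V V0 VD VZ VE VB) => x y; exact: e.
Qed.

End Basis.

Lemma mmap_horner (K : fieldType) n (h : 'I_n -> {poly K}) (f : {mpoly K[n]}) t :
  (mmap polyC h f).[t] = f.@[fun i => (h i).[t]].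
Proof.
rewrite /meval /mmap horner_sum; apply: eq_bigr => m _.
rewrite hornerM hornerC; congr (_ * _).
by rewrite /mmap1 horner_prod; apply: eq_bigr => i _; rewrite horner_exp.
Qed.

Section Density.

Variables (K : fieldType) (I : finType).
Hypothesis charK : [pchar K] =i pred0.

(** On the line joining [x0] to a point of [V], both open conditions become nonzero univariate
    polynomials; their product has a nonroot in characteristic zero. *)
Lemma zariski_open_dense (U : {ffun I -> K} -> Prop) x0 :
  zariski_open U -> U x0 -> zariski_dense U.
Proof.
case=> F hF /hF[f0 Ff0 f0x] V [F' hF'] [x1 /hF'[f1 Ff1 f1x]].
pose h (i : 'I_#|I|) : {poly K} :=
  (x0 (enum_val i))%:P + (x1 (enum_val i) - x0 (enum_val i)) *: 'X.
pose g0 := mmap polyC h f0; pose g1 := mmap polyC h f1.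
have g00 : g0 != 0.
  apply: contraNneq f0x => e; rewrite /coord_eval.
  have : g0.[0] = 0 by rewrite e horner0.
  rewrite mmap_horner => h0; apply/eqP; rewrite -[RHS]h0; apply: meval_eq => i.
  by rewrite /h hornerD hornerC hornerZ hornerX mulr0 addr0.
have g10 : g1 != 0.
  apply: contraNneq f1x => e; rewrite /coord_eval.
  have : g1.[1] = 0 by rewrite e horner0.
  rewrite mmap_horner => h0; apply/eqP; rewrite -[RHS]h0; apply: meval_eq => i.
  by rewrite /h hornerD hornerC hornerZ hornerX mulr1 subrKC.
have [t _] := poly_nonroot charK (mulf_neq0 g00 g10).
rewrite hornerM mulf_eq0 negb_or => /andP[t0 t1].
pose x := [ffun i : I => (h (enum_rank i)).[t]].
have ev f : coord_eval f x = (mmap polyC h f).[t].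
  rewrite mmap_horner /coord_eval; apply: meval_eq => i.
  by rewrite ffunE enum_valK.
by exists x; [apply/hF'; exists f1|apply/hF; exists f0]; rewrite ?ev.
Qed.

End Density.

Lemma card_sigma (I : finType) (T : I -> finType) :
  #|{: {i : I & T i}}| = (\sum_i #|T i|)%N.
Proof. by rewrite card_tagged sumnE big_map big_enum. Qed.

Lemma sum_sigma (I : finType) (T : I -> finType) (F : I -> nat) :
  (\sum_(q : {i : I & T i}) F (tag q) = \sum_i #|T i| * F i)%N.
Proof.
rewrite -(@sig_big_dep _ _ _ I T xpredT (fun=> xpredT) (fun i _ => F i)) /=.
by apply: eq_bigr => i _; rewrite sum_nat_const.
Qed.

Lemma sumn_triangle n : (\sum_(e < n) e.+1)%N = sumn (full n).
Proof. by elim: n => [|n ih]; rewrite ?big_ord0 // big_ord_recr /= ih addnC. Qed.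

Lemma sumn_triangle_rev n : (\sum_(i < n) (n.-1 - i).+1)%N = sumn (full n).
Proof.
elim: n => [|n ih]; rewrite ?big_ord0 // big_ord_recl /= subn0 -ih; congr (_ + _)%N.
apply: eq_bigr => i _; rewrite /bump /=; congr (_.+1).
by have := ltn_ord i; lia.
Qed.

Section Rank.

Variables (K : fieldType) (m d : nat) (p : 'I_m.+1 -> nat).

(* A label [q, i, j] with i + j <= order of q stands for the derivative of
   order (i, j) at the point q; a label [e, x] with x <= e for the monomial
   X^x Y^(e - x). *)
Definition mult (q : point_label p) : nat := (tag q).+1.

Definition cond_label : finType :=
  {q : point_label p & {i : 'I_(tag q).+1 & 'I_(tag q - i).+1}}.
Definition mon_label : finType := {e : 'I_d.+1 & 'I_e.+1}.

Definition cond_exp (j : cond_label) : nat * nat :=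
  (tag (tagged j) : nat, tagged (tagged j) : nat).
Definition mon_exp (a : mon_label) : nat * nat :=
  (tagged a : nat, (tag a - tagged a)%N).
Definition mon_cell (a : mon_label) : cell := corner (mon_exp a).1 (mon_exp a).2.

Definition entry (R : comNzRingType) (X Y : R) (i : nat * nat) (a : nat * nat) : R :=
  (a.1 ^_ i.1 * a.2 ^_ i.2)%:R * (X ^+ (a.1 - i.1) * Y ^+ (a.2 - i.2)).

(** The ring is arbitrary so that the same matrix can be taken at the generic point, with polynomial
    entries. *)
Definition condmx (R : comNzRingType) (x : point_label p -> 'I_2 -> R) :
    'M[R]_(#|cond_label|, #|mon_label|) :=
  \matrix_(r, c) entry (x (tag (enum_val r)) 0) (x (tag (enum_val r)) 1)
    (cond_exp (enum_val r)) (mon_exp (enum_val c)).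

Lemma card_mon_label : #|mon_label| = sumn (full d.+1).
Proof.
by rewrite card_sigma -sumn_triangle; apply: eq_bigr => e _; rewrite card_ord.
Qed.

Lemma card_cond_label : #|cond_label| = (\sum_(q : point_label p) sumn (full (tag q).+1))%N.
Proof.
rewrite card_sigma; apply: eq_bigr => q _.
rewrite card_sigma -sumn_triangle_rev; apply: eq_bigr => i _; rewrite card_ord.
by [].
Qed.

Section FromNS.

Variables (L : seq (point_label p)) (Q : seq (nat * (K * K))) (D : seq cell).
Hypothesis uL : uniq L.
Hypothesis QL : map fst Q = [seq mult q | q <- L].
Hypothesis Qsep : {in D, forall a, exists2 f : cell -> K,
  conditions Q f & {in D, forall b, f b = (b == a)%:R}}.

Let pt (q : point_label p) : K * K := (nth (0%N, (1, 1)) Q (index q L)).2.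

(** The product in the first coordinate undoes the shear: p1^x p2^(x + y) = (p1 p2)^x p2^y. *)
Definition torus_point : {ffun coord_label p -> K} :=
  [ffun qc : coord_label p => if qc.2 == 0 then (pt qc.1).1 * (pt qc.1).2 else (pt qc.1).2].

Let C := condmx (point torus_point).
Let in_span (f : cell -> K) := exists u : 'rV[K]_#|cond_label|,
  forall a : mon_label, f (mon_cell a) = (u *m C) 0 (enum_rank a).

Lemma in_span_basis q i j : (i + j < mult q)%N ->
  in_span (fun a => ffbasis K i j a * chi (pt q) a).
Proof.
rewrite /mult => ij; have it : (i < (tag q).+1)%N by lia.
have jt : (j < (tag q - Ordinal it).+1)%N by rewrite ltnS leq_subRL -ltnS.
pose lab : cond_label := Tagged (fun q : point_label p => {i : 'I_(tag q).+1 & 'I_(tag q - i).+1})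
  (Tagged (fun i : 'I_(tag q).+1 => 'I_(tag q - i).+1) (Ordinal jt)).
pose X := (pt q).1 * (pt q).2; pose Y := (pt q).2.
(* The factor X^i Y^j restores the exponents lowered by differentiation. *)
exists ((X ^+ i * Y ^+ j) *: delta_mx 0 (enum_rank lab)) => a.
rewrite -scalemxAl mxE -rowE mxE [C _ _]mxE !enum_rankK /entry /point !ffunE /= -/X -/Y.
rewrite /ffbasis /mon_cell expo_corner /cond_exp /=.
set x := (mon_exp a).1; set y := (mon_exp a).2.
have [xi|xi] := ltnP x i; first by rewrite ffact_small // mul0n !mul0r mulr0.
have [yj|yj] := ltnP y j; first by rewrite (ffact_small yj) muln0 !mul0r mulr0.
rewrite [RHS]mulrCA; congr (_ * _); rewrite mulrACA -!exprD !subnKC //.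
rewrite /chi /= (_ : int_of_Z (Z.of_nat x) = x); last by lia.
rewrite (_ : int_of_Z (Z.of_nat (x + y)) = (x + y)%N); last by lia.
by rewrite -!exprnP exprMn exprD mulrA.
Qed.

Lemma in_span_conditions f : conditions Q f -> in_span f.
Proof.
have -> : Q = [seq (mult q, pt q) | q <- L].
  have szQ : size Q = size L by have := congr1 size QL; rewrite !size_map.
  apply: (@eq_from_nth _ (0%N, (1, 1))); first by rewrite size_map.
  move=> i iQ; have q0 : point_label p by case: (L) szQ iQ => [->//|q l] _ _.
  have iL : (i < size L)%N by rewrite -szQ.
  rewrite (nth_map q0) // /pt index_uniq // [LHS]surjective_pairing; congr pair.
  have := congr1 (nth 0%N ^~ i) QL => /=.
  by rewrite (nth_map (0%N, (1, 1))) // (nth_map q0).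
elim: (L) f => [|q l ih] f /=.
  by move=> hf; exists 0 => a; rewrite mul0mx mxE.
case=> l0 [g [hl /ih[u hu] hf]].
have [u' hu'] : in_span (fun a => l0 a * chi (pt q) a).
  apply: (polf_ind_basis (V := fun h => in_span (fun a => h a * chi (pt q) a)) hl).
  - by exists 0 => a; rewrite mul0mx mxE mul0r.
  - move=> f1 f2 [u1 h1] [u2 h2]; exists (u1 + u2) => a.
    by rewrite mulmxDl mxE -h1 -h2 mulrDl.
  - move=> c f1 [u1 h1]; exists (c *: u1) => a.
    by rewrite -scalemxAl mxE -h1 mulrA.
  - by move=> f1 f2 e [u1 h1]; exists u1 => a; rewrite -h1 e.
  exact: in_span_basis.
exists (u' + u) => a; rewrite hf mulmxDl mxE -hu -hu'.
by [].
Qed.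

(** The separating functions lie in the row space of [C]; selecting the columns of the cells of [D]
    turns them into an identity matrix. *)
Lemma rank_ge_cells : (#|[set a | mon_cell a \in D]| <= \rank C)%N.
Proof.
pose DI : {set mon_label} := [set a | mon_cell a \in D]; rewrite -/DI.
have /fin_all_exists[u hu] (c : 'I_#|DI|) : exists u : 'rV[K]_#|cond_label|,
    forall c', (u *m C) 0 (enum_rank (enum_val c')) = (c == c')%:R.
  have inD (c' : 'I_#|DI|) : mon_cell (enum_val c' : mon_label) \in D.
    by have := enum_valP c'; rewrite inE.
  have [f /in_span_conditions[u hu] fE] := Qsep (inD c).
  exists u => c'; rewrite -hu fE //; congr (_%:R); congr nat_of_bool.
  apply/eqP/eqP => [e|->//]; apply: enum_val_inj.
  move: e; rewrite /mon_cell /corner; case: (enum_val c) => [e x]; case: (enum_val c') => [e' x'].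
  rewrite /mon_exp /= => -[hx he].
  have ee : e = e' by apply: val_inj => /=; have := ltn_ord x; have := ltn_ord x'; lia.
  by subst e'; congr existT; apply: val_inj => /=; lia.
pose U := \matrix_(c < #|DI|) u c.
pose S : 'M[K]_(#|mon_label|, #|DI|) := \matrix_(r, c) (r == enum_rank (enum_val c))%:R.
have US : U *m C *m S = 1%:M.
  apply/matrixP => c c'; rewrite !mxE -hu (bigD1 (enum_rank (enum_val c'))) //=.
  rewrite big1 ?addr0 => [|i /negPf ne]; last by rewrite [S _ _]mxE ne mulr0.
  rewrite [S _ _]mxE eqxx mulr1 !mxE; apply: eq_bigr => j _.
  by rewrite !mxE.
rewrite -(@mxrank1 K #|DI|) -US; apply: leq_trans (mxrankM_maxl _ _) _.
exact: mxrankM_maxr.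
Qed.

End FromNS.

End Rank.

(** * Minors and the solution space of the conditions *)

Lemma minor_of_rank (K : fieldType) a b (A : 'M[K]_(a, b)) :
  exists r c, \det (\matrix_(i < \rank A, j < \rank A) A (r i) (c j)) != 0.
Proof.
pose B := rowsub (maxrankfun A) A.
have fB : row_full B^T by rewrite /row_full mxrank_tr; apply: maxrowsub_free.
exists (maxrankfun A), (fullrankfun fB).
have := fullrowsub_unit fB; rewrite unitmxE unitfE -det_tr; apply: etrans.
by congr (\det _ != 0); apply/matrixP => i j; rewrite !mxE.
Qed.

Lemma rank_of_minor (K : fieldType) a b (A : 'M[K]_(a, b)) s (r : 'I_s -> 'I_a) (c : 'I_s -> 'I_b) :
  \det (\matrix_(i, j) A (r i) (c j)) != 0 -> (s <= \rank A)%N.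
Proof.
move=> h; have u : (\matrix_(i, j) A (r i) (c j)) \in unitmx by rewrite unitmxE unitfE.
rewrite -(mxrank_unit u).
have -> : \matrix_(i, j) A (r i) (c j) = (rowsub c (rowsub r A)^T)^T.
  by apply/matrixP => i j; rewrite !mxE.
rewrite mxrank_tr; apply: leq_trans (mxrankS (rowsub_sub _ _)) _.
by rewrite mxrank_tr; apply: mxrankS; apply: rowsub_sub.
Qed.

Section Curves.

Variables (K : fieldType) (m d : nat) (p : 'I_m.+1 -> nat).

Definition mon_mnm (a : mon_label d) : 'X_{1..2} :=
  [multinom (if i == 0%R then (mon_exp a).1 else (mon_exp a).2) | i < 2].

Lemma mdeg_mon_mnm a : mdeg (mon_mnm a) = tag a.
Proof.
rewrite mdegE big_ord_recl big_ord1 !mnmE /= /mon_exp /= subnKC //.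
by rewrite -ltnS.
Qed.

Lemma mon_mnm_inj : injective mon_mnm.
Proof.
move=> a b e; have e1 := congr1 (@mdeg 2) e; have e2 := congr1 (fun f : 'X_{1..2} => f 0) e.
move: e1 e2; rewrite !mdeg_mon_mnm !mnmE /mon_exp /=; case: a b {e} => [u x] [v y] /= e1 e2.
have uv : u = v by apply: val_inj.
by subst v; congr existT; apply: val_inj.
Qed.

Lemma mon_mnm_surj (f : 'X_{1..2}) : (mdeg f <= d)%N -> exists a, mon_mnm a = f.
Proof.
rewrite mdegE big_ord_recl big_ord1 /= => le.
pose e : 'I_d.+1 := Ordinal (le : (f ord0 + f (lift ord0 ord0) < d.+1)%N).
have xe : (f ord0 < e.+1)%N by rewrite ltnS /= leq_addr.
exists (Tagged (fun e : 'I_d.+1 => 'I_e.+1) (Ordinal xe)); apply/mnmP => i.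
rewrite mnmE /mon_exp /=; case: i => [[|[|//]] hi] /=; first by congr (f _); apply: val_inj.
by rewrite addKn; congr (f _); apply: val_inj.
Qed.

Definition to_poly (v : 'rV[K]_#|mon_label d|) : {mpoly K[2]} :=
  \sum_c v 0 c *: 'X_[mon_mnm (enum_val c)].

Lemma to_poly_coef v c : (to_poly v)@_(mon_mnm (enum_val c)) = v 0 c.
Proof.
rewrite raddf_sum /= (bigD1 c) //= big1 ?addr0 => [|i ne].
  by rewrite mcoeffZ mcoeffX eqxx mulr1.
rewrite mcoeffZ mcoeffX; case: eqP => [/mon_mnm_inj/enum_val_inj e|]; last by rewrite mulr0.
by rewrite e eqxx in ne.
Qed.

Lemma to_poly_sum (I : finType) (c : I -> K) (v : I -> 'rV_#|mon_label d|) :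
  \sum_i c i *: to_poly (v i) = to_poly (\sum_i c i *: v i).
Proof.
rewrite /to_poly; under eq_bigr do rewrite scaler_sumr.
rewrite exchange_big /=; apply: eq_bigr => j _; rewrite summxE scaler_suml.
by apply: eq_bigr => i _; rewrite mxE scalerA.
Qed.

Lemma msize_to_poly v : (msize (to_poly v) <= d.+1)%N.
Proof.
apply: leq_trans (msize_sum _ _ _) _; apply/bigmax_leqP => c _.
apply: leq_trans (mmeasureZ_le _ _ _) _; rewrite msizeX mdeg_mon_mnm.
by rewrite ltnS -ltnS.
Qed.

Lemma to_polyP f : (msize f <= d.+1)%N ->
  f = to_poly (\row_c f@_(mon_mnm (enum_val c))).
Proof.
move=> sf; apply/mpolyP => n; have [nd|nd] := leqP (mdeg n) d.
  have [a <-] := mon_mnm_surj nd; rewrite -(enum_rankK a) to_poly_coef mxE.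
  by rewrite enum_rankK.
rewrite !memN_msupp_eq0 //; apply: msize_mdeg_ge; last exact: leq_trans sf nd.
exact: leq_trans (msize_to_poly _) nd.
Qed.

Lemma deriv_to_poly v (al : 'X_{1..2}) (x : 'I_2 -> K) :
  ((to_poly v)^`M[al]).@[x] =
  \sum_c v 0 c * entry (x 0) (x 1) (al 0, al 1) (mon_exp (enum_val c)).
Proof.
rewrite raddf_sum raddf_sum; apply: eq_bigr => c _ /=.
rewrite mderivmZ mevalZ mderivmX mevalZ mevalX; congr (_ * _).
rewrite !big_ord_recl !big_ord0 !muln1 !mulr1 !mnmBE !mnmE /= /entry /=.
by have -> : lift ord0 ord0 = 1 :> 'I_2 by apply: val_inj.
Qed.

Variable x : {ffun coord_label p -> K}.
Let C := condmx d (point x).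

Lemma Gamma_to_poly v : Gamma d x (to_poly v) <-> v *m C^T = 0.
Proof.
split=> [[_ h]|h].
  apply/rowP => r; rewrite !mxE; set j := enum_val r.
  pose al : 'X_{1..2} := [multinom (if i == 0%R then (cond_exp j).1 else (cond_exp j).2) | i < 2].
  have := h (tag j) al; rewrite mdegE big_ord_recl big_ord1 !mnmE /= deriv_to_poly !mnmE /=.
  move=> /(_ _) => h'; rewrite -[RHS]h'.
    by apply: eq_bigr => c _; rewrite !mxE.
  rewrite /cond_exp /=; case: j {h h' al} => [q [i i']] /=.
  have hi := ltn_ord i; have hi' := ltn_ord i'; rewrite ltnS in hi.
  by rewrite ltnS leq_subRL in hi'.
split; first exact: msize_to_poly.
move=> q al; rewrite mdegE big_ord_recl big_ord1 => le.
rewrite (_ : lift ord0 ord0 = 1) in le; last exact: val_inj.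
have it : (al 0%R < (tag q).+1)%N by rewrite ltnS; apply: leq_trans (leq_addr _ _) le.
have jt : (al 1%R < (tag q - Ordinal it).+1)%N by rewrite ltnS leq_subRL.
pose j : cond_label p := Tagged (fun q : point_label p => {i : 'I_(tag q).+1 & 'I_(tag q - i).+1})
  (Tagged (fun i : 'I_(tag q).+1 => 'I_(tag q - i).+1) (Ordinal jt)).
have := congr1 (fun w : 'rV_ _ => w 0 (enum_rank j)) h; rewrite !mxE => h'.
rewrite deriv_to_poly -[RHS]h'; apply: eq_bigr => c _.
by rewrite !mxE enum_rankK.
Qed.

Lemma Gamma_has_dim : has_dim (Gamma d x) (#|mon_label d| - \rank C).
Proof.
rewrite -mxrank_tr -mxrank_ker; set B := row_base (kermx C^T).
exists (fun i => to_poly (row i B)); split.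
  move=> c; rewrite to_poly_sum => h0.
  have {h0} : \sum_i c i *: row i B = 0.
    apply/rowP => k; rewrite -to_poly_coef h0 mcoeff0 mxE.
    by [].
  have -> : \sum_i c i *: row i B = (\row_i c i) *m B.
    by rewrite mulmx_sum_row; apply: eq_bigr => i _; rewrite mxE.
  move=> h i; have fB : row_free B := row_base_free _.
  have : \row_i c i = 0 by apply: (row_free_inj fB); rewrite mul0mx.
  by move/rowP/(_ i); rewrite !mxE.
move=> f; split=> [hf|[c ->]].
  have fE := to_polyP hf.1; rewrite fE in hf *.
  move/Gamma_to_poly/eqP: hf; rewrite -sub_kermx -(eq_row_base (kermx C^T)).
  case/submxP => w ->; exists (w 0); rewrite to_poly_sum mulmx_sum_row.
  by [].
rewrite to_poly_sum; apply/Gamma_to_poly/eqP; rewrite -sub_kermx.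
apply: summx_sub => i _; apply: scalemx_sub; rewrite -(eq_row_base (kermx C^T)).
exact: row_sub.
Qed.

End Curves.

(** * Openness of large rank and one good placement *)

Section Generic.

Variables (K : fieldType) (m d : nat) (p : 'I_m.+1 -> nat).
Variable s : nat.

Let generic_point (q : point_label p) (c : 'I_2) : {mpoly K[#|coord_label p|]} :=
  'X_(enum_rank ((q, c) : coord_label p)).

Let large_rank (x : {ffun coord_label p -> K}) : Prop := (s <= \rank (condmx d (point x)))%N.

(** The equations are minors at the generic point, of every size from [s] on; evaluation at [x]
    turns them into minors at [x]. *)
Lemma large_rank_open : zariski_open large_rank.
Proof.
exists (fun f => exists t r c, (s <= t)%N /\
  f = \det (\matrix_(i < t, j < t) condmx d generic_point (r i) (c j))) => x.
have ev t r c : coord_eval (\det (\matrix_(i < t, j < t) condmx d generic_point (r i) (c j))) x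
    = \det (\matrix_(i < t, j < t) condmx d (point x) (r i) (c j)).
  rewrite /coord_eval -det_map_mx; congr (\det _); apply/matrixP => i j.
  rewrite !mxE /entry rmorphM rmorph_nat; congr (_ * _).
  by rewrite rmorphM !rmorphXn /= !mevalXU !enum_rankK.
split=> [h|[f [t [r [c [st ->]]]]]].
  have [r [c hdet]] := minor_of_rank (condmx d (point x)).
  exists (\det (\matrix_(i, j) condmx d generic_point (r i) (c j))); last by rewrite ev.
  by exists (\rank (condmx d (point x))), r, c.
by rewrite ev => /rank_of_minor; apply: leq_trans.
Qed.

End Generic.

Lemma triangular_decomposition n : exists d r : nat,
  (r <= d)%N /\ (r + sumn (full d) = n)%N.
Proof.
elim: n => [|n [d [r [rd e]]]]; first by exists 0%N, 0%N.
have [lt|ge] := ltnP r d; first by exists d, r.+1; split=> //; rewrite addSn e.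
by exists d.+1, 0%N; split=> //; rewrite /=; lia.
Qed.

Lemma mem_triangle r d x y : (r <= d)%N ->
  (corner x y \in cells (r :: full d)) = (x + y < d)%N || (x + y == d)%N && (x < r)%N.
Proof.
move=> rd; apply/cellsP/orP => [[x' [e [[hx he] le lx]]]|h].
  have xx : x' = x by lia.
  have ee : e = (x + y)%N by lia.
  subst x' e; rewrite /= size_full ltnS in le; rewrite /= size_full subSS in lx.
  case: (ltngtP (x + y)%N d) le lx => // [lt|eq] _ lx; first by left.
  by right; rewrite eq subnn /= in lx *.
exists x, (x + y)%N; rewrite /= size_full subSS; case: h => [lt|/andP[/eqP e xr]]; split=> //.
- by rewrite ltnW.
- have -> : (d - (x + y) = (d - (x + y).+1).+1)%N by lia.
  by rewrite /= nth_full; lia.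
- by rewrite e.
by rewrite e subnn.
Qed.

Section Position.

Variables (K : fieldType) (m d : nat) (p : 'I_m.+1 -> nat) (k : 'I_m.+1).
Hypothesis charK : [pchar K] =i pred0.
Hypothesis k12 : (k <= 12)%N.
Hypothesis pk1 : (6 * m.+1 < p k)%N.
Hypothesis pk2 : (4 * m.+1 * (2 * m + 1) < p k * (k.+1 * k.+2))%N.

Lemma sumn_iota_full n : sumn (iota 1 n) = sumn (full n).
Proof. by have := sumn_iota1 n; have := sumn_full n; lia. Qed.

Lemma exists_large_rank :
  exists x, (minn #|mon_label d| #|cond_label p| <= \rank (condmx d (@point K m p x)))%N.
Proof.
pose L1 := [seq q <- enum (point_label p) | tag q != k].
pose L2 := [seq q <- enum (point_label p) | ~~ (tag q != k)].
pose L := L1 ++ L2.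
have pL : perm_eq L (enum (point_label p)).
  by rewrite /L /L1 /L2 (perm_filterC (fun q : point_label p => tag q != k)).
have uL : uniq L by rewrite (perm_uniq pL) enum_uniq.
have multL2 : [seq mult q | q <- L2] = nseq (p k) k.+1.
  have <- : size L2 = p k.
    rewrite size_filter -sum1_count big_mkcond big_enum /=.
    rewrite (eq_bigr (fun q : point_label p => (tag q == k) : nat)) => [|q _].
      rewrite (sum_sigma _ (fun j : 'I_m.+1 => (j == k) : nat)) (bigD1 k) //= eqxx card_ord muln1.
      by rewrite big1 ?addn0 // => j /negPf ->; rewrite muln0.
    by rewrite negbK; case: (_ == _).
  rewrite -(size_map (@mult m p) L2); apply/all_pred1P/allP => n /mapP[q].
  by rewrite mem_filter negbK => /andP[/eqP e _] ->; rewrite /mult e /= eqxx.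
have sumL : #|cond_label p| =
    (sumn [seq sumn (iota 1 n) | n <- [seq mult q | q <- L1]] + p k * sumn (iota 1 k.+1))%N.
  have -> : (p k * sumn (iota 1 k.+1))%N =
      sumn [seq sumn (iota 1 n) | n <- [seq mult q | q <- L2]].
    rewrite multL2; elim: (p k) => //= n ih; move: ih; rewrite mulSn /= => <-.
    by [].
  rewrite -sumn_cat -!map_cat -/L card_cond_label sumnE -map_comp big_map.
  rewrite (perm_big _ pL) big_enum /=; apply: eq_bigr => q _.
  exact: (esym (sumn_iota_full (mult q))).
(* The staircase is sized by the number of conditions, not by [d]; the comparison with the monomials
   of degree at most [d] comes afterwards. *)
have [d0 [r [rd sumE]]] := triangular_decomposition #|cond_label p|.
have hM : (0 < k.+1 <= 13)%N by [].
have hmu : (k.+1 <= m.+1)%N by apply: ltn_ord.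
have hMs : all (fun n => 0 < n <= m.+1)%N [seq mult q | q <- L1].
  by apply/allP => n /mapP[q _ ->]; rewrite /mult /= ltn_ord.
have harea : (4 * m.+1 ^ 2 < p k * sumn (iota 1 k.+1) + 2 * m.+1)%N.
  by have := sumn_iota1 k.+1; move: pk2; nia.
have [Q QP Qsep] := NS_mixed charK hM hmu hMs pk1 harea rd (etrans sumE sumL).
have QL : map fst Q = [seq mult q | q <- L] by rewrite QP /L map_cat multL2.
exists (torus_point L Q); apply: leq_trans (rank_ge_cells d uL QL Qsep).
have sN : #|mon_label d| = sumn (full d.+1) := card_mon_label d.
have mono a b : (a <= b)%N -> (sumn (full a) <= sumn (full b))%N.
  by move=> ab; have := sumn_full a; have := sumn_full b; nia.
(* Filling by degree makes the staircase and the monomial triangle nested: either all monomials lie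
   in the staircase, or the whole staircase lies in the triangle. Both give the smaller cardinal as
   a lower bound of the rank. *)
have [le|lt] := leqP #|mon_label d| #|cond_label p|.
  rewrite -(@cardsT (mon_label d)); apply/subset_leq_card/subsetP => a _.
  rewrite inE mem_triangle //; apply/orP; left.
  have dd : (d < d0)%N.
    rewrite ltnNge; apply/negP => h; have := mono d0.+1 d.+1 h.
    by move: le; rewrite sN -sumE => le le'; have := leq_trans le' le; rewrite /=; lia.
  have -> : ((mon_exp a).1 + (mon_exp a).2 = tag a)%N.
    by rewrite /mon_exp /= subnKC // -ltnS ltn_ord.
  by apply: leq_ltn_trans dd; rewrite -ltnS ltn_ord.
have szD : size (cells (r :: full d0)) = #|cond_label p| by rewrite size_cells -sumE.
rewrite -szD cardE -(size_map (@mon_cell d)).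
apply: uniq_leq_size; first exact: cells_uniq.
move=> a aD; have [x [y ea]] : exists x y, a = corner x y.
  case/cellsP: (aD) => x [e [ea le lx]]; exists x, (e - x)%N; rewrite ea /corner; congr pair.
  suff : (x <= e)%N by lia.
  move: le lx; rewrite /= size_full ltnS leq_eqVlt => /predU1P[->|ed].
    by rewrite subnn /=; lia.
  rewrite subSS (_ : (d0 - e = (d0 - e.+1).+1)%N) /= ?nth_full; lia.
have xyd : (x + y < d.+1)%N.
  rewrite ltnNge; apply/negP => le; move: aD; rewrite ea mem_triangle //.
  rewrite sN -sumE in lt; case/orP => [h|/andP[/eqP h hr]].
    by have := mono d.+1 d0 (ltnW (leq_ltn_trans le h)); lia.
  by rewrite h in le; have := mono d.+1 d0 le; lia.
have yx : (x < (Ordinal xyd).+1)%N by rewrite ltnS leq_addr.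
pose lab : mon_label d := Tagged (fun e : 'I_d.+1 => 'I_e.+1) (Ordinal yx).
have labE : mon_cell lab = a by rewrite ea /mon_cell /mon_exp /= addKn.
by apply/mapP; exists lab; rewrite ?mem_enum ?inE labE.
Qed.

Lemma card_cond_sum : #|cond_label p| = (\sum_(j < m.+1) p j * sumn (full j.+1))%N.
Proof.
rewrite card_cond_label (sum_sigma _ (fun j : 'I_m.+1 => sumn (full j.+1))).
by apply: eq_bigr => j _; rewrite card_ord.
Qed.

Lemma half_triangle n : ((n.+1 * n.+2)%:R / 2 = (sumn (full n.+1))%:R :> rat).
Proof.
rewrite -(sumn_full n.+1) natrM mulfK //.
Qed.

Lemma expected_dimE : expected_dim d p = (#|mon_label d| - minn #|mon_label d| #|cond_label p|)%:R.
Proof.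
rewrite /expected_dim half_triangle -card_mon_label.
under eq_bigr do rewrite half_triangle -natrM.
rewrite -natr_sum -card_cond_sum; case: (leqP #|mon_label d| #|cond_label p|) => h.
  by rewrite subnn; apply: max_l; rewrite subr_le0 ler_nat.
by rewrite natrB 1?ltnW //; apply: max_r; rewrite subr_ge0 ler_nat ltnW.
Qed.

Lemma expected_dim_generic :
  generically (fun x : {ffun coord_label p -> K} =>
    exists2 n : nat, has_dim (Gamma d x) n & n%:R = expected_dim d p).
Proof.
have [x0 hx0] := exists_large_rank.
set s := minn _ _ in hx0.
exists (fun x => (s <= \rank (condmx d (@point K m p x)))%N); split.
- exact: large_rank_open.
- by apply: (zariski_open_dense charK (x0 := x0)) => //; apply: large_rank_open.
move=> x hx; exists (#|mon_label d| - \rank (condmx d (point x)))%N; first exact: Gamma_has_dim.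
rewrite expected_dimE; congr ((_ - _)%:R); apply/eqP; rewrite eqn_leq hx andbT.
by rewrite leq_min rank_leq_col rank_leq_row.
Qed.

End Position.

Theorem theorem1 (K : fieldType) (charK : [pchar K] =i pred0)
    (m : nat) (k : 'I_m.+1) (k_le12 : (k <= 12)%N) :
  exists r : rat,
    r <= Num.max (6 * (m.+1)%:R)
                 ((4 * m.+1 * (2 * m + 1))%:R / (k.+1 * k.+2)%:R) /\
    forall (d : nat) (p : 'I_m.+1 -> nat),
      r < (p k)%:R ->
      generically (fun x : {ffun coord_label p -> K} =>
        exists2 n : nat, has_dim (Gamma d x) n & n%:R = expected_dim d p).
Proof.
eexists; split=> [|d p]; first exact: lexx.
rewrite gt_max ltr_pdivrMr ?ltr0n // -!natrM !ltr_nat => /andP[h1 h2].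
exact: expected_dim_generic h1 h2.
Qed.
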